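(* Let $m\ge2$ and $\pmb\mu=(\mu_1,\ldots,\mu_m)$ be an $m$-tuple of finite non-negative Borel measures on $\mathbb T$. If $\mathcal H_{\pmb\mu}=\mathcal H(b)$ as sets for some $b\in H^\infty$ with $\|b\|_\infty\le1$, then $\mu_2=\cdots=\mu_m=0$.
   Context: $\mathbb D$ open unit disc, $\mathbb T$ unit circle, $dA$ normalized area measure, $H^2$ Hardy space, $H^\infty$ bounded holomorphic functions on $\mathbb D$ with sup norm. For a measure $\mu$, $P_\mu(z)=\int_{\mathbb T}\frac{1-|z|^2}{|z-\zeta|^2}d\mu(\zeta)$, $D_{\mu,j}(f)=\frac{1}{j!(j-1)!}\int_{\mathbb D}|f^{(j)}|^2P_\mu(1-|z|^2)^{j-1}dA$ ($j\ge1$), $\mathcal H_{\mu,j}=\{f\in\mathcal O(\mathbb D):D_{\mu,j}(f)<\infty\}$ if $\mu\ne0$ and $H^2$ if $\mu=0$. $\mathcal H_{\pmb\mu}=\bigcap_{j=1}^m\mathcal H_{\mu_j,j}$ with norm $\|f\|^2_{\pmb\mu}=\|f\|_{H^2}^2+\sum_jD_{\mu_j,j}(f)$. For $b$ in the closed unit ball of $H^\infty$, the de Branges–Rovnyak space $\mathcal H(b)$ is the reproducing kernel Hilbert space on $\mathbb D$ with kernel $\frac{1-b(z)\overline{b(w)}}{1-z\overline w}$. *)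

(* Defs.v *)
From HB Require Import structures.
From mathcomp Require Import all_boot all_order all_algebra.
From mathcomp Require Import all_classical all_reals all_analysis.
From mathcomp.real_closed Require Import complex.
Set Implicit Arguments. Unset Strict Implicit. Unset Printing Implicit Defensive.
Import Order.TTheory GRing.Theory Num.Theory.
Import numFieldNormedType.Exports.
Local Open Scope classical_set_scope.
Local Open Scope ring_scope.

Definition cnorm {R : realType} (z : R[i]) : R := Num.sqrt (complex.Re z ^+ 2 + complex.Im z ^+ 2).
Definition cconj {R : realType} (z : R[i]) : R[i] := Complex (complex.Re z) (- complex.Im z).
Definition disc {R : realType} : set R[i] := [set z | cnorm z < 1].

Definition is_cderiv {R : realType} (f : R[i] -> R[i]) (z l : R[i]) : Prop :=
  forall e : R, 0 < e -> exists2 d : R, 0 < d &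
    forall h : R[i], h != 0 -> cnorm h < d -> cnorm ((f (z + h) - f z) / h - l) < e.

Definition holomorphic_on_disc {R : realType} (f : R[i] -> R[i]) : Prop :=
  forall z, disc z -> exists l, is_cderiv f z l.

(** the complex derivative (meaningful at points of D where f is holomorphic) *)
Definition cderiv {R : realType} (f : R[i] -> R[i]) : R[i] -> R[i] :=
  fun z => xget 0 [set l | is_cderiv f z l].
Definition cderivn {R : realType} (n : nat) (f : R[i] -> R[i]) : R[i] -> R[i] :=
  iter n cderiv f.

Definition H2 {R : realType} (f : R[i] -> R[i]) : Prop :=
  holomorphic_on_disc f /\
  exists M : R, forall N : nat,
    \sum_(n < N) cnorm (cderivn n f 0 / (n`!)%:R) ^+ 2 <= M.

Definition Hinf_ball {R : realType} (b : R[i] -> R[i]) : Prop :=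
  holomorphic_on_disc b /\ forall z, disc z -> cnorm (b z) <= 1.

(** The plane R^2 (with the product = Borel sigma-algebra) identified with C *)
Definition to_C {R : realType} (p : R * R) : R[i] := Complex p.1 p.2.
Definition circle {R : realType} : set (R * R) := [set p | p.1 ^+ 2 + p.2 ^+ 2 = 1].
Definition discR {R : realType} : set (R * R) := [set p | p.1 ^+ 2 + p.2 ^+ 2 < 1].

(** Finite nonnegative Borel measures on T are finite measures on R^2
    carried by the unit circle. *)
Definition finite_measure_R2 (R : realType) :=
  {finite_measure set (R * R)%type -> \bar R}.

Definition on_circle {R : realType} (mu : finite_measure_R2 R) : Prop :=
  mu (~` circle) = 0%E.

Definition zero_measure {R : realType} (mu : finite_measure_R2 R) : Prop :=
  forall A : set (R * R), measurable A -> mu A = 0%E.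

Definition Poisson {R : realType} (mu : finite_measure_R2 R) (z : R[i]) : \bar R :=
  (\int[mu]_(p in circle)
     ((1 - cnorm z ^+ 2) / cnorm (z - to_C p) ^+ 2)%:E)%E.

(** normalized area measure dA = dx dy / pi; D_{mu,j}(f) *)
Definition Dmu {R : realType} (mu : finite_measure_R2 R) (j : nat)
    (f : R[i] -> R[i]) : \bar R :=
  (\int[(@lebesgue_measure R \x @lebesgue_measure R)%E]_(p in discR)
     ((cnorm (cderivn j f (to_C p)) ^+ 2
        * (1 - cnorm (to_C p) ^+ 2) ^+ (j - 1)
        / ((j`!)%:R * ((j - 1)`!)%:R * pi))%:E * Poisson mu (to_C p)))%E.

Definition Hmu {R : realType} (mu : finite_measure_R2 R) (j : nat)
    (f : R[i] -> R[i]) : Prop :=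
  (zero_measure mu -> H2 f) /\
  (~ zero_measure mu -> holomorphic_on_disc f /\ (Dmu mu j f < +oo)%E).

Definition Hvec {R : realType} (m : nat) (mu : nat -> finite_measure_R2 R)
    (f : R[i] -> R[i]) : Prop :=
  forall j : nat, (1 <= j <= m)%N -> Hmu (mu j) j f.

(** de Branges-Rovnyak space H(b): the RKHS of the kernel
    K(z,w) = (1 - b(z) conj(b(w)))/(1 - z conj(w)), built by the
    Moore-Aronszajn construction: pointwise limits on D of sequences of finite
    combinations sum_i c_i K(., w_i) (w_i in D) that are Cauchy for the
    kernel norm. *)
Definition dBR_kernel {R : realType} (b : R[i] -> R[i]) (z w : R[i]) : R[i] :=
  (1 - b z * cconj (b w)) / (1 - z * cconj w).

Definition kcomb {R : realType} (b : R[i] -> R[i]) (s : seq (R[i] * R[i]))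
    (z : R[i]) : R[i] :=
  \sum_(x <- s) x.1 * dBR_kernel b z x.2.

Definition knorm2 {R : realType} (b : R[i] -> R[i]) (s : seq (R[i] * R[i])) : R :=
  complex.Re (\sum_(x <- s) \sum_(y <- s) y.1 * cconj x.1 * dBR_kernel b x.2 y.2).

Definition kneg {R : realType} (s : seq (R[i] * R[i])) : seq (R[i] * R[i]) :=
  map (fun x => (- x.1, x.2)) s.

Definition dBR_space {R : realType} (b : R[i] -> R[i]) (f : R[i] -> R[i]) : Prop :=
  exists S : nat -> seq (R[i] * R[i]),
    (forall n x, x \in S n -> disc x.2) /\
    (forall e : R, 0 < e -> exists N : nat, forall n k : nat, (N <= n)%N -> (N <= k)%N ->
        knorm2 b (S n ++ kneg (S k)) < e) /\
    (forall z, disc z -> forall e : R, 0 < e -> exists N : nat, forall n : nat, (N <= n)%N ->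
        cnorm (kcomb b (S n) z - f z) < e).

(* Main.v *)
Require Import Defs.
From HB Require Import structures.
From mathcomp Require Import all_boot all_order all_algebra.
From mathcomp Require Import all_classical all_reals all_analysis.
From mathcomp Require Import measurable_realfun.
From mathcomp.real_closed Require Import complex.
From mathcomp Require Import zify ring lra.
Set Implicit Arguments. Unset Strict Implicit. Unset Printing Implicit Defensive.
Import Order.TTheory GRing.Theory Num.Theory.
Import numFieldNormedType.Exports.
Local Open Scope classical_set_scope.
Local Open Scope ring_scope.

(* Suppose [mu_j <> 0] for some [j >= 2].  Since [P_mu z >= c (1 - |z|^2)], the
   finiteness of [D_{mu,j} f] and the area mean value estimate on squares of
   side comparable to [1 - |w|] give [|f^(j) w| <= K (1 - |w|)^-j], so every [f]
   in H(b) grows at most logarithmically, in particular at most like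
   [(1 - |w|)^(-1/4)].  If [1 - |b|^2] did not tend to 0 at the circle, some
   points [w_n] tending rapidly to it would have kernel norms
   [>= c (1 - |w_n|)^(-1/2)], and a gliding hump of normalised kernels would be
   an element of H(b) violating this growth bound.  Hence [|b| -> 1] uniformly.

   On the other hand every [k_v z = 1 / (1 - conj v * z)] lies in H_mu, its
   derivatives being bounded and [P_mu] being integrable on the disc, hence in
   H(b).  By duality [|sum_i conj c_i k_v(z_i)|] is at most [K] times the norm of
   [sum_i c_i K(., z_i)].  For [c_i = b(z_i) / N] and [z_i] the [N] rotates of a
   point of the circle of radius [r], Parseval bounds that squared norm by
   [4 max (1 - |b|^2)] as soon as [r^(2N) <= 1/2], whereas the average of the
   left-hand sum over the circle is [conj (b (r^2 v))].  Letting [r -> 1]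
   gives [b v = 0], contradicting [|b| -> 1]. *)

(** The case [j = 1] has to escape, and it does so by an exponent: the area estimate really gives
    |f^(j)| = O((1 - |w|)^(-(j+2)/2)), which is within the stated (1 - |w|)^-j exactly when j >= 2.
    For j = 1, integrating yields only (1 - |w|)^(-1/2), a growth that kernels have anyway. The
    exponent 1/4 replaces the logarithm because it is enough to stay below 1/2.

    Only an equality of sets is given, so no norms are compared: H(b) in H_mu serves for the hump,
    H_mu in H(b) for the k_v.

    The second half is a quantitative form of a fact on inner functions: if |b| = 1 on the circle,
    H(b) is the orthogonal complement of b H^2 in H^2, so that <k_v, b> = conj (b v) must vanish.
    Circles of radius r < 1 and finitely many points avoid boundary values. The coefficients b(z_i)
    / N discretise the pairing with b: up to the factor 1 / (1 - r^(2N)), the Szego part of their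
    squared norm is at most 1, while the subtracted part is close to 1, since |b|^2 is nearly the
    constant 1 and its Fourier mass sits at frequency 0. *)

Local Notation Re := complex.Re.
Local Notation Im := complex.Im.
Local Notation lebR := lebesgue_measure.

(** * Complex differentiation *)

Section cnorm.
Context {R : realType}.
Implicit Types z w u : R[i].

Lemma normC_cnorm z : `|z| = (cnorm z)%:C%C.
Proof. by rewrite normc_def. Qed.

Lemma cnorm_ge0 z : 0 <= cnorm z. Proof. exact: sqrtr_ge0. Qed.

Lemma cnormM z w : cnorm (z * w) = cnorm z * cnorm w.
Proof. by apply: complexI; rewrite rmorphM /= -!normC_cnorm normrM. Qed.

Lemma cnormD z w : cnorm (z + w) <= cnorm z + cnorm w.
Proof. by rewrite -lecR rmorphD /= -!normC_cnorm ler_normD. Qed.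

Lemma cnormN z : cnorm (- z) = cnorm z.
Proof. by apply: complexI; rewrite -!normC_cnorm normrN. Qed.

Lemma cnormB z w : cnorm (z - w) <= cnorm z + cnorm w.
Proof. by rewrite -(cnormN w) cnormD. Qed.

Lemma cdistC z w : cnorm (z - w) = cnorm (w - z).
Proof. by rewrite -cnormN opprB. Qed.

Lemma cdistD u z w : cnorm (z - w) <= cnorm (z - u) + cnorm (u - w).
Proof. by rewrite (le_trans _ (cnormD _ _))// addrA subrK. Qed.

Lemma cnorm_sub_ge z w : cnorm z - cnorm w <= cnorm (z - w).
Proof. by rewrite lerBlDr -{1}(subrK w z) cnormD. Qed.

Lemma cnormV z : cnorm z^-1 = (cnorm z)^-1.
Proof. by apply: complexI; rewrite fmorphV /= -!normC_cnorm normfV. Qed.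

Lemma cnorm_div z w : cnorm (z / w) = cnorm z / cnorm w.
Proof. by rewrite cnormM cnormV. Qed.

Lemma cnormX z n : cnorm (z ^+ n) = cnorm z ^+ n.
Proof. by apply: complexI; rewrite rmorphXn /= -!normC_cnorm normrX. Qed.

Lemma cnorm0 : cnorm (0 : R[i]) = 0.
Proof. by apply: complexI; rewrite -normC_cnorm normr0. Qed.

Lemma cnorm1 : cnorm (1 : R[i]) = 1.
Proof. by apply: complexI; rewrite -normC_cnorm normr1. Qed.

Lemma cnorm_eq0 z : (cnorm z == 0) = (z == 0).
Proof. by rewrite -(inj_eq (@complexI _)) -normC_cnorm normr_eq0. Qed.

Lemma cnorm_gt0 z : (0 < cnorm z) = (z != 0).
Proof. by rewrite lt_def cnorm_ge0 andbT cnorm_eq0. Qed.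

Lemma cnorm_real (x : R) : cnorm x%:C%C = `|x|.
Proof. by rewrite /cnorm/= expr0n addr0 sqrtr_sqr. Qed.

Lemma cnorm_nat n : cnorm (n%:R : R[i]) = n%:R.
Proof. by rewrite -(rmorph_nat (real_complex R)) cnorm_real normr_nat. Qed.

Lemma cnorm_i : cnorm ('i%C : R[i]) = 1.
Proof. by rewrite /cnorm/= expr0n expr1n add0r sqrtr1. Qed.

Lemma cnorm_sqr z : cnorm z ^+ 2 = Re z ^+ 2 + Im z ^+ 2.
Proof. by rewrite sqr_sqrtr// addr_ge0 ?sqr_ge0. Qed.

Lemma normr_Re_le z : `|Re z| <= cnorm z.
Proof. by rewrite -sqrtr_sqr ler_wsqrtr// lerDl sqr_ge0. Qed.

Lemma normr_Im_le z : `|Im z| <= cnorm z.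
Proof. by rewrite -sqrtr_sqr ler_wsqrtr// lerDr sqr_ge0. Qed.

Lemma Re_le_cnorm z : Re z <= cnorm z.
Proof. exact: le_trans (ler_norm _) (normr_Re_le z). Qed.

Lemma cnorm_le_ReIm z : cnorm z <= `|Re z| + `|Im z|.
Proof.
rewrite -(@ler_pXn2r _ 2) ?nnegrE ?cnorm_ge0 ?addr_ge0//.
rewrite cnorm_sqr sqrrD !real_normK ?num_real//.
by rewrite lerD2r lerDl pmulrn_lge0// mulr_ge0.
Qed.

Lemma ReD z w : Re (z + w) = Re z + Re w. Proof. by case: z w => [? ?] []. Qed.
Lemma ImD z w : Im (z + w) = Im z + Im w. Proof. by case: z w => [? ?] []. Qed.
Lemma ReN z : Re (- z) = - Re z. Proof. by case: z. Qed.
Lemma ImN z : Im (- z) = - Im z. Proof. by case: z. Qed.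
Lemma ReM z w : Re (z * w) = Re z * Re w - Im z * Im w. Proof. by case: z w => [? ?] []. Qed.
Lemma ImM z w : Im (z * w) = Re z * Im w + Im z * Re w. Proof. by case: z w => [? ?] []. Qed.
Lemma ReZ (a : R) z : Re (a%:C%C * z) = a * Re z.
Proof. by rewrite ReM /= mul0r subr0. Qed.
Lemma ImZ (a : R) z : Im (a%:C%C * z) = a * Im z.
Proof. by rewrite ImM /= mul0r addr0. Qed.

Lemma complexP z w : Re z = Re w -> Im z = Im w -> z = w.
Proof. by case: z w => [? ?] [? ?] /= -> ->. Qed.

Lemma cconjD z w : cconj (z + w) = cconj z + cconj w.
Proof. by apply: complexP; rewrite /= ?ReD ?ImD//= opprD. Qed.
Lemma cconjN z : cconj (- z) = - cconj z.
Proof. by apply: complexP; rewrite /= ?ReN ?ImN. Qed.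
Lemma cconjM z w : cconj (z * w) = cconj z * cconj w.
Proof. by apply: complexP; rewrite /= ?ReM ?ImM//= ?mulrNN ?mulrN ?mulNr// opprD. Qed.
Lemma cconjK z : cconj (cconj z) = z.
Proof. by apply: complexP; rewrite //= opprK. Qed.
Lemma cconj_real (a : R) : cconj a%:C%C = a%:C%C.
Proof. by rewrite /cconj/= oppr0. Qed.
Lemma cconj0 : cconj (0 : R[i]) = 0. Proof. exact: cconj_real. Qed.
Lemma cconj1 : cconj (1 : R[i]) = 1. Proof. exact: cconj_real. Qed.
Lemma cconj_nat n : cconj (n%:R : R[i]) = n%:R.
Proof. by rewrite -(rmorph_nat (real_complex R)) cconj_real. Qed.
Lemma Re_real (x : R) : Re x%:C%C = x. Proof. by []. Qed.
Lemma Re_conj z : Re (cconj z) = Re z. Proof. by []. Qed.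
Lemma mulcconj z : z * cconj z = (cnorm z ^+ 2)%:C%C.
Proof.
apply: complexP; rewrite ?ReM ?ImM/= ?cnorm_sqr; last by rewrite mulrN mulrC addNr.
by rewrite mulrN opprK !expr2.
Qed.
Lemma cconjV z : cconj z^-1 = (cconj z)^-1.
Proof.
have [->|z0] := eqVneq z 0; first by rewrite invr0 cconj0 invr0.
have cz0 : cconj z != 0.
  by apply: contraNneq z0 => h; rewrite -(cconjK z) h cconj0.
by apply: (mulfI cz0); rewrite -cconjM mulfV// cconj1 mulfV.
Qed.
Lemma cnorm_conj z : cnorm (cconj z) = cnorm z.
Proof. by rewrite /cnorm/= sqrrN. Qed.
Lemma cconj_sum I (r : seq I) P (F : I -> R[i]) :
  cconj (\sum_(i <- r | P i) F i) = \sum_(i <- r | P i) cconj (F i).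
Proof. exact: (big_morph _ cconjD cconj0). Qed.
End cnorm.

Section klim.
Context {K : numFieldType} {T : Type} {F : set_system T} {FF : Filter F}.
Implicit Types f g : T -> K.

Definition klim (G : set_system T) f (l : K) :=
  forall e : K, 0 < e -> G [set x | `|l - f x| < e].

Lemma klimP f l : klim F f l <-> f @ F --> l.
Proof. by split => [h|/cvgrPdist_lt h]; [apply/cvgrPdist_lt|exact: h]. Qed.

Lemma klimM f g a b : klim F f a -> klim F g b -> klim F (fun x => f x * g x) (a * b).
Proof. by rewrite !klimP; exact: cvgM. Qed.

Lemma klimV f a : a != 0 -> klim F f a -> klim F (fun x => (f x)^-1) a^-1.
Proof. by rewrite !klimP; exact: cvgV. Qed.

End klim.

Section clim.
Context {R : realType} {T : Type} {F : set_system T} {FF : Filter F}.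
Implicit Types f g : T -> R[i].

Definition clim (G : set_system T) f (l : R[i]) :=
  forall e : R, 0 < e -> G [set x | cnorm (f x - l) < e].

(** The tolerances of [klim] are positive elements of [R[i]], hence real; so limits measured by
    [cnorm] inherit products and inverses from the normed field [R[i]]. *)
Lemma clim_klim f l : clim F f l <-> klim F f l.
Proof.
split=> h e e0.
  have ee : e = (Re e)%:C%C.
    by case: e e0 => a b; rewrite ltcE /= => /andP[/eqP -> _].
  have e0' : 0 < Re e by move: e0; rewrite ltcE => /andP[].
  apply: filterS (h _ e0') => x /=.
  by rewrite normC_cnorm ee ltcR cdistC.
have : (0 : R[i]) < e%:C%C by rewrite (ltcR 0 e).
move=> /h; apply: filterS => x /=.
by rewrite normC_cnorm ltcR cdistC.
Qed.

Lemma clim_cst l : clim F (fun=> l) l.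
Proof. by move=> e e0; apply: filterE => x /=; rewrite subrr cnorm0. Qed.

Lemma climD f g a b : clim F f a -> clim F g b -> clim F (fun x => f x + g x) (a + b).
Proof.
move=> fa gb e e0; apply: filterS2 (fa (e / 2) _) (gb (e / 2) _); rewrite ?divr_gt0// => x /= h1 h2.
rewrite opprD addrACA (le_lt_trans (cnormD _ _))// [ltRHS]splitr; exact: ltrD.
Qed.

Lemma climN f a : clim F f a -> clim F (fun x => - f x) (- a).
Proof. by move=> fa e e0; apply: filterS (fa e e0) => x /=; rewrite -opprD cnormN. Qed.

Lemma climB f g a b : clim F f a -> clim F g b -> clim F (fun x => f x - g x) (a - b).
Proof. by move=> fa gb; apply: climD => //; exact: climN. Qed.

Lemma climM f g a b : clim F f a -> clim F g b -> clim F (fun x => f x * g x) (a * b).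
Proof. by rewrite !clim_klim; exact: klimM. Qed.

Lemma climV f a : a != 0 -> clim F f a -> clim F (fun x => (f x)^-1) a^-1.
Proof. by rewrite !clim_klim; exact: klimV. Qed.

Lemma clim_conj f a : clim F f a -> clim F (fun x => cconj (f x)) (cconj a).
Proof.
by move=> fa e e0; apply: filterS (fa e e0) => x /=; rewrite -cconjN -cconjD cnorm_conj.
Qed.

Lemma clim_ReIm f a : clim F f a <->
  (Re (f x) @[x --> F] --> Re a) /\ (Im (f x) @[x --> F] --> Im a).
Proof.
split=> [fa|[/cvgrPdist_lt fr /cvgrPdist_lt fi] e e0].
  split; apply/cvgrPdist_lt => e e0; apply: filterS (fa e e0) => x /=;
    rewrite cdistC; apply: le_lt_trans.
    by rewrite -ReN -ReD normr_Re_le.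
  by rewrite -ImN -ImD normr_Im_le.
apply: filterS2 (fr (e / 2) _) (fi (e / 2) _); rewrite ?divr_gt0// => x /= h1 h2.
rewrite cdistC (le_lt_trans (cnorm_le_ReIm _))// ReD ReN ImD ImN [ltRHS]splitr; exact: ltrD.
Qed.

Lemma clim_sum I (r : seq I) (f : I -> T -> R[i]) (l : I -> R[i]) :
  (forall i, clim F (f i) (l i)) ->
  clim F (fun x => \sum_(i <- r) f i x) (\sum_(i <- r) l i).
Proof.
move=> h; elim: r => [|i r ih].
  by rewrite big_nil; under eq_fun do rewrite big_nil; exact: clim_cst.
by rewrite big_cons; under eq_fun do rewrite big_cons; exact: climD.
Qed.

End clim.

(** * Continuity and rules for complex derivatives *)

Section ccts.
Context {R : realType}.
Local Notation C := R[i].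

Definition cnbhs (z : C) : set_system C :=
  [set A | exists2 d : R, 0 < d & forall w, cnorm (w - z) < d -> A w].

Global Instance cnbhs_filter z : Filter (cnbhs z).
Proof.
constructor.
- by exists 1.
- move=> A B [d d0 dA] [e e0 eB]; exists (Num.min d e); first by rewrite lt_min d0.
  by move=> w; rewrite lt_min => /andP[/dA ? /eB].
- by move=> A B AB [d d0 dA]; exists d => // w /dA /AB.
Qed.

Definition ccts (f : C -> C) z := clim (cnbhs z) f (f z).

Lemma ccts_id z : ccts id z.
Proof. by move=> e e0; exists e. Qed.

Lemma clim_comp T (F : set_system T) {FF : Filter F} (f : C -> C) (g : T -> C) a :
  clim F g a -> ccts f a -> clim F (fun x => f (g x)) (f a).
Proof.
move=> ga fa e e0; have [d d0 dE] := fa e e0.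
by apply: filterS (ga d d0) => x /=; exact: dE.
Qed.

Lemma ccts_cst c z : ccts (fun=> c) z. Proof. exact: clim_cst. Qed.

Lemma cctsB f g z : ccts f z -> ccts g z -> ccts (fun w => f w - g w) z.
Proof. exact: climB. Qed.

Lemma cctsM f g z : ccts f z -> ccts g z -> ccts (fun w => f w * g w) z.
Proof. exact: climM. Qed.

Lemma cctsV f z : f z != 0 -> ccts f z -> ccts (fun w => (f w)^-1) z.
Proof. exact: climV. Qed.

Lemma cctsX f n z : ccts f z -> ccts (fun w => f w ^+ n) z.
Proof.
move=> cf; elim: n => [|n ih]; first exact: ccts_cst.
rewrite (_ : (fun w => _) = fun w => f w * f w ^+ n); first exact: cctsM.
by apply/funext => w; rewrite exprS.
Qed.

(** Caratheodory's form of differentiability: without division, the product, quotient and chain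
    rules become algebra on slopes. The slope [q] also serves later as the difference quotient with
    its singularity removed in Cauchy's formula. *)
Lemma is_cderiv_factor (f : C -> C) z l : is_cderiv f z l <->
  exists2 q : C -> C, clim (cnbhs z) q l & q z = l /\ forall w, f w - f z = q w * (w - z).
Proof.
split=> [h|[q qc [qz qE]] e e0].
  exists (fun w => if w == z then l else (f w - f z) / (w - z)); last first.
    split; first by rewrite eqxx.
    move=> w; case: eqVneq => [->|wz]; first by rewrite !subrr mulr0.
    by rewrite divfK// subr_eq0.
  move=> e e0; have [d d0 dE] := h e e0; exists d => // w wd /=.
  case: eqVneq => [_|wz]; first by rewrite subrr cnorm0.
  have := dE (w - z); rewrite subr_eq0 (addrC z) subrK; exact.
have [d d0 dE] := qc e e0; exists d => // h h0 hd.
by rewrite qE (addrC z) addrK mulfK// dE//= addrK.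
Qed.

Lemma is_cderiv_ccts (f : C -> C) z l : is_cderiv f z l -> ccts f z.
Proof.
move=> /is_cderiv_factor[q qc [qz qE]].
have -> : f = (fun w => f z + q w * (w - z)).
  by apply/funext => w; rewrite -qE addrC subrK.
rewrite /ccts subrr mulr0; apply: climD; first exact: clim_cst.
rewrite -[X in clim _ _ X](mulr0 l); apply: climM => //.
by rewrite -(subrr z); apply: climB; [exact: ccts_id|exact: clim_cst].
Qed.

Lemma is_cderiv_unique (f : C -> C) z l l' : is_cderiv f z l -> is_cderiv f z l' -> l = l'.
Proof.
move=> h h'; apply/eqP; rewrite -subr_eq0 -cnorm_eq0; apply/negP => /negP n0.
have e0 : 0 < cnorm (l - l') / 2 by rewrite divr_gt0// lt_def n0 cnorm_ge0.
have [d d0 dE] := h _ e0; have [d' d'0 d'E] := h' _ e0.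
pose x := Num.min d d' / 2.
have x0 : 0 < x by rewrite divr_gt0// lt_min d0.
have xd : x < Num.min d d' by rewrite ltr_pdivrMr// mulr_natr mulr2n ltrDl lt_min d0.
move: xd; rewrite lt_min => /andP[xd xd'].
have xC0 : x%:C%C != 0 :> C by rewrite -cnorm_gt0 cnorm_real gtr0_norm.
have := dE x%:C%C xC0; have := d'E x%:C%C xC0.
rewrite cnorm_real gtr0_norm// => /(_ xd') h1 /(_ xd) h2.
have := ltrD h2 h1; rewrite -splitr ltNge => /negP; apply.
rewrite (cdistC _ l); exact: cdistD.
Qed.

Lemma is_cderivE (f : C -> C) z l : is_cderiv f z l -> cderiv f z = l.
Proof.
move=> h; rewrite /cderiv; case: xgetP => [l' -> /= h'|/(_ l)//].
exact: is_cderiv_unique h' h.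
Qed.

Lemma is_cderiv_near (f g : C -> C) z l : (cnbhs z) [set w | f w = g w] ->
  is_cderiv f z l -> is_cderiv g z l.
Proof.
move=> [d0 d00 fg] h e e0; have [d dd0 dE] := h e e0.
exists (Num.min d d0); first by rewrite lt_min dd0.
move=> u u0; rewrite lt_min => /andP[ud ud0].
rewrite -!fg ?dE//= ?subrr ?cnorm0//.
by rewrite (addrC z) addrK.
Qed.

Lemma is_cderiv_cst c z : is_cderiv (fun=> c : C) z 0.
Proof. by move=> e e0; exists 1 => // h _ _; rewrite subrr mul0r subrr cnorm0. Qed.

Lemma is_cderiv_id z : is_cderiv (fun w : C => w) z 1.
Proof.
by move=> e e0; exists 1 => // h h0 _; rewrite (addrC z) addrK mulfV// subrr cnorm0.
Qed.

Lemma is_cderivD (f g : C -> C) z a b : is_cderiv f z a -> is_cderiv g z b ->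
  is_cderiv (fun w => f w + g w) z (a + b).
Proof.
move=> /is_cderiv_factor[q qc [qz qE]] /is_cderiv_factor[p pc [pz pE]].
apply/is_cderiv_factor; exists (fun w => q w + p w); first exact: climD.
by split=> [|w]; rewrite ?qz ?pz// mulrDl -qE -pE opprD addrACA.
Qed.

Lemma is_cderivM (f g : C -> C) z a b : is_cderiv f z a -> is_cderiv g z b ->
  is_cderiv (fun w => f w * g w) z (a * g z + f z * b).
Proof.
move=> fa gb; have gc := is_cderiv_ccts gb; move: fa gb.
move=> /is_cderiv_factor[q qc [qz qE]] /is_cderiv_factor[p pc [pz pE]].
apply/is_cderiv_factor; exists (fun w => q w * g w + f z * p w).
  by apply: climD; apply: climM => //; exact: clim_cst.
split=> [|w]; rewrite ?qz ?pz// mulrDl -mulrA (mulrC (g w)) mulrA -qE -[f z * _ * _]mulrA -pE.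
by ring.
Qed.

Lemma is_cderivZ c (f : C -> C) z a : is_cderiv f z a ->
  is_cderiv (fun w => c * f w) z (c * a).
Proof.
by move=> h; have := is_cderivM (is_cderiv_cst c z) h; rewrite mul0r add0r.
Qed.

Lemma is_cderivN (f : C -> C) z a : is_cderiv f z a -> is_cderiv (fun w => - f w) z (- a).
Proof.
move=> h; rewrite -mulN1r; under [X in is_cderiv X]funext do rewrite -mulN1r.
exact: is_cderivZ.
Qed.

Lemma is_cderivB (f g : C -> C) z a b : is_cderiv f z a -> is_cderiv g z b ->
  is_cderiv (fun w => f w - g w) z (a - b).
Proof. by move=> fa gb; apply: is_cderivD => //; exact: is_cderivN. Qed.

Lemma is_cderivV (f : C -> C) z a : f z != 0 -> is_cderiv f z a ->
  is_cderiv (fun w => (f w)^-1) z (- a / f z ^+ 2).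
Proof.
move=> fz0 fa; have fc := is_cderiv_ccts fa.
have [d0 d00 dE0] : (cnbhs z) [set w | f w != 0].
  have := fc (cnorm (f z)); rewrite cnorm_gt0 => /(_ fz0).
  apply: filterS => w /=; apply: contraTneq => ->.
  by rewrite sub0r cnormN ltxx.
move: fa => /is_cderiv_factor[q qc [qz qE]].
pose g w := if f w == 0 then (f z)^-1 - (1 * (w - z)) else (f w)^-1.
(* Near [z], where [f] does not vanish, this function coincides with [1 / f] and displays its
   slope. *)
suff : is_cderiv (fun w => (f z)^-1 + (- q w / (f w * f z)) * (w - z)) z (- a / f z ^+ 2).
  apply: is_cderiv_near; exists d0 => // w /dE0/= fw0.
  rewrite -mulrA [_^-1 * _]mulrC mulrA mulNr -qE; field.
  by rewrite fw0 fz0.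
apply/is_cderiv_factor; exists (fun w => - q w / (f w * f z)).
  apply: climM; first exact: climN.
  apply: climV; first by rewrite mulf_neq0.
  by rewrite expr2; apply: climM => //; exact: clim_cst.
split=> [|w]; first by rewrite qz expr2.
by rewrite subrr mulr0 addr0 addrC addKr.
Qed.

Lemma is_cderiv_comp (f g : C -> C) z a b : is_cderiv g z a -> is_cderiv f (g z) b ->
  is_cderiv (fun w => f (g w)) z (b * a).
Proof.
move=> ga; have gc := is_cderiv_ccts ga; move: ga.
move=> /is_cderiv_factor[q qc [qz qE]] /is_cderiv_factor[p pc [pz pE]].
apply/is_cderiv_factor; exists (fun w => p (g w) * q w); last first.
  by split=> [|w]; rewrite ?qz ?pz// pE qE mulrA.
apply: climM => //; rewrite -pz; apply: clim_comp => //.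
by rewrite /ccts pz.
Qed.

End ccts.

(** * Integrals over segments and Goursat's theorem *)

Section rintegral.
Context {R : realType}.
Implicit Types f g : R -> R.

(** Continuity is two-sided even at the endpoints: the integrands are restrictions of functions
    continuous at each point of the path in the plane. *)
Definition rcts_on (a b : R) f := forall t, a <= t <= b -> f x @[x --> t] --> f t.

Lemma rcts_integrable a b f : rcts_on a b f -> lebR.-integrable `[a, b] (EFin \o f).
Proof.
move=> cf; apply: continuous_compact_integrable; first exact: segment_compact.
apply: continuous_in_subspaceT => x; rewrite inE/= in_itv/= => xab.
exact: cf.
Qed.

Lemma Rintegral_split a b c f : a <= b -> b <= c -> rcts_on a c f ->
  \int[lebR]_(x in `[a, c]) f x = \int[lebR]_(x in `[a, b]) f x + \int[lebR]_(x in `[b, c]) f x.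
Proof.
move=> ab bc cf; have If := rcts_integrable cf.
rewrite -(@Rintegral_itv_obnd_cbnd _ b); last first.
  by apply: integrableS If => //; apply: subset_itv; rewrite bnd_simp.
rewrite -(Rintegral_itvB If) ?bnd_simp//; ring.
Qed.

Lemma Rintegral_segment_cst (a b c : R) : a <= b -> \int[lebR]_(x in `[a, b]) c = c * (b - a).
Proof.
move=> ab; rewrite Rintegral_cst//= lebesgue_measure_itv/= lte_fin.
by case: ltgtP ab => // -> _; rewrite subrr.
Qed.

Lemma Rintegral_segment_le a b f g : rcts_on a b f -> rcts_on a b g ->
  (forall x, a <= x <= b -> f x <= g x) ->
  \int[lebR]_(x in `[a, b]) f x <= \int[lebR]_(x in `[a, b]) g x.
Proof.
move=> cf cg fg; apply: le_Rintegral => //.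
- exact: rcts_integrable cf.
- exact: rcts_integrable cg.
Qed.

Lemma Rintegral_norm_le a b f M : a <= b -> rcts_on a b f ->
  (forall x, a <= x <= b -> `|f x| <= M) ->
  `|\int[lebR]_(x in `[a, b]) f x| <= M * (b - a).
Proof.
move=> ab cf fM; rewrite ler_norml; apply/andP; split.
  rewrite -mulNr -Rintegral_segment_cst//; apply: Rintegral_segment_le => //.
    by move=> ? _; exact: cvg_cst.
  by move=> x /fM; rewrite ler_norml => /andP[].
rewrite -Rintegral_segment_cst//; apply: Rintegral_segment_le => //.
  by move=> ? _; exact: cvg_cst.
by move=> x /fM; rewrite ler_norml => /andP[].
Qed.

End rintegral.

Section cint.
Context {R : realType}.
Local Notation C := R[i].
Implicit Types f g : R -> C.

Definition pcts g (t : R) := clim (nbhs t) g (g t).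
Definition pcts_on (a b : R) g := forall t, a <= t <= b -> pcts g t.

Lemma pcts_on_Re a b g : pcts_on a b g -> rcts_on a b (fun t => Re (g t)).
Proof. by move=> h t /h /clim_ReIm[]. Qed.

Lemma pcts_on_Im a b g : pcts_on a b g -> rcts_on a b (fun t => Im (g t)).
Proof. by move=> h t /h /clim_ReIm[]. Qed.

Lemma pcts_on_cst a b c : pcts_on a b (fun=> c).
Proof. by move=> t _; exact: clim_cst. Qed.

Lemma pcts_onD a b f g : pcts_on a b f -> pcts_on a b g -> pcts_on a b (fun t => f t + g t).
Proof. by move=> cf cg t tab; apply: climD; [exact: cf|exact: cg]. Qed.

Lemma pcts_onN a b f : pcts_on a b f -> pcts_on a b (fun t => - f t).
Proof. by move=> cf t tab; apply: climN; exact: cf. Qed.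

Lemma pcts_onB a b f g : pcts_on a b f -> pcts_on a b g -> pcts_on a b (fun t => f t - g t).
Proof. by move=> cf cg; apply: pcts_onD => //; exact: pcts_onN. Qed.

Lemma pcts_onM a b f g : pcts_on a b f -> pcts_on a b g -> pcts_on a b (fun t => f t * g t).
Proof. by move=> cf cg t tab; apply: climM; [exact: cf|exact: cg]. Qed.

Lemma pcts_on_conj a b f : pcts_on a b f -> pcts_on a b (fun t => cconj (f t)).
Proof. by move=> cf t tab; apply: clim_conj; exact: cf. Qed.

Definition cint (a b : R) g : C :=
  Complex (\int[lebR]_(x in `[a, b]) Re (g x)) (\int[lebR]_(x in `[a, b]) Im (g x)).

Lemma Re_cint a b g : Re (cint a b g) = \int[lebR]_(x in `[a, b]) Re (g x).
Proof. by []. Qed.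

Lemma Im_cint a b g : Im (cint a b g) = \int[lebR]_(x in `[a, b]) Im (g x).
Proof. by []. Qed.

Lemma eq_cint a b f g : (forall t, a <= t <= b -> f t = g t) -> cint a b f = cint a b g.
Proof.
move=> fg; rewrite /cint; congr Complex; apply: eq_Rintegral => x;
by rewrite inE/= in_itv/= => xab; rewrite fg.
Qed.

Lemma cintD a b f g : pcts_on a b f -> pcts_on a b g ->
  cint a b (fun t => f t + g t) = cint a b f + cint a b g.
Proof.
move=> cf cg; apply: complexP; rewrite ?ReD ?ImD ?Re_cint ?Im_cint.
  rewrite -RintegralD//; [|exact/rcts_integrable/pcts_on_Re|exact/rcts_integrable/pcts_on_Re].
  by under eq_Rintegral do rewrite ReD.
rewrite -RintegralD//; [|exact/rcts_integrable/pcts_on_Im|exact/rcts_integrable/pcts_on_Im].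
by under eq_Rintegral do rewrite ImD.
Qed.

Lemma cintZ a b c f : pcts_on a b f -> cint a b (fun t => c * f t) = c * cint a b f.
Proof.
move=> cf.
have IR := rcts_integrable (pcts_on_Re cf).
have II := rcts_integrable (pcts_on_Im cf).
have IZ (r : R) (h : R -> R) : lebR.-integrable `[a, b] (EFin \o h) ->
    lebR.-integrable `[a, b] (EFin \o (fun t => r * h t)).
  move=> ih.
  exact: (@integrableZl _ _ _ lebR `[a, b]%classic (measurable_itv _) r _ ih).
apply: complexP; rewrite ?ReM ?ImM ?Re_cint ?Im_cint -!RintegralZl//.
  rewrite -RintegralB//; try exact: IZ.
  by under eq_Rintegral do rewrite ReM.
rewrite -RintegralD//; try exact: IZ.
by under eq_Rintegral do rewrite ImM.
Qed.

Lemma cintN a b f : pcts_on a b f -> cint a b (fun t => - f t) = - cint a b f.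
Proof.
by move=> cf; rewrite -mulN1r -cintZ//; apply: eq_cint => t _; rewrite mulN1r.
Qed.

Lemma cintB a b f g : pcts_on a b f -> pcts_on a b g ->
  cint a b (fun t => f t - g t) = cint a b f - cint a b g.
Proof. by move=> cf cg; rewrite cintD ?cintN//; exact: pcts_onN. Qed.

Lemma cint_conj a b f : pcts_on a b f -> cint a b (fun t => cconj (f t)) = cconj (cint a b f).
Proof.
move=> cf; apply: complexP; rewrite ?Re_cint ?Im_cint//= -mulN1r -RintegralZl//.
  by under [RHS]eq_Rintegral do rewrite mulN1r.
exact/rcts_integrable/pcts_on_Im.
Qed.

Lemma cint_cst a b c : a <= b -> cint a b (fun=> c) = (b - a)%:C%C * c.
Proof.
by move=> ab; apply: complexP; rewrite ?ReZ ?ImZ ?Re_cint ?Im_cint Rintegral_segment_cst// mulrC.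
Qed.

Lemma cint_split a b c f : a <= b -> b <= c -> pcts_on a c f ->
  cint a c f = cint a b f + cint b c f.
Proof.
move=> ab bc cf; apply: complexP; rewrite ?ReD ?ImD ?Re_cint ?Im_cint (Rintegral_split ab bc)//.
  exact: pcts_on_Re.
exact: pcts_on_Im.
Qed.

(* The factor 2 comes from bounding the real and imaginary parts separately. *)
Lemma cint_norm_le a b f M : a <= b -> pcts_on a b f ->
  (forall t, a <= t <= b -> cnorm (f t) <= M) -> cnorm (cint a b f) <= 2 * M * (b - a).
Proof.
move=> ab cf fM; apply: le_trans (cnorm_le_ReIm _) _.
rewrite -mulrA mulr_natl mulr2n lerD//; apply: Rintegral_norm_le => //.
- exact: pcts_on_Re.
- by move=> t /fM; exact: le_trans (normr_Re_le _).
- exact: pcts_on_Im.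
- by move=> t /fM; exact: le_trans (normr_Im_le _).
Qed.

Lemma cint_sum a b I (r : seq I) (f : I -> R -> C) :
  (forall i, pcts_on a b (f i)) ->
  cint a b (fun t => \sum_(i <- r) f i t) = \sum_(i <- r) cint a b (f i).
Proof.
move=> cf; elim: r => [|i r ih].
  rewrite big_nil; under eq_fun do rewrite big_nil.
  by apply: complexP; rewrite ?Re_cint ?Im_cint Rintegral_cst// mul0r.
rewrite big_cons; under eq_fun do rewrite big_cons.
rewrite cintD ?ih// => t tab; apply: clim_sum => j; exact: cf.
Qed.

End cint.

Section goursat.
Context {R : realType}.
Local Notation C := R[i].
Implicit Types F : C -> C.

(** The contour integral along the boundary, counterclockwise; the factor ['i] is the [dz] of the
    vertical sides. *)
Definition rect_int F (x1 x2 y1 y2 : R) : C :=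
  cint x1 x2 (fun x => F (Complex x y1)) - cint x1 x2 (fun x => F (Complex x y2))
  + 'i%C * (cint y1 y2 (fun y => F (Complex x2 y)) - cint y1 y2 (fun y => F (Complex x1 y))).

Lemma clim_hor y (t : R) : clim (nbhs t) (fun x => Complex x y : C) (Complex t y).
Proof. by apply/clim_ReIm; split => /=; [exact: cvg_id|exact: cvg_cst]. Qed.

Lemma clim_ver x (t : R) : clim (nbhs t) (fun y => Complex x y : C) (Complex x t).
Proof. by apply/clim_ReIm; split => /=; [exact: cvg_cst|exact: cvg_id]. Qed.

Lemma pcts_hor F y a b : (forall x, a <= x <= b -> ccts F (Complex x y)) ->
  pcts_on a b (fun x => F (Complex x y)).
Proof. by move=> h t tab; apply: clim_comp; [exact: clim_hor|exact: h]. Qed.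

Lemma pcts_ver F x a b : (forall y, a <= y <= b -> ccts F (Complex x y)) ->
  pcts_on a b (fun y => F (Complex x y)).
Proof. by move=> h t tab; apply: clim_comp; [exact: clim_ver|exact: h]. Qed.

Lemma rect_int_splitx F x1 x2 x3 y1 y2 : x1 <= x2 -> x2 <= x3 ->
  pcts_on x1 x3 (fun x => F (Complex x y1)) -> pcts_on x1 x3 (fun x => F (Complex x y2)) ->
  rect_int F x1 x3 y1 y2 = rect_int F x1 x2 y1 y2 + rect_int F x2 x3 y1 y2.
Proof.
move=> x12 x23 c1 c2; rewrite /rect_int (cint_split x12 x23 c1) (cint_split x12 x23 c2); ring.
Qed.

Lemma rect_int_splity F x1 x2 y1 y2 y3 : y1 <= y2 -> y2 <= y3 ->
  pcts_on y1 y3 (fun y => F (Complex x1 y)) -> pcts_on y1 y3 (fun y => F (Complex x2 y)) ->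
  rect_int F x1 x2 y1 y3 = rect_int F x1 x2 y1 y2 + rect_int F x1 x2 y2 y3.
Proof.
move=> y12 y23 c1 c2; rewrite /rect_int (cint_split y12 y23 c1) (cint_split y12 y23 c2); ring.
Qed.

(* Subtracting an affine function does not change the integral, so only the
   first-order remainder at [p] counts. *)
Lemma rect_int_affine_le F x1 x2 y1 y2 (p a l : C) (e : R) : x1 <= x2 -> y1 <= y2 ->
  (forall x y, x1 <= x <= x2 -> y1 <= y <= y2 -> ccts F (Complex x y)) ->
  (forall x y, x1 <= x <= x2 -> y1 <= y <= y2 ->
    cnorm (F (Complex x y) - a - l * (Complex x y - p)) <= e) ->
  cnorm (rect_int F x1 x2 y1 y2) <= 4 * e * ((x2 - x1) + (y2 - y1)).
Proof.
move=> x12 y12 cF Fe.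
have hx1 : x1 <= x1 <= x2 by rewrite lexx.
have hx2 : x1 <= x2 <= x2 by rewrite lexx x12.
have hy1 : y1 <= y1 <= y2 by rewrite lexx.
have hy2 : y1 <= y2 <= y2 by rewrite lexx y12.
pose E z := F z - a - l * (z - p).
have cE x y : x1 <= x <= x2 -> y1 <= y <= y2 -> ccts E (Complex x y).
  move=> hx hy; apply: climB; first by apply: climB; [exact: cF|exact: clim_cst].
  apply: climM; first exact: clim_cst.
  by apply: climB; [exact: ccts_id|exact: clim_cst].
have EH y : y1 <= y <= y2 -> pcts_on x1 x2 (fun x => E (Complex x y)).
  by move=> hy; apply: pcts_hor => x hx; exact: cE.
have EV x : x1 <= x <= x2 -> pcts_on y1 y2 (fun y => E (Complex x y)).
  by move=> hx; apply: pcts_ver => y hy; exact: cE.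
have FH y : y1 <= y <= y2 -> pcts_on x1 x2 (fun x => F (Complex x y)).
  by move=> hy; apply: pcts_hor => x hx; exact: cF.
have FV x : x1 <= x <= x2 -> pcts_on y1 y2 (fun y => F (Complex x y)).
  by move=> hx; apply: pcts_ver => y hy; exact: cF.
have -> : rect_int F x1 x2 y1 y2 =
    cint x1 x2 (fun x => E (Complex x y1) - E (Complex x y2)) +
    'i%C * cint y1 y2 (fun y => E (Complex x2 y) - E (Complex x1 y)).
  rewrite /rect_int -!cintB; [|exact: FV|exact: FV|exact: FH|exact: FH].
  have -> : cint x1 x2 (fun x => F (Complex x y1) - F (Complex x y2)) =
     cint x1 x2 (fun x => E (Complex x y1) - E (Complex x y2)) +
     (x2 - x1)%:C%C * (l * Complex 0 (y1 - y2)).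
    rewrite -cint_cst// -cintD; last 2 first.
    - by apply: pcts_onB; exact: EH.
    - exact: pcts_on_cst.
    apply: eq_cint => t _; rewrite /E.
    rewrite -[Complex 0 (y1 - y2)](_ : Complex t y1 - Complex t y2 = _); last first.
      by apply: complexP; rewrite ?ReD ?ImD ?ReN ?ImN/= ?subrr.
    ring.
  have -> : cint y1 y2 (fun y => F (Complex x2 y) - F (Complex x1 y)) =
     cint y1 y2 (fun y => E (Complex x2 y) - E (Complex x1 y)) +
     (y2 - y1)%:C%C * (l * (x2 - x1)%:C%C).
    rewrite -cint_cst// -cintD; last 2 first.
    - by apply: pcts_onB; exact: EV.
    - exact: pcts_on_cst.
    apply: eq_cint => t _; rewrite /E.
    rewrite -[(x2 - x1)%:C%C](_ : Complex x2 t - Complex x1 t = _); last first.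
      by apply: complexP; rewrite ?ReD ?ImD ?ReN ?ImN/= ?subrr.
    ring.
  (* With this, the affine contributions of the horizontal and of the vertical sides cancel. *)
  have -> : Complex 0 (y1 - y2) = - 'i%C * (y2 - y1)%:C%C :> C.
    by apply: complexP; rewrite ?ReM ?ImM/=; ring.
  ring.
have e2 (u v : C) : cnorm u <= e -> cnorm v <= e -> cnorm (u - v) <= 2 * e.
  by move=> hu hv; rewrite mulr_natl mulr2n (le_trans (cnormB _ _))// lerD.
apply: le_trans (cnormD _ _) _; rewrite cnormM cnorm_i mul1r mulrDr.
have -> : 4 * e = 2 * (2 * e) by ring.
apply: lerD; apply: cint_norm_le => //.
- by apply: pcts_onB; exact: EH.
- by move=> t ht; apply: e2; exact: Fe.
- by apply: pcts_onB; exact: EV.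
- by move=> t ht; apply: e2; exact: Fe.
Qed.

Lemma halving_lt (A e : R) : 0 < e -> exists n : nat, A * 2^-1 ^+ n < e.
Proof.
move=> e0; have A1 : 0 < `|A| + 1 by rewrite ltr_wpDl.
have [n _ /(_ n (leqnn n)) /= h] := near_infty_natSinv_expn_lt (PosNum (divr_gt0 e0 A1)).
exists n; apply: (@le_lt_trans _ _ ((`|A| + 1) * 2^-1 ^+ n)).
  rewrite ler_wpM2r ?exprn_ge0// (le_trans (ler_norm A))// lerDl//.
move: h; rewrite /= ltr_pdivlMr// mulrC div1r -exprVn//.
Qed.

(** Bisection: one of the four quarters carries at least a fourth of the integral. The nested
    rectangles shrink to a point, where the derivative makes [F] affine up to a remainder that
    [rect_int_affine_le] can use. *)
Lemma goursat F (x1 x2 y1 y2 : R) : x1 <= x2 -> y1 <= y2 ->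
  (forall x y, x1 <= x <= x2 -> y1 <= y <= y2 -> exists l, is_cderiv F (Complex x y) l) ->
  rect_int F x1 x2 y1 y2 = 0.
Proof.
move=> x12 y12 dF.
have cF x y : x1 <= x <= x2 -> y1 <= y <= y2 -> ccts F (Complex x y).
  by move=> hx hy; have [l /is_cderiv_ccts] := dF x y hx hy.
pose q (n : nat) : R := 2^-1 ^+ n.
pose A n := (x2 - x1) * q n; pose B n := (y2 - y1) * q n.
have q0 n : 0 <= q n by rewrite exprn_ge0.
have A0 n : 0 <= A n by rewrite mulr_ge0// subr_ge0.
have B0 n : 0 <= B n by rewrite mulr_ge0// subr_ge0.
have AS n : A n = A n.+1 + A n.+1 by rewrite /A /q exprS; field.
have BS n : B n = B n.+1 + B n.+1 by rewrite /B /q exprS; field.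
have [J JDef] : exists J : nat -> R * R -> C, forall n p,
    J n p = rect_int F p.1 (p.1 + A n) p.2 (p.2 + B n).
  by exists (fun n p => rect_int F p.1 (p.1 + A n) p.2 (p.2 + B n)).
pose good n (p : R * R) :=
  [/\ x1 <= p.1, p.1 + A n <= x2, y1 <= p.2 & p.2 + B n <= y2].
(* The condition [good] stands inside the existential so that [choice] yields a total function; at
   bad inputs any value serves. *)
have step (np : nat * (R * R)) : exists p' : R * R, good np.1 np.2 ->
   [/\ good np.1.+1 p', np.2.1 <= p'.1, p'.1 + A np.1.+1 <= np.2.1 + A np.1,
    np.2.2 <= p'.2 /\ p'.2 + B np.1.+1 <= np.2.2 + B np.1 &
    cnorm (J np.1 np.2) <= 4 * cnorm (J np.1.+1 p')].
  move: np => [n [u v]]/=; have [[/= g1 g2 g3 g4]|ng] := pselect (good n (u, v)); last first.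
    by exists (u, v).
  have a0 := A0 n.+1; have b0 := B0 n.+1.
  rewrite AS in g2; rewrite BS in g4.
  have JE : J n (u, v) = J n.+1 (u, v) + J n.+1 (u, v + B n.+1) +
     (J n.+1 (u + A n.+1, v) + J n.+1 (u + A n.+1, v + B n.+1)).
    rewrite !JDef/= AS BS !addrA.
    have cH y : y1 <= y <= y2 -> pcts_on u (u + A n.+1 + A n.+1) (fun x => F (Complex x y)).
      by move=> hy; apply: pcts_hor => x hx; apply: cF => //; lra.
    have cV x : x1 <= x <= x2 -> pcts_on v (v + B n.+1 + B n.+1) (fun y => F (Complex x y)).
      by move=> hx; apply: pcts_ver => y hy; apply: cF => //; lra.
    rewrite (@rect_int_splitx _ u (u + A n.+1)); [|lra|lra|apply: cH; lra|apply: cH; lra].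
    rewrite (@rect_int_splity _ u (u + A n.+1) v (v + B n.+1)); [|lra|lra|apply: cV; lra|apply: cV; lra].
    rewrite (@rect_int_splity _ (u + A n.+1) _ v (v + B n.+1)); [|lra|lra|apply: cV; lra|apply: cV; lra].
    by rewrite !addrA.
  have : cnorm (J n (u, v)) <= cnorm (J n.+1 (u, v)) + cnorm (J n.+1 (u, v + B n.+1)) +
     (cnorm (J n.+1 (u + A n.+1, v)) + cnorm (J n.+1 (u + A n.+1, v + B n.+1))).
    by rewrite JE (le_trans (cnormD _ _))// lerD// cnormD.
  move=> le4.
  have K p' : u <= p'.1 <= u + A n.+1 -> v <= p'.2 <= v + B n.+1 ->
      cnorm (J n (u, v)) <= 4 * cnorm (J n.+1 p') ->
      exists p' : R * R, good n (u, v) ->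
     [/\ good n.+1 p', u <= p'.1, p'.1 + A n.+1 <= u + A n,
       v <= p'.2 /\ p'.2 + B n.+1 <= v + B n & cnorm (J n (u, v)) <= 4 * cnorm (J n.+1 p')].
    move=> hu hv hJ; exists p' => _; split; last exact: hJ.
    - by clear -g1 g2 g3 g4 hu hv; rewrite /good; split; lra.
    - by clear -hu; lra.
    - by clear -hu AS; rewrite (AS n); lra.
    - by clear -hv BS; rewrite (BS n); split; lra.
  have [h1|h1] := leP (cnorm (J n (u, v))) (4 * cnorm (J n.+1 (u, v))).
    by apply: K h1; clear -a0 b0 => /=; lra.
  have [h2|h2] := leP (cnorm (J n (u, v))) (4 * cnorm (J n.+1 (u, v + B n.+1))).
    by apply: K h2; clear -a0 b0 => /=; lra.
  have [h3|h3] := leP (cnorm (J n (u, v))) (4 * cnorm (J n.+1 (u + A n.+1, v))).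
    by apply: K h3; clear -a0 b0 => /=; lra.
  have [h4|h4] := leP (cnorm (J n (u, v))) (4 * cnorm (J n.+1 (u + A n.+1, v + B n.+1))).
    by apply: K h4; clear -a0 b0 => /=; lra.
  (* Otherwise each quarter would be below a fourth of the total, contradicting [le4]. *)
  exfalso; move: le4 h1 h2 h3 h4; clear.
  move: (cnorm (J n (u, v))) (cnorm (J n.+1 (u, v))) (cnorm (J n.+1 (u, v + B n.+1))).
  move: (cnorm (J n.+1 (u + A n.+1, v))) (cnorm (J n.+1 (u + A n.+1, v + B n.+1))) => *; lra.
have {step}[nxt nxtP] := choice step.
pose fix P n : R * R := if n is m.+1 then nxt (m, P m) else (x1, y1).
have A_0 : A 0%N = x2 - x1 by rewrite /A /q expr0 mulr1.
have B_0 : B 0%N = y2 - y1 by rewrite /B /q expr0 mulr1.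
have goodP n : good n (P n).
  elim: n => [|n ih] /=; first by split => /=; rewrite ?A_0 ?B_0; lra.
  by have [] := nxtP (n, P n) ih.
have stepP n : [/\ (P n).1 <= (P n.+1).1, (P n.+1).1 + A n.+1 <= (P n).1 + A n,
    (P n).2 <= (P n.+1).2 /\ (P n.+1).2 + B n.+1 <= (P n).2 + B n &
    cnorm (J n (P n)) <= 4 * cnorm (J n.+1 (P n.+1))].
  by have [] := nxtP (n, P n) (goodP n).
have nest n k : [/\ (P n).1 <= (P (n + k)%N).1, (P (n + k)%N).1 + A (n + k)%N <= (P n).1 + A n,
    (P n).2 <= (P (n + k)%N).2 & (P (n + k)%N).2 + B (n + k)%N <= (P n).2 + B n].
  elim: k => [|k [h1 h2 h3 h4]]; first by rewrite addn0.
  rewrite addnS; have [k1 k2 [k3 k4] _] := stepP (n + k)%N.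
  by split; [exact: le_trans h1 k1|exact: le_trans k2 h2|exact: le_trans h3 k3|exact: le_trans k4 h4].
(* Every lower left corner lies below every upper right one, so the suprema of the corner
   coordinates give a point common to all the rectangles. *)
have cross n m : (P n).1 <= (P m).1 + A m /\ (P n).2 <= (P m).2 + B m.
  case: (leqP n m) => [/subnKC <-|/ltnW /subnKC <-].
    have [h1 h2 h3 h4] := nest n (m - n)%N.
    have := A0 (n + (m - n))%N; have := B0 (n + (m - n))%N; lra.
  have [h1 h2 h3 h4] := nest m (n - m)%N.
  have := A0 (m + (n - m))%N; have := B0 (m + (n - m))%N; lra.
have normJ n : cnorm (rect_int F x1 x2 y1 y2) <= 4 ^+ n * cnorm (J n (P n)).
  elim: n => [|n ih]; first by rewrite expr0 mul1r JDef/= A_0 B_0 !(addrC _ (_ - _)) !subrK.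
  have [_ _ _ h] := stepP n.
  by rewrite (le_trans ih)// exprSr -mulrA ler_wpM2l// exprn_ge0.
pose px := sup (range (fun n => (P n).1)); pose py := sup (range (fun n => (P n).2)).
have pxP n : (P n).1 <= px <= (P n).1 + A n.
  apply/andP; split.
    apply: sup_upper_bound; last by exists n.
    split; first by exists (P 0%N).1, 0%N.
    by exists ((P 0%N).1 + A 0%N) => _ [k _ <-]; have [] := cross k 0%N.
  apply: ge_sup; first by exists (P 0%N).1, 0%N.
  by move=> _ [k _ <-]; have [] := cross k n.
have pyP n : (P n).2 <= py <= (P n).2 + B n.
  apply/andP; split.
    apply: sup_upper_bound; last by exists n.
    split; first by exists (P 0%N).2, 0%N.
    by exists ((P 0%N).2 + B 0%N) => _ [k _ <-]; have [] := cross k 0%N.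
  apply: ge_sup; first by exists (P 0%N).2, 0%N.
  by move=> _ [k _ <-]; have [] := cross k n.
have [||l dl] := dF px py.
- by have := pxP 0%N; rewrite /= A_0; lra.
- by have := pyP 0%N; rewrite /= B_0; lra.
set S := (x2 - x1) + (y2 - y1).
have S0 : 0 <= S by rewrite addr_ge0// subr_ge0.
(* The factor [4 ^+ n] lost by bisection is compensated by two factors [2^-1 ^+ n]: one from the
   distance in the remainder, one from the perimeter. *)
have main (e : R) : 0 < e -> cnorm (rect_int F x1 x2 y1 y2) <= 4 * e * S ^+ 2.
  move=> e0; have [d d0 dE] := dl e e0.
  have [n nd] := halving_lt S d0.
  have qS : A n + B n = S * q n by rewrite /A /B -mulrDl.
  have near x y : (P n).1 <= x <= (P n).1 + A n -> (P n).2 <= y <= (P n).2 + B n ->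
      cnorm (Complex x y - Complex px py) <= S * q n.
    move=> hx hy; rewrite (le_trans (cnorm_le_ReIm _))// ReD ImD ReN ImN/= -qS.
    have := pxP n; have := pyP n; move=> h1 h2.
    by rewrite lerD// ler_norml; apply/andP; split; lra.
  have := @rect_int_affine_le F (P n).1 ((P n).1 + A n) (P n).2 ((P n).2 + B n)
    (Complex px py) (F (Complex px py)) l (e * (S * q n)).
  have [g1 g2 g3 g4] := goodP n.
  rewrite -JDef !lerDl => /(_ (A0 n) (B0 n)) h.
  have {h} : cnorm (J n (P n)) <= 4 * (e * (S * q n)) * (S * q n).
    have -> : 4 * (e * (S * q n)) * (S * q n) =
      4 * (e * (S * q n)) * ((P n).1 + A n - (P n).1 + ((P n).2 + B n - (P n).2)).
      by rewrite -qS; ring.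
    apply: h => x y hx hy; first by apply: cF; lra.
    have nxy := near x y hx hy.
    have [->|zp] := eqVneq (Complex x y) (Complex px py).
      by rewrite !subrr mulr0 subrr cnorm0 !mulr_ge0// ltW.
    have zp0 : Complex x y - Complex px py != 0 by rewrite subr_eq0.
    have := dE _ zp0 (le_lt_trans nxy nd); rewrite (addrC (Complex px py)) subrK => /ltW h.
    set D := F _ - F _ in h *; set w := Complex x y - Complex px py in zp0 h nxy *.
    have -> : D - l * w = (D / w - l) * w by field.
    by rewrite cnormM ler_pM ?cnorm_ge0.
  move=> h; apply: le_trans (normJ n) _.
  apply: le_trans (ler_wpM2l (exprn_ge0 n _) h) _ => //.
  have q4 : 4 ^+ n * q n ^+ 2 = 1.
    rewrite /q -exprM mulnC exprM -exprMn.
    have -> : (4 : R) * 2^-1 ^+ 2 = 1 by field.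
    by rewrite expr1n.
  rewrite le_eqVlt; apply/orP; left; apply/eqP.
  have -> : 4 ^+ n * (4 * (e * (S * q n)) * (S * q n)) = 4 * e * S ^+ 2 * (4 ^+ n * q n ^+ 2) by ring.
  by rewrite q4 mulr1.
apply/eqP; rewrite -cnorm_eq0 eq_le cnorm_ge0 andbT; apply/ler_addgt0Pr => e e0.
rewrite add0r; have S1 : 0 < 4 * S ^+ 2 + 1 by rewrite ltr_wpDl// mulr_ge0// sqr_ge0.
apply: le_trans (main (e / (4 * S ^+ 2 + 1)) _) _; first by rewrite divr_gt0.
have -> : 4 * (e / (4 * S ^+ 2 + 1)) * S ^+ 2 = e * (4 * S ^+ 2 / (4 * S ^+ 2 + 1)) by ring.
by rewrite ler_piMr ?(ltW e0)// ler_pdivrMr// mul1r lerDl.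
Qed.

End goursat.

(** * Circle means and Cauchy's formula *)

Section cexp.
Context {R : realType}.
Local Notation C := R[i].

Lemma is_derive_remainder (f : R -> R) (a l : R) : is_derive a 1 f l ->
  forall e : R, 0 < e -> exists2 d : R, 0 < d &
    forall h : R, `|h| < d -> `|f (a + h) - f a - l * h| <= e * `|h|.
Proof.
move=> [df dfl] e e0.
have : h^-1 *: ((f \o shift a) (h *: 1) - f a) @[h --> 0^'] --> l by rewrite -dfl; exact: df.
move=> /cvgrPdist_le /(_ e e0)[d /= d0 dE]; exists d => // h hd.
have [->|h0] := eqVneq h 0; first by rewrite addr0 subrr mulr0 subrr normr0 mulr0.
have := dE h; rewrite /= sub0r normrN => /(_ hd h0).
rewrite /GRing.scale/= mulr1 (addrC h) => hle.
have -> : f (a + h) - f a - l * h = - (l - h^-1 * (f (a + h) - f a)) * h by field.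
by rewrite normrM normrN ler_wpM2r.
Qed.

(** The exponential maps rectangles onto annuli, which lets Goursat's theorem on rectangles compare
    means over circles. *)
Definition cexp (z : C) : C := Complex (expR (Re z) * cos (Im z)) (expR (Re z) * sin (Im z)).

Lemma cexpD z w : cexp (z + w) = cexp z * cexp w.
Proof.
by apply: complexP; rewrite ?ReM ?ImM /cexp/= ReD ImD expRD ?cosD ?sinD; ring.
Qed.

Lemma cexp_remainder (e : R) : 0 < e -> exists2 d : R, 0 < d &
  forall h, cnorm h < d -> cnorm (cexp h - 1 - h) <= e * cnorm h.
Proof.
(* The four error terms below cost 1 + 2 + 2 + 2 = 7 of these eighths. *)
move=> e0; have e80 : 0 < e / 8 by rewrite divr_gt0.
have [d1 d10 E1] := is_derive_remainder (is_derive_expR (0 : R)) e80.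
have [d2 d20 E2] := is_derive_remainder (is_derive_cos (0 : R)) e80.
have [d3 d30 E3] := is_derive_remainder (is_derive_sin (0 : R)) e80.
have [d4 d40 E4] := is_derive_remainder (is_derive_expR (0 : R)) (ltr01 : 0 < (1 : R)).
pose d := Num.min (Num.min d1 d2) (Num.min (Num.min d3 d4) (Num.min (1 / 2) (e / 8))).
exists d; first by rewrite !lt_min d10 d20 d30 d40 e80 divr_gt0.
move=> [x y] hd; rewrite /d !lt_min in hd.
case/and3P: hd => /andP[hd1 hd2] /andP[hd3 hd4] /andP[hd5 hd6].
set N := cnorm _ in hd1 hd2 hd3 hd4 hd5 hd6 *.
have xN : `|x| <= N := normr_Re_le (Complex x y).
have yN : `|y| <= N := normr_Im_le (Complex x y).
have {E1} := E1 x (le_lt_trans xN hd1).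
have {E2} := E2 y (le_lt_trans yN hd2).
have {E3} := E3 y (le_lt_trans yN hd3).
have {E4} := E4 x (le_lt_trans xN hd4).
rewrite !add0r expR0 cos0 sin0 oppr0 mul0r !subr0 !addr0 !mul1r => E4 E3 E2 E1.
have N0 : 0 <= N by exact: cnorm_ge0.
have Ex : expR x <= 2.
  have : expR x - 1 - x <= `|x| by exact: le_trans (ler_norm _) E4.
  have : x <= `|x| by exact: ler_norm.
  lra.
have Ex1 : `|expR x - 1| <= 2 * N.
  have -> : expR x - 1 = (expR x - 1 - x) + x by ring.
  rewrite (le_trans (ler_normD _ _))//; lra.
have eN : e / 8 * `|y| <= e / 8 * N by rewrite ler_wpM2l// ltW.
have eNx : e / 8 * `|x| <= e / 8 * N by rewrite ler_wpM2l// ltW.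
have Ec : `|expR x * (cos y - 1)| <= 2 * (e / 8 * N).
  rewrite normrM; apply: ler_pM => //; last exact: le_trans E2 _.
  by rewrite ger0_norm// expR_ge0.
have Es : `|expR x * (sin y - y)| <= 2 * (e / 8 * N).
  rewrite normrM; apply: ler_pM => //; last exact: le_trans E3 _.
  by rewrite ger0_norm// expR_ge0.
have Ey : `|(expR x - 1) * y| <= 2 * (e / 8 * N).
  rewrite normrM (le_trans (ler_pM _ _ Ex1 yN))//.
  have : N * N <= e / 8 * N by rewrite ler_wpM2r// ltW.
  lra.
apply: le_trans (cnorm_le_ReIm _) _; rewrite !ReD !ImD !ReN !ImN /cexp/=.
have -> : expR x * cos y - 1 - x = (expR x - 1 - x) + expR x * (cos y - 1) by ring.
have -> : expR x * sin y - 0 - y = expR x * (sin y - y) + (expR x - 1) * y by ring.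
have := ler_normD (expR x - 1 - x) (expR x * (cos y - 1)).
have := ler_normD (expR x * (sin y - y)) ((expR x - 1) * y).
have := mulr_ge0 (ltW e0) N0.
clear -Ec Es Ey E1 eNx => *; lra.
Qed.

Lemma is_cderiv_cexp z : is_cderiv cexp z (cexp z).
Proof.
move=> e e0; have N0 := cnorm_ge0 (cexp z).
have e'0 : 0 < e / 2 / (cnorm (cexp z) + 1) by rewrite !divr_gt0// ltr_wpDl.
have [d d0 dE] := cexp_remainder e'0; exists d => // h h0 /dE.
rewrite cexpD.
have -> : (cexp z * cexp h - cexp z) / h - cexp z = cexp z * ((cexp h - 1 - h) / h) by field.
have hn : 0 < cnorm h by rewrite cnorm_gt0.
rewrite -ler_pdivrMr// -cnorm_div => hle; rewrite cnormM.
apply: le_lt_trans (ler_wpM2l N0 hle) _.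
rewrite mulrA ltr_pdivrMr; last by rewrite ltr_wpDl.
by have := mulr_ge0 (ltW e0) N0; lra.
Qed.

End cexp.

Section cmean.
Context {R : realType}.
Local Notation C := R[i].
Implicit Types (f g h : C -> C) (r t : R).

Definition circ r t : C := Complex (r * cos t) (r * sin t).
Definition tpi : R := pi *+ 2.
Definition cmean r f : C := (tpi^-1)%:C%C * cint 0 tpi (fun t => f (circ r t)).
Definition ccirc r f := pcts_on 0 tpi (fun t => f (circ r t)).

Lemma tpi_gt0 : 0 < tpi. Proof. by rewrite pmulrn_lgt0// pi_gt0. Qed.

Lemma cnorm_circ r t : cnorm (circ r t) = `|r|.
Proof.
by rewrite /cnorm/= !exprMn -mulrDr cos2Dsin2 mulr1 sqrtr_sqr.
Qed.

Lemma circ_cexp r t : 0 < r -> circ r t = cexp (Complex (ln r) t).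
Proof. by move=> r0; rewrite /circ /cexp/= lnK. Qed.

Lemma clim_circ T (F : set_system T) {FF : Filter F} (rf tf : T -> R) r t :
  rf x @[x --> F] --> r -> tf x @[x --> F] --> t ->
  clim F (fun x => circ (rf x) (tf x)) (circ r t).
Proof.
move=> Fr Ft; apply/clim_ReIm; split => /=.
  apply: cvgM => //; apply: continuous_cvg => //; exact: continuous_cos.
apply: cvgM => //; apply: continuous_cvg => //; exact: continuous_sin.
Qed.

Lemma pcts_circ r t : pcts (circ r) t.
Proof. by apply: clim_circ; [exact: cvg_cst|exact: cvg_id]. Qed.

Lemma ccirc_ccts r f : (forall z, cnorm z = `|r| -> ccts f z) -> ccirc r f.
Proof.
by move=> h t _; apply: clim_comp; [exact: pcts_circ|apply: h; rewrite cnorm_circ].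
Qed.

Lemma ccirc_cst r c : ccirc r (fun=> c). Proof. exact: pcts_on_cst. Qed.

Lemma ccircD r f g : ccirc r f -> ccirc r g -> ccirc r (fun z => f z + g z).
Proof. exact: pcts_onD. Qed.
Lemma ccircB r f g : ccirc r f -> ccirc r g -> ccirc r (fun z => f z - g z).
Proof. exact: pcts_onB. Qed.
Lemma ccircM r f g : ccirc r f -> ccirc r g -> ccirc r (fun z => f z * g z).
Proof. exact: pcts_onM. Qed.
Lemma ccirc_conj r f : ccirc r f -> ccirc r (fun z => cconj (f z)).
Proof. exact: pcts_on_conj. Qed.
Lemma ccirc_sum r I (s : seq I) (f : I -> C -> C) :
  (forall i, ccirc r (f i)) -> ccirc r (fun z => \sum_(i <- s) f i z).
Proof. by move=> h t tab; apply: (@clim_sum _ _ _ _ _ _ (fun i t => f i (circ r t))) => i; exact: h. Qed.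

Lemma eq_cmean r f g : (forall z, cnorm z = `|r| -> f z = g z) -> cmean r f = cmean r g.
Proof.
by move=> fg; congr (_ * _); apply: eq_cint => t _; apply: fg; rewrite cnorm_circ.
Qed.

Lemma cmeanD r f g : ccirc r f -> ccirc r g ->
  cmean r (fun z => f z + g z) = cmean r f + cmean r g.
Proof. by move=> cf cg; rewrite /cmean cintD// mulrDr. Qed.

Lemma cmeanB r f g : ccirc r f -> ccirc r g ->
  cmean r (fun z => f z - g z) = cmean r f - cmean r g.
Proof. by move=> cf cg; rewrite /cmean cintB// mulrBr. Qed.

Lemma cmeanZ r c f : ccirc r f -> cmean r (fun z => c * f z) = c * cmean r f.
Proof. by move=> cf; rewrite /cmean cintZ// mulrCA. Qed.

Lemma cmean_cst r c : cmean r (fun=> c) = c.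
Proof.
rewrite /cmean cint_cst ?(ltW tpi_gt0)// subr0 mulrA -rmorphM/= mulVf ?gt_eqF ?tpi_gt0//.
by rewrite mul1r.
Qed.

Lemma cmean_conj r f : ccirc r f -> cmean r (fun z => cconj (f z)) = cconj (cmean r f).
Proof. by move=> cf; rewrite /cmean cint_conj// cconjM cconj_real. Qed.

Lemma cmean_sum r I (s : seq I) (f : I -> C -> C) : (forall i, ccirc r (f i)) ->
  cmean r (fun z => \sum_(i <- s) f i z) = \sum_(i <- s) cmean r (f i).
Proof.
by move=> h; rewrite /cmean (@cint_sum _ _ _ _ _ (fun i t => f i (circ r t)))// mulr_sumr.
Qed.

Lemma cmean_norm_le r f M : ccirc r f ->
  (forall t, 0 <= t <= tpi -> cnorm (f (circ r t)) <= M) -> cnorm (cmean r f) <= 2 * M.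
Proof.
move=> cf fM; rewrite /cmean cnormM cnorm_real gtr0_norm ?invr_gt0 ?tpi_gt0//.
rewrite ler_pdivrMl ?tpi_gt0// mulrC -[X in _ <= _ * X](subr0 tpi).
by apply: cint_norm_le => //; exact/ltW/tpi_gt0.
Qed.

Lemma Re_cmean_ge0 r f : (forall z, cnorm z = `|r| -> 0 <= Re (f z)) -> 0 <= Re (cmean r f).
Proof.
move=> f0; rewrite /cmean ReZ mulr_ge0 ?invr_ge0 ?(ltW tpi_gt0)// Re_cint.
by apply: Rintegral_ge0 => t _; apply: f0; rewrite cnorm_circ.
Qed.

(** Goursat for [f] composed with [cexp] on the rectangle of sides [[ln r1, ln r2]] and [[0, tpi]]:
    the vertical sides are the two means, and the horizontal ones cancel by periodicity. *)
Lemma cmean_annulus r1 r2 f : 0 < r1 -> r1 <= r2 ->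
  (forall z, r1 <= cnorm z <= r2 -> exists l, is_cderiv f z l) ->
  cmean r1 f = cmean r2 f.
Proof.
move=> r10 r12 df; have r20 : 0 < r2 by exact: lt_le_trans r12.
pose F z := f (cexp z).
have tpi0 := ltW tpi_gt0.
have lnr : ln r1 <= ln r2 by rewrite ler_ln.
have dF x y : ln r1 <= x <= ln r2 -> 0 <= y <= tpi -> exists l, is_cderiv F (Complex x y) l.
  move=> /andP[x1 x2] _; have [|l dl] := df (cexp (Complex x y)).
    have -> : cexp (Complex x y) = circ (expR x) y by [].
    by rewrite cnorm_circ gtr0_norm ?expR_gt0// -[r1]lnK// -[r2]lnK// !ler_expR x1.
  by exists (l * cexp (Complex x y)); apply: is_cderiv_comp dl; exact: is_cderiv_cexp.
have := goursat lnr tpi0 dF; rewrite /rect_int.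
have -> : cint (ln r1) (ln r2) (fun x => F (Complex x tpi)) =
  cint (ln r1) (ln r2) (fun x => F (Complex x 0)).
  by apply: eq_cint => x _; rewrite /F /cexp/= cos2pi sin2pi cos0 sin0.
rewrite subrr add0r => /eqP; rewrite mulf_eq0 -cnorm_eq0 cnorm_i oner_eq0/= subr_eq0 => /eqP E.
rewrite /cmean; congr (_ * _); rewrite (_ : cint 0 tpi (fun t => f (circ r1 t)) = cint 0 tpi (fun y => F (Complex (ln r1) y))).
  by rewrite -E; apply: eq_cint => t _; rewrite /F -circ_cexp.
by apply: eq_cint => t _; rewrite /F -circ_cexp.
Qed.

(** Compactness of the interval of angles, in near-covering form, makes the joint continuity in
    [(r, t)] uniform in [t]. *)
Lemma cmean_continuous r0 f : (forall z, cnorm z = `|r0| -> ccts f z) ->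
  forall e : R, 0 < e -> \forall r \near r0,
   forall t, 0 <= t <= tpi -> cnorm (f (circ r t) - f (circ r0 t)) < e.
Proof.
move=> cf e e0.
have /compact_near_coveringP nc : compact `[(0 : R), tpi] by exact: segment_compact.
have /(_ _)H := nc R (nbhs r0) (fun r t => cnorm (f (circ r t) - f (circ r0 t)) < e) _.
have {}H : \forall r \near r0, `[(0 : R), tpi] `<=`
    (fun t => cnorm (f (circ r t) - f (circ r0 t)) < e).
  apply: H => t _.
  have ct : clim (filter_prod (nbhs t) (nbhs r0)) (fun p => f (circ p.2 p.1)) (f (circ r0 t)).
    apply: clim_comp; last by apply: cf; rewrite cnorm_circ.
    by apply: clim_circ; [exact: cvg_snd|exact: cvg_fst].
  have ct' : clim (filter_prod (nbhs t) (nbhs r0)) (fun p => f (circ r0 p.1)) (f (circ r0 t)).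
    apply: clim_comp; last by apply: cf; rewrite cnorm_circ.
    by apply: clim_circ; [exact: cvg_cst|exact: cvg_fst].
  have Fp : Filter (filter_prod (nbhs t) (nbhs r0)) by exact: filter_prod_filter.
  have := @climB _ _ _ Fp _ _ _ _ ct ct'; rewrite subrr => /(_ e e0).
  by apply: filterS => p /=; rewrite subr0.
by apply: filterS H => r h t t01; apply: h; rewrite /= in_itv.
Qed.

Lemma cmean_near r0 f : (forall z, cnorm z = `|r0| -> ccts f z) ->
  forall e : R, 0 < e -> exists2 d : R, 0 < d & forall r, `|r - r0| < d -> ccirc r f ->
    cnorm (cmean r f - cmean r0 f) <= e.
Proof.
move=> cf e e0; have e20 : 0 < e / 2 by rewrite divr_gt0.
have [d /= d0 dE] := cmean_continuous cf e20.
exists d => // r rd cr; rewrite distrC in rd; have {}dE := dE r rd.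
rewrite /cmean -mulrBr -cintB//; last exact: ccirc_ccts.
rewrite cnormM cnorm_real gtr0_norm ?invr_gt0 ?tpi_gt0// ler_pdivrMl ?tpi_gt0//.
have -> : tpi * e = 2 * (e / 2) * (tpi - 0) by field.
apply: cint_norm_le; first exact/ltW/tpi_gt0.
  by apply: pcts_onB => //; exact: ccirc_ccts.
by move=> t tt; exact/ltW/dE.
Qed.

(** The means over all circles of radius in []0, r]] agree, and those over small circles approach
    the mean over the degenerate circle of radius 0. *)
Lemma cmean_center r f : 0 < r -> (forall z, cnorm z <= r -> exists l, is_cderiv f z l) ->
  cmean r f = f 0.
Proof.
move=> r0 df; apply/eqP; rewrite -subr_eq0 -cnorm_eq0 eq_le cnorm_ge0 andbT.
have cf z : cnorm z <= r -> ccts f z by move=> /df[l /is_cderiv_ccts].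
apply/ler_addgt0Pr => e e0; rewrite add0r.
have [z|d d0 dE] := @cmean_near 0 f _ e e0.
  by rewrite normr0 => z0; apply: cf; rewrite z0 ltW.
pose s := Num.min r (d / 2).
have s0 : 0 < s by rewrite lt_min r0 divr_gt0.
have sr : s <= r by rewrite ge_min lexx.
have sd : s < d by rewrite gt_min [X in _ || X]ltr_pdivrMr// mulr_natr mulr2n ltrDl d0 orbT.
have := dE s; rewrite subr0 gtr0_norm// => /(_ sd).
have -> : cmean 0 f = f 0.
  rewrite -(cmean_cst 0 (f 0)); apply: eq_cmean => z; rewrite normr0 => /eqP.
  by rewrite cnorm_eq0 => /eqP ->.
rewrite (@cmean_annulus s r)//; last by move=> z /andP[_ /df].
by apply; apply: ccirc_ccts => z; rewrite gtr0_norm// => zs; apply: cf; rewrite zs.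
Qed.

End cmean.

Section cauchy.
Context {R : realType}.
Local Notation C := R[i].
Implicit Types (f g h : C -> C) (r t : R).

Lemma pcts_on_bounded (a b : R) (g : R -> C) : a <= b -> pcts_on a b g ->
  exists2 M, 0 <= M & forall t, a <= t <= b -> cnorm (g t) <= M.
Proof.
move=> ab cg.
have bnd (f : R -> R) : rcts_on a b f -> exists2 M : R, 0 <= M & forall t, a <= t <= b -> `|f t| <= M.
  move=> cf; have [|c cab cM] := @EVT_max _ (fun t => `|f t|) a b ab.
    apply: continuous_in_subspaceT => x; rewrite inE/= in_itv/= => xab.
    by apply: cvg_norm; exact: cf.
  by exists `|f c| => // t tab; apply: cM; rewrite in_itv.
have [M1 M10 h1] := bnd _ (pcts_on_Re cg); have [M2 M20 h2] := bnd _ (pcts_on_Im cg).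
exists (M1 + M2); first exact: addr_ge0.
by move=> t tab; rewrite (le_trans (cnorm_le_ReIm _))// lerD ?h1 ?h2.
Qed.

(** On the circle conj z = r^2 / z, so that z / (z - w) is the conjugate of a function [k]
    holomorphic on the closed disc, with [k 0 = 1]. *)
Lemma cmean_kernel r w : 0 < r -> cnorm w < r -> cmean r (fun z => z / (z - w)) = 1.
Proof.
move=> r0 wr; pose k z := (1 - cconj w * (r ^- 2)%:C%C * z)^-1.
have kn z : cnorm z <= r -> 1 - cconj w * (r ^- 2)%:C%C * z != 0.
  move=> zr; rewrite subr_eq0 eq_sym; apply: contraTneq wr => E.
  have : cnorm (cconj w * (r ^- 2)%:C%C * z) = 1 by rewrite E cnorm1.
  rewrite !cnormM cnorm_conj cnorm_real ger0_norm ?invr_ge0 ?sqr_ge0// => E1.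
  rewrite -leNgt -(ler_pM2r r0) -[leLHS]mulr1 -E1.
  have -> : r * r * (cnorm w / r ^+ 2 * cnorm z) = cnorm w * cnorm z by field; rewrite gt_eqF.
  by rewrite ler_wpM2l ?cnorm_ge0.
have dk z : cnorm z <= r -> exists l, is_cderiv k z l.
  move=> /kn zn; eexists; apply: is_cderivV => //.
  apply: is_cderivB; first exact: is_cderiv_cst.
  by apply: is_cderivZ; exact: is_cderiv_id.
transitivity (cmean r (fun z => cconj (k z))).
  apply: eq_cmean => z; rewrite gtr0_norm// => zr.
  have z0 : z != 0 by rewrite -cnorm_gt0 zr.
  have zw : z - w != 0 by rewrite subr_eq0; apply: contraTneq wr => <-; rewrite zr ltxx.
  rewrite /k cconjV cconjD cconjN !cconjM cconj1 cconjK cconj_real.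
  have -> : cconj z = (r ^+ 2)%:C%C / z by rewrite -[r]zr -mulcconj; field.
  have r20 : (r ^+ 2)%:C%C != 0 :> C by rewrite -cnorm_gt0 cnorm_real normr_gt0 expf_neq0// gt_eqF.
  rewrite fmorphV/=; move: (_%:C%C) r20 => a a0; field.
  by rewrite z0 a0 zw.
rewrite cmean_conj; last first.
  by apply: ccirc_ccts => z; rewrite gtr0_norm// => zr; have [|l /is_cderiv_ccts] := dk z; rewrite ?zr.
by rewrite (cmean_center r0 dk) /k mulr0 subr0 invr1 cconj1.
Qed.

(** The difference quotient of [h] at [w] is continuous at [w] but not known to be differentiable
    there. Its means are therefore constant on radii below [cnorm w] and on radii above it, and the
    continuity of means joins the two ranges. *)
Lemma cauchy r w h : 0 < r -> cnorm w < r ->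
  (forall z, cnorm z <= r -> exists l, is_cderiv h z l) ->
  cmean r (fun z => h z * (z / (z - w))) = h w.
Proof.
move=> r0 wr dh; have ch z : cnorm z <= r -> ccts h z by move=> /dh[l /is_cderiv_ccts].
have cz z : ccts id z by exact: ccts_id.
have [l /is_cderiv_factor[Q Qc [Ql QE]]] := dh w (ltW wr).
(* The factor [z] is that of z / (z - w); it also makes [q 0 = 0], so the means over small circles
   vanish. *)
pose q z := Q z * z.
have cqw : ccts q w by apply: cctsM; [rewrite /ccts Ql|exact: ccts_id].
have dq z : cnorm z <= r -> z != w -> exists l, is_cderiv q z l.
  move=> zr zw; have [l' dl'] := dh z zr.
  eexists; apply: (@is_cderiv_near _ (fun z => (h z - h w) * (z - w)^-1 * z)).
    exists (cnorm (z - w)); first by rewrite cnorm_gt0 subr_eq0.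
    move=> u uz /=; have uw : u - w != 0.
      by rewrite subr_eq0; apply: contraTneq uz => ->; rewrite cdistC ltxx.
    by rewrite QE mulfK.
  apply: is_cderivM; last exact: is_cderiv_id.
  apply: is_cderivM; first by apply: is_cderivB; [exact: dl'|exact: is_cderiv_cst].
  apply: is_cderivV; first by rewrite subr_eq0.
  by apply: is_cderivB; [exact: is_cderiv_id|exact: is_cderiv_cst].
have cq z : cnorm z <= r -> ccts q z.
  move=> zr; have [->//|zw] := eqVneq z w.
  by have [? /is_cderiv_ccts] := dq z zr zw.
have ccq s : 0 <= s -> s <= r -> ccirc s q.
  by move=> s0 sr; apply: ccirc_ccts => z; rewrite ger0_norm// => zs; apply: cq; rewrite zs.
have small s : 0 < s -> s < cnorm w -> cmean s q = 0.
  move=> s0 sw; rewrite cmean_center//; first by rewrite /q mulr0.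
  move=> z zs; apply: dq; first by rewrite (le_trans zs)// ltW// (lt_trans sw).
  by apply: contraTneq sw => <-; rewrite -leNgt.
(* This circle passes through [w]; its mean is a limit of means over smaller circles. *)
have atw : cmean (cnorm w) q = 0.
  have [w0|w0] := eqVneq w 0.
    rewrite w0 cnorm0 -(cmean_cst 0 0); apply: eq_cmean => z; rewrite normr0 => /eqP.
    by rewrite cnorm_eq0 => /eqP ->; rewrite /q mulr0.
  apply/eqP; rewrite -cnorm_eq0 eq_le cnorm_ge0 andbT; apply/ler_addgt0Pr => e e0; rewrite add0r.
  have wp : 0 < cnorm w by rewrite cnorm_gt0.
  have [z|d d0 dE] := @cmean_near _ (cnorm w) q _ e e0.
    by rewrite ger0_norm ?cnorm_ge0// => zw; apply: cq; rewrite zw ltW.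
  pose s := Num.max (cnorm w / 2) (cnorm w - d / 2).
  have s0 : 0 < s by rewrite lt_max divr_gt0.
  have sw : s < cnorm w by rewrite gt_max; apply/andP; split; lra.
  have sd : `|s - cnorm w| < d.
    have : cnorm w - d / 2 <= s by rewrite le_max lexx orbT.
    by move=> ?; rewrite ltr_norml; apply/andP; split; lra.
  have := dE s sd (ccq _ (ltW s0) _); rewrite small// sub0r cnormN; apply.
  by rewrite ltW// (lt_trans sw).
have qr : cmean r q = 0.
  apply/eqP; rewrite -cnorm_eq0 eq_le cnorm_ge0 andbT; apply/ler_addgt0Pr => e e0; rewrite add0r.
  have [z|d d0 dE] := @cmean_near _ (cnorm w) q _ e e0.
    by rewrite ger0_norm ?cnorm_ge0// => zw; apply: cq; rewrite zw ltW.
  pose s := Num.min r (cnorm w + d / 2).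
  have sw : cnorm w < s by rewrite lt_min; apply/andP; split; lra.
  have sr : s <= r by rewrite ge_min lexx.
  have s0 : 0 < s := le_lt_trans (cnorm_ge0 w) sw.
  have sd : `|s - cnorm w| < d.
    have : s <= cnorm w + d / 2 by rewrite ge_min lexx orbT.
    by move=> ?; rewrite ltr_norml; apply/andP; split; lra.
  have := dE s sd (ccq _ (ltW s0) sr); rewrite atw subr0 (@cmean_annulus _ s r)//.
  move=> z /andP[sz zr]; apply: dq => //.
  by apply: contraTneq sw => <-; rewrite -leNgt.
have neq z : cnorm z = `|r| -> z - w != 0.
  rewrite gtr0_norm// => zr; rewrite subr_eq0.
  by apply: contraTneq wr => <-; rewrite zr ltxx.
transitivity (cmean r (fun z => q z + h w * (z / (z - w)))).
  apply: eq_cmean => z /neq zw; rewrite /q.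
  have -> : h z = h w + Q z * (z - w) by rewrite -QE addrC subrK.
  by field.
have cK : ccirc r (fun z => z / (z - w)).
  apply: ccirc_ccts => z /neq zw; apply: cctsM; first exact: ccts_id.
  by apply: cctsV => //; apply: cctsB; [exact: ccts_id|exact: ccts_cst].
rewrite cmeanD; [|exact: ccq (ltW r0) _|by apply: ccircM => //; exact: ccirc_cst].
by rewrite qr add0r cmeanZ// cmean_kernel// mulr1.
Qed.

(** Differentiation under the mean, from a second-order Taylor bound on the kernel that is uniform
    on the circle. *)
Lemma is_cderiv_cmean r (psi : C -> C) (k : C -> C -> C) (k' : C -> C) w (d B : R) :
  0 < d -> 0 <= B -> ccirc r psi -> ccirc r k' ->
  (forall u, cnorm u < d -> ccirc r (k ^~ (w + u))) ->
  (forall z u, cnorm z = `|r| -> cnorm u < d ->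
     cnorm (k z (w + u) - k z w - u * k' z) <= B * cnorm u ^+ 2) ->
  is_cderiv (fun v => cmean r (fun z => psi z * k z v)) w (cmean r (fun z => psi z * k' z)).
Proof.
move=> d0 B0 cpsi ck' ck kB e e0.
have [M M0 psiM] := pcts_on_bounded (ltW tpi_gt0) cpsi.
have MB : 0 < 2 * (M * B) + 1 by rewrite ltr_wpDl// !mulr_ge0.
exists (Num.min d (e / (2 * (M * B) + 1))); first by rewrite lt_min d0 divr_gt0.
move=> u u0; rewrite lt_min => /andP[ud ue].
have ckw : ccirc r (k ^~ w) by rewrite -[w]addr0; apply: ck; rewrite cnorm0.
have cku := ck u ud.
have -> : (cmean r (fun z => psi z * k z (w + u)) - cmean r (fun z => psi z * k z w)) / u
   - cmean r (fun z => psi z * k' z) =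
   cmean r (fun z => psi z * (k z (w + u) - k z w - u * k' z)) / u.
  have -> : cmean r (fun z => psi z * (k z (w + u) - k z w - u * k' z)) =
     cmean r (fun z => psi z * k z (w + u)) - cmean r (fun z => psi z * k z w)
     - u * cmean r (fun z => psi z * k' z).
    rewrite -cmeanZ; last exact: ccircM.
    rewrite -cmeanB; [|exact: ccircM|exact: ccircM].
    rewrite -cmeanB; last 2 first.
    - by apply: ccircB; exact: ccircM.
    - by apply: ccircM; [exact: ccirc_cst|exact: ccircM].
    by apply: eq_cmean => z _; ring.
  by field.
have un : 0 < cnorm u by rewrite cnorm_gt0.
rewrite cnorm_div ltr_pdivrMr//.
have : cnorm (cmean r (fun z => psi z * (k z (w + u) - k z w - u * k' z))) <=
    2 * (M * (B * cnorm u ^+ 2)).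
  apply: cmean_norm_le.
    apply: ccircM => //; apply: ccircB; first exact: ccircB.
    by apply: ccircM => //; exact: ccirc_cst.
  move=> t tt; rewrite cnormM; apply: ler_pM; rewrite ?cnorm_ge0//; first exact: psiM.
  by apply: kB => //; rewrite cnorm_circ.
move=> /le_lt_trans; apply.
have -> : 2 * (M * (B * cnorm u ^+ 2)) = (2 * (M * B) * cnorm u) * cnorm u by ring.
rewrite ltr_pM2r//; move: ue; rewrite ltr_pdivlMr// mulrC => ue.
apply: le_lt_trans ue; rewrite ler_wpM2r ?(ltW un)// lerDl//.
Qed.

(** The first part represents the derivative near [w] by a mean, and the second part differentiates
    that mean: together they show that the derivative is again holomorphic. *)
Lemma is_cderiv_cauchy r w h : 0 < r -> cnorm w < r ->
  (forall z, cnorm z <= r -> exists l, is_cderiv h z l) ->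
  is_cderiv h w (cmean r (fun z => h z * z * (z - w) ^- 2)) /\
  exists l, is_cderiv (fun v => cmean r (fun z => h z * z * (z - v) ^- 2)) w l.
Proof.
move=> r0 wr dh; have ch z : cnorm z <= r -> ccts h z by move=> /dh[l /is_cderiv_ccts].
have rr : `|r| = r by rewrite gtr0_norm.
have cpsi : ccirc r (fun z => h z * z).
  apply: ccirc_ccts => z; rewrite rr => zr; apply: cctsM; last exact: ccts_id.
  by apply: ch; rewrite zr.
(* Half the distance to the circle: points moved by less than [d] from [w] stay at distance at least
   [d] from it, so all inverse powers are bounded by those of [d]. *)
pose d := (r - cnorm w) / 2.
have d0 : 0 < d by rewrite divr_gt0// subr_gt0.
have far z u : cnorm z = `|r| -> cnorm u < d -> d <= cnorm (z - (w + u)).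
  rewrite rr => zr ud; rewrite opprD addrA.
  have := cnorm_sub_ge (z - w) u; have := cnorm_sub_ge z w; rewrite zr.
  by move: ud; rewrite /d => *; lra.
have far0 z : cnorm z = `|r| -> d <= cnorm (z - w).
  by move=> zr; have := far z 0 zr; rewrite cnorm0 addr0; apply.
have nz z u : cnorm z = `|r| -> cnorm u < d -> z - (w + u) != 0.
  by move=> zr ud; rewrite -cnorm_gt0 (lt_le_trans d0)// far.
have nz0 z : cnorm z = `|r| -> z - w != 0.
  by move=> zr; rewrite -cnorm_gt0 (lt_le_trans d0)// far0.
have ck n u : cnorm u < d -> ccirc r (fun z => (z - (w + u)) ^- n).
  move=> ud; apply: ccirc_ccts => z zr.
  apply: cctsV; first by rewrite expf_neq0// nz.
  by apply: cctsX; apply: cctsB; [exact: ccts_id|exact: ccts_cst].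
have ck0 n : ccirc r (fun z => (z - w) ^- n).
  by have := ck n 0; rewrite cnorm0 addr0; apply.
have inv_le z u n : cnorm z = `|r| -> cnorm u < d -> cnorm ((z - (w + u)) ^- n) <= d ^- n.
  move=> zr ud; rewrite cnormV cnormX lef_pV2 ?posrE ?exprn_gt0//; last first.
    by rewrite (lt_le_trans d0)// far.
  by rewrite lerXn2r ?nnegrE ?cnorm_ge0 ?(ltW d0)// far.
have inv0_le z n : cnorm z = `|r| -> cnorm ((z - w) ^- n) <= d ^- n.
  by move=> zr; have := inv_le z 0 n zr; rewrite cnorm0 addr0; apply.
split.
  apply: (@is_cderiv_near _ (fun v => cmean r (fun z => h z * z * (z - v)^-1))).
    exists d => // v vw /=; rewrite -[RHS](@cauchy r v)//.
      by apply: eq_cmean => z _; rewrite mulrA.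
    have := cnorm_sub_ge v w; move: vw; rewrite /d => *; lra.
  apply: (@is_cderiv_cmean _ _ (fun z v => (z - v)^-1) _ _ d (d ^- 3)) => //.
  - by rewrite invr_ge0 exprn_ge0// ltW.
  - by move=> u ud; exact: ck 1%N u ud.
  - move=> z u zr ud; have n1 := nz z u zr ud; have n0 := nz0 z zr.
    have -> : (z - (w + u))^-1 - (z - w)^-1 - u * (z - w) ^- 2 =
      (z - (w + u)) ^- 1 * (z - w) ^- 2 * u ^+ 2.
      by field; rewrite n1 n0.
    rewrite cnormM cnormX ler_wpM2r ?sqr_ge0// cnormM.
    have -> : d ^- 3 = d ^- 1 * d ^- 2 by field; rewrite gt_eqF.
    by apply: ler_pM; rewrite ?cnorm_ge0 ?inv_le ?inv0_le.
exists (cmean r (fun z => h z * z * (2 * (z - w) ^- 3))).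
apply: (@is_cderiv_cmean _ _ (fun z v => (z - v) ^- 2) _ _ d (3 * d ^- 4)) => //.
- by rewrite mulr_ge0// invr_ge0 exprn_ge0// ltW.
- by apply: ccircM => //; exact: ccirc_cst.
- by move=> u ud; exact: ck 2%N u ud.
- move=> z u zr ud; have n1 := nz z u zr ud; have n0 := nz0 z zr.
  have -> : (z - (w + u)) ^- 2 - (z - w) ^- 2 - u * (2 * (z - w) ^- 3) =
    ((z - (w + u)) ^- 2 * (z - w) ^- 2 +
     2 * ((z - (w + u)) ^- 1 * (z - w) ^- 3)) * u ^+ 2.
    by field; rewrite n1 n0.
  rewrite cnormM cnormX ler_wpM2r ?sqr_ge0//.
  have -> : 3 * d ^- 4 = d ^- 2 * d ^- 2 + 2 * (d ^- 1 * d ^- 3) by field; rewrite gt_eqF.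
  rewrite (le_trans (cnormD _ _))// lerD//.
    by rewrite cnormM; apply: ler_pM; rewrite ?cnorm_ge0 ?inv_le ?inv0_le.
  rewrite cnormM cnorm_nat ler_wpM2l//.
  by rewrite cnormM; apply: ler_pM; rewrite ?cnorm_ge0 ?inv_le ?inv0_le.
Qed.

Lemma holomorphic_cderiv h : holomorphic_on_disc h -> holomorphic_on_disc (cderiv h).
Proof.
move=> hh w wd; rewrite /disc/= in wd.
pose r := (1 + cnorm w) / 2; have w0 := cnorm_ge0 w.
have r0 : 0 < r by rewrite /r; lra.
have wr : cnorm w < r by rewrite /r; lra.
have dh z : cnorm z <= r -> exists l, is_cderiv h z l.
  by move=> zr; apply: hh; rewrite /disc/= (le_lt_trans zr)// /r; lra.
have [_ [l dl]] := is_cderiv_cauchy r0 wr dh; exists l.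
apply: is_cderiv_near dl; exists (r - cnorm w); first by rewrite subr_gt0.
move=> v vw /=; apply/esym/is_cderivE.
have vr : cnorm v < r by have := cnorm_sub_ge v w; lra.
by have [] := is_cderiv_cauchy r0 vr dh.
Qed.

Lemma holomorphic_cderivn n h : holomorphic_on_disc h -> holomorphic_on_disc (cderivn n h).
Proof. by move=> hh; elim: n => //= n ih; exact: holomorphic_cderiv. Qed.

Lemma is_cderiv_cderivn n h z : holomorphic_on_disc h -> disc z ->
  is_cderiv (cderivn n h) z (cderivn n.+1 h z).
Proof.
by move=> hh /(holomorphic_cderivn n hh)[l dl]; rewrite /= (is_cderivE dl).
Qed.

End cauchy.

(** * The kernel form of H(b) *)

Section kernel_form.
Context {R : realType}.
Local Notation C := R[i].
Implicit Types (b : C -> C) (s t : seq (C * C)).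

(** The inner product of the combination coded by [t] with that coded by [s]: linear in [t],
    conjugate linear in [s]. *)
Definition kform b s t : C :=
  \sum_(x <- s) \sum_(y <- t) y.1 * cconj x.1 * dBR_kernel b x.2 y.2.

Definition kscale (c : C) s : seq (C * C) := map (fun x => (c * x.1, x.2)) s.

Definition in_disc s := forall x, x \in s -> disc x.2.

Lemma knorm2E b s : knorm2 b s = Re (kform b s s). Proof. by []. Qed.

Lemma knegE s : kneg s = kscale (-1) s.
Proof. by apply: eq_map => x; rewrite mulN1r. Qed.

Lemma kform_catl b s1 s2 t : kform b (s1 ++ s2) t = kform b s1 t + kform b s2 t.
Proof. by rewrite /kform big_cat. Qed.

Lemma kform_catr b s t1 t2 : kform b s (t1 ++ t2) = kform b s t1 + kform b s t2.
Proof. by rewrite /kform -big_split; apply: eq_bigr => x _; rewrite big_cat. Qed.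

Lemma kform_scalel b c s t : kform b (kscale c s) t = cconj c * kform b s t.
Proof.
rewrite /kform big_map mulr_sumr; apply: eq_bigr => x _.
rewrite mulr_sumr; apply: eq_bigr => y _ /=; rewrite cconjM; ring.
Qed.

Lemma kform_scaler b c s t : kform b s (kscale c t) = c * kform b s t.
Proof.
rewrite /kform mulr_sumr; apply: eq_bigr => x _.
rewrite big_map mulr_sumr; apply: eq_bigr => y _ /=; ring.
Qed.

Lemma dBR_kernel_conj b z w : cconj (dBR_kernel b z w) = dBR_kernel b w z.
Proof.
rewrite /dBR_kernel cconjM cconjV !cconjD !cconjN !cconjM !cconjK cconj1.
by rewrite (mulrC _ (b w)) (mulrC _ w).
Qed.

Lemma kform_conj b s t : cconj (kform b s t) = kform b t s.
Proof.
rewrite /kform cconj_sum; under eq_bigr do rewrite cconj_sum.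
rewrite exchange_big/=; apply: eq_bigr => y _; apply: eq_bigr => x _.
by rewrite cconjM dBR_kernel_conj cconjM cconjK [cconj _ * _]mulrC.
Qed.

(** The reproducing property: pairing with the kernel at [z] evaluates at [z]. *)
Lemma kform1l b z t : kform b [:: (1, z)] t = kcomb b t z.
Proof.
by rewrite /kform big_seq1 /kcomb; apply: eq_bigr => y _; rewrite cconj1 mulr1.
Qed.

Lemma kform1 b z w : kform b [:: (1, z)] [:: (1, w)] = dBR_kernel b z w.
Proof. by rewrite /kform !big_seq1 cconj1 !mulr1 mul1r. Qed.

Lemma in_disc_cat s t : in_disc s -> in_disc t -> in_disc (s ++ t).
Proof. by move=> hs ht x; rewrite mem_cat => /orP[/hs|/ht]. Qed.

Lemma in_disc_scale c s : in_disc s -> in_disc (kscale c s).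
Proof. by move=> hs x /mapP[y ys ->]; exact: hs y ys. Qed.

Lemma in_disc1 c z : disc z -> in_disc [:: (c, z)].
Proof. by move=> zd x; rewrite inE => /eqP ->. Qed.

End kernel_form.

(** * Positivity of the kernel and the Cauchy-Schwarz inequality *)

Section positivity.
Context {R : realType}.
Local Notation C := R[i].
Context (b : C -> C) (hb : Hinf_ball b).
Implicit Types s t : seq (C * C).

(* With [k_w] the Szego kernel of the disc of radius [r], [G = sum c_i k_(w_i)] and
   [g = sum c_i conj (b w_i) k_(w_i)], the form is [|G|^2 - |g|^2] in the Hardy norm
   of that disc, which is at least [|b g - G|^2 >= 0]. *)
Lemma kernel_positive_radius (r : R) s : 0 < r -> r < 1 ->
  (forall x, x \in s -> cnorm x.2 < r) ->
  0 <= Re (\sum_(x <- s) \sum_(y <- s) y.1 * cconj x.1 *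
     ((1 - b x.2 * cconj (b y.2)) / (1 - x.2 * cconj y.2 * (r ^- 2)%:C%C))).
Proof.
move=> r0 r1 sr; have [bh b1] := hb; have rr : `|r| = r by rewrite gtr0_norm.
pose k (w z : C) := (1 - z * cconj w * (r ^- 2)%:C%C)^-1.
have kn w z : cnorm w < r -> cnorm z <= r -> 1 - z * cconj w * (r ^- 2)%:C%C != 0.
  move=> wr zr; rewrite subr_eq0 eq_sym; apply: contraTneq wr => E.
  have : cnorm (z * cconj w * (r ^- 2)%:C%C) = 1 by rewrite E cnorm1.
  rewrite !cnormM cnorm_conj cnorm_real ger0_norm ?invr_ge0 ?sqr_ge0// => E1.
  rewrite -leNgt -(ler_pM2r r0) -[leLHS]mulr1 -E1.
  have -> : r * r * (cnorm z * cnorm w / r ^+ 2) = cnorm w * cnorm z by field; rewrite gt_eqF.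
  by rewrite ler_wpM2l ?cnorm_ge0.
have dk w z : cnorm w < r -> cnorm z <= r -> exists l, is_cderiv (k w) z l.
  move=> wr zr; exists (- (0 - 1 * (cconj w * (r ^- 2)%:C%C)) / (1 - z * (cconj w * (r ^- 2)%:C%C)) ^+ 2).
  rewrite /k (_ : (fun z => _) = fun z => (1 - z * (cconj w * (r ^- 2)%:C%C))^-1); last first.
    by apply/funext => u; rewrite mulrA.
  apply: is_cderivV; first by rewrite mulrA kn.
  apply: is_cderivB; first exact: is_cderiv_cst.
  rewrite -[X in is_cderiv _ _ X]addr0 -[X in _ + X](mulr0 z).
  by apply: is_cderivM; [exact: is_cderiv_id|exact: is_cderiv_cst].
have db z : cnorm z <= r -> exists l, is_cderiv b z l.
  by move=> zr; apply: bh; exact: le_lt_trans zr r1.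
have conjk w z : cnorm w < r -> cnorm z = r -> cconj (k w z) = z / (z - w).
  move=> wr zr; have z0 : z != 0 by rewrite -cnorm_gt0 zr.
  have zw : z - w != 0 by rewrite subr_eq0; apply: contraTneq wr => <-; rewrite zr ltxx.
  rewrite /k cconjV cconjD cconjN !cconjM cconj1 cconjK cconj_real.
  have -> : cconj z = (r ^+ 2)%:C%C / z by rewrite -[r]zr -mulcconj; field.
  have r20 : (r ^+ 2)%:C%C != 0 :> C by rewrite -cnorm_gt0 cnorm_real normr_gt0 expf_neq0// gt_eqF.
  rewrite fmorphV/=; move: (_%:C%C) r20 => a a0; field.
  by rewrite z0 a0 zw.
have dsum (c : C * C -> C) z : cnorm z <= r ->
    exists l, is_cderiv (fun z => \sum_(y <- s) c y * k y.2 z) z l.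
  move=> zr; elim: s sr => [|y s' ih] sr.
    by exists 0; under eq_fun do rewrite big_nil; exact: is_cderiv_cst.
  have [|l dl] := ih; first by move=> x xs; apply: sr; rewrite inE xs orbT.
  have [|l' dl'] := dk y.2 z _ zr; first by apply: sr; rewrite mem_head.
  exists (c y * l' + l); under eq_fun do rewrite big_cons.
  exact: is_cderivD (is_cderivZ (c y) dl') dl.
have rep H x : x \in s -> (forall z, cnorm z <= r -> exists l, is_cderiv H z l) ->
    cmean r (fun z => H z * cconj (k x.2 z)) = H x.2.
  move=> xs dH; rewrite -(cauchy r0 (sr x xs) dH).
  by apply: eq_cmean => z; rewrite rr => zr; rewrite conjk// sr.
have cH H : (forall z, cnorm z <= r -> exists l, is_cderiv H z l) -> ccirc r H.
  move=> dH; apply: ccirc_ccts => z; rewrite rr => zr.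
  by have [|l /is_cderiv_ccts] := dH z; rewrite ?zr.
have ck x : x \in s -> ccirc r (k x.2).
  by move=> /sr xr; apply: cH => z; exact: dk.
pose G z := \sum_(y <- s) y.1 * k y.2 z.
pose g z := \sum_(y <- s) y.1 * cconj (b y.2) * k y.2 z.
have dG z : cnorm z <= r -> exists l, is_cderiv G z l by exact: (dsum (fun y => y.1)).
have dg z : cnorm z <= r -> exists l, is_cderiv g z l.
  exact: (dsum (fun y => y.1 * cconj (b y.2))).
have dbg z : cnorm z <= r -> exists l, is_cderiv (fun z => b z * g z) z l.
  move=> zr; have [l1 d1] := db z zr; have [l2 d2] := dg z zr.
  by eexists; exact: is_cderivM d1 d2.
have expand H (c : C * C -> C) : (forall z, cnorm z <= r -> exists l, is_cderiv H z l) ->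
    cmean r (fun z => H z * cconj (\sum_(x <- s) c x * k x.2 z)) = \sum_(x <- s) cconj (c x) * H x.2.
  (* [cmean_sum] asks for continuity of every summand, while [k x.2] is controlled only for [x] in
     [s]; the test replaces the other summands by 0. *)
  move=> dH; transitivity (cmean r (fun z => \sum_(x <- s)
      if x \in s then cconj (c x) * (H z * cconj (k x.2 z)) else 0)).
    apply: eq_cmean => z _; rewrite cconj_sum mulr_sumr; apply: eq_big_seq => x xs.
    by rewrite xs cconjM; ring.
  have cx x : x \in s -> ccirc r (fun z => cconj (c x) * (H z * cconj (k x.2 z))).
    move=> xs; apply: ccircM; first exact: ccirc_cst.
    by apply: ccircM; [exact: cH|apply: ccirc_conj; exact: ck].
  rewrite (@cmean_sum _ _ _ _ (fun x z => if x \in s then cconj (c x) * (H z * cconj (k x.2 z)) else 0)); last first.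
    by move=> x; case xs: (x \in s); [exact: cx|exact: ccirc_cst].
  apply: eq_big_seq => x xs; rewrite xs.
  rewrite cmeanZ; first by rewrite rep.
  by apply: ccircM; [exact: cH|apply: ccirc_conj; exact: ck].
have expG H : (forall z, cnorm z <= r -> exists l, is_cderiv H z l) ->
    cmean r (fun z => H z * cconj (G z)) = \sum_(x <- s) cconj x.1 * H x.2.
  exact: (expand H (fun x => x.1)).
have expg H : (forall z, cnorm z <= r -> exists l, is_cderiv H z l) ->
    cmean r (fun z => H z * cconj (g z)) = \sum_(x <- s) cconj (x.1 * cconj (b x.2)) * H x.2.
  exact: (expand H (fun x => x.1 * cconj (b x.2))).
pose AA := cmean r (fun z => G z * cconj (G z)).
pose BB := cmean r (fun z => g z * cconj (g z)).
(* Both sides are the sum of conj c_i b(w_i) g(w_i): the coefficients of [g] are those of [G] times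
   conj b(w_i). *)
have BE : cmean r (fun z => b z * g z * cconj (G z)) = BB.
  rewrite /BB (expG (fun z => b z * g z) dbg) (expg g dg).
  by apply: eq_bigr => x _; rewrite cconjM cconjK; ring.
have -> : \sum_(x <- s) \sum_(y <- s) y.1 * cconj x.1 *
     ((1 - b x.2 * cconj (b y.2)) / (1 - x.2 * cconj y.2 * (r ^- 2)%:C%C)) = AA - BB.
  rewrite /AA /BB (expG G dG) (expg g dg).
  rewrite -sumrB; apply: eq_bigr => x _; rewrite cconjM cconjK /G /g !mulr_sumr -sumrB.
  by apply: eq_bigr => y _; rewrite /k; ring.
have cG := cH _ dG; have cg := cH _ dg; have cbg := cH _ dbg; have cb := cH _ db.
(* The integrand is |b g - G|^2 + (1 - |b|^2) |g|^2, and by [BE] its mean has real part that of AA +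
   BB - 2 BB. *)
have : 0 <= Re (cmean r (fun z => G z * cconj (G z) + g z * cconj (g z) -
     (b z * g z * cconj (G z) + cconj (b z * g z * cconj (G z))))).
  apply: Re_cmean_ge0 => z; rewrite rr => zr.
  have -> : G z * cconj (G z) + g z * cconj (g z) -
     (b z * g z * cconj (G z) + cconj (b z * g z * cconj (G z))) =
     (b z * g z - G z) * cconj (b z * g z - G z) + (1 - b z * cconj (b z)) * (g z * cconj (g z)).
    by rewrite !(cconjM, cconjD, cconjN, cconjK); ring.
  rewrite !mulcconj ReD [X in _ + Re X]mulrC ReZ ReD ReN; apply: addr_ge0; first exact: sqr_ge0.
  apply: mulr_ge0; first exact: sqr_ge0.
  rewrite -[X in _ <= X]/(1 - cnorm (b z) ^+ 2) subr_ge0 exprn_ile1 ?cnorm_ge0// b1//.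
  by rewrite /disc/= zr.
rewrite cmeanB; last 2 first.
- by apply: ccircD; apply: ccircM => //; exact: ccirc_conj.
- by apply: ccircD; [|apply: ccirc_conj]; apply: ccircM => //; exact: ccirc_conj.
rewrite cmeanD; last 2 first.
- by apply: ccircM => //; exact: ccirc_conj.
- by apply: ccircM => //; exact: ccirc_conj.
rewrite cmeanD; last 2 first.
- by apply: ccircM => //; exact: ccirc_conj.
- by apply: ccirc_conj; apply: ccircM => //; exact: ccirc_conj.
rewrite cmean_conj; last by apply: ccircM => //; exact: ccirc_conj.
rewrite BE -/AA -/BB; move: AA BB {BE} => u v.
by rewrite !ReD !ReN ReD (Re_conj v); lra.
Qed.

Lemma in_disc_radius s : in_disc s -> exists2 rho : R, 0 < rho < 1 & forall x, x \in s -> cnorm x.2 <= rho.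
Proof.
elim: s => [|y s ih] hs; first by exists 2^-1 => //; apply/andP; split; lra.
have [|rho /andP[rho0 rho1] h] := ih; first by move=> x xs; apply: hs; rewrite inE xs orbT.
exists (Num.max rho (cnorm y.2)).
  rewrite lt_max rho0/= gt_max rho1/=; exact: (hs y (mem_head _ _)).
move=> x; rewrite inE => /orP[/eqP ->|/h xr]; first by rewrite le_max lexx orbT.
by rewrite le_max xr.
Qed.

Lemma one_sub_mulconj_neq0 (z w : C) : disc z -> disc w -> 1 - z * cconj w != 0.
Proof.
rewrite /disc/= => z1 w1; rewrite subr_eq0 eq_sym.
apply: contraTneq (mulr_ilt1 (cnorm_ge0 z) (cnorm_ge0 w) z1 w1) => E.
by rewrite -(cnorm_conj w) -cnormM E cnorm1 ltxx.
Qed.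

(** The finitely many points lie in a smaller disc, so positivity holds for every radius [r] near 1;
    the form of radius [r] tends to the kernel form as [r] tends to 1. *)
Lemma knorm2_ge0 s : in_disc s -> 0 <= knorm2 b s.
Proof.
move=> hs; rewrite leNgt; apply/negP => neg.
have [rho /andP[rho0 rho1] hrho] := in_disc_radius hs.
pose f (r : R) := \sum_(x <- s) \sum_(y <- s) y.1 * cconj x.1 *
     ((1 - b x.2 * cconj (b y.2)) / (1 - x.2 * cconj y.2 * (r ^- 2)%:C%C)).
(* The membership test again makes every summand converge, as [clim_sum] requires of all indices. *)
pose term (x y : C * C) (r : R) := if (x \in s) && (y \in s) then y.1 * cconj x.1 *
     ((1 - b x.2 * cconj (b y.2)) / (1 - x.2 * cconj y.2 * (r ^- 2)%:C%C)) else 0.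
have fE r : f r = \sum_(x <- s) \sum_(y <- s) term x y r.
  by apply: eq_big_seq => x xs; apply: eq_big_seq => y ys; rewrite /term xs ys.
have f1 : f 1 = kform b s s.
  apply: eq_bigr => x _; apply: eq_bigr => y _.
  by rewrite expr1n invr1 mulr1.
have lr : clim (nbhs (1 : R)) (fun r => (r ^- 2)%:C%C) (1 ^- 2)%:C%C.
  apply/clim_ReIm; split => /=; last exact: cvg_cst.
  apply: cvgV; first by rewrite expr1n oner_neq0.
  by apply: (@exprn_continuous _ 2).
have fc : clim (nbhs (1 : R)) f (f 1).
  rewrite fE (_ : f = fun r => \sum_(x <- s) \sum_(y <- s) term x y r); last exact/funext.
  apply: (@clim_sum _ _ _ _ _ _ (fun x r => \sum_(y <- s) term x y r)) => x.
  apply: (@clim_sum _ _ _ _ _ _ (fun y r => term x y r)) => y.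
  rewrite /term; case: ifPn => [/andP[xs ys]|_]; last exact: clim_cst.
  apply: climM; first exact: clim_cst.
  apply: climM; first exact: clim_cst.
  apply: climV.
    by rewrite expr1n invr1 mulr1; apply: one_sub_mulconj_neq0; exact: hs.
  apply: climB; first exact: clim_cst.
  by apply: climM => //; exact: clim_cst.
have e0 : 0 < - knorm2 b s by rewrite oppr_gt0.
have [d /= d0 dE] := fc _ e0.
pose r := Num.max ((1 + rho) / 2) (1 - d / 2).
have r1 : r < 1 by rewrite gt_max; apply/andP; split; lra.
have rr : rho < r by rewrite lt_max; apply/orP; left; lra.
have r0 : 0 < r by exact: lt_trans rr.
have rd : `|1 - r| < d.
  have : 1 - d / 2 <= r by rewrite le_max lexx orbT.
  by move=> ?; rewrite ltr_norml; apply/andP; split; lra.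
have := dE r rd; rewrite f1 => /(le_lt_trans (normr_Re_le _)).
rewrite ReD ReN -knorm2E ltr_norml => /andP[_].
have : 0 <= Re (f r).
  by apply: kernel_positive_radius => // x /hrho h; exact: le_lt_trans rr.
lra.
Qed.

Lemma knorm2_cat_scale s t (c : C) : knorm2 b (s ++ kscale c t) =
  knorm2 b s + 2 * Re (c * kform b s t) + cnorm c ^+ 2 * knorm2 b t.
Proof.
rewrite !knorm2E kform_catl !kform_catr !kform_scalel !kform_scaler -(kform_conj b s t) -cconjM mulrA.
rewrite (mulrC _ c) mulcconj !ReD ReZ /=; ring.
Qed.

Lemma kform_cauchy_schwarz s t : in_disc s -> in_disc t ->
  cnorm (kform b s t) ^+ 2 <= knorm2 b s * knorm2 b t.
Proof.
move=> hs ht; set F := kform b s t.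
have Q0 := knorm2_ge0 hs; have Q1 := knorm2_ge0 ht.
have main (l : R) : 0 <= knorm2 b s - 2 * l * cnorm F ^+ 2 + l ^+ 2 * cnorm F ^+ 2 * knorm2 b t.
  have := knorm2_ge0 (in_disc_cat hs (in_disc_scale (c := - (l%:C%C * cconj F)) ht)).
  rewrite knorm2_cat_scale -/F (_ : - (l%:C%C * cconj F) * F = - (l%:C%C * (F * cconj F))); last by ring.
  rewrite mulcconj ReN ReZ Re_real cnormN cnormM.
  rewrite cnorm_real cnorm_conj exprMn real_normK ?num_real//.
  by move: (knorm2 b s) (knorm2 b t) (cnorm F) => *; lra.
have [Qt0|Qt0] := eqVneq (knorm2 b t) 0; last first.
  have := main (knorm2 b t)^-1.
  have -> : knorm2 b s - 2 * (knorm2 b t)^-1 * cnorm F ^+ 2 +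
    (knorm2 b t)^-1 ^+ 2 * cnorm F ^+ 2 * knorm2 b t =
    (knorm2 b s * knorm2 b t - cnorm F ^+ 2) / knorm2 b t by field.
  have Qp : 0 < knorm2 b t by rewrite lt_def Qt0.
  by rewrite pmulr_lge0 ?invr_gt0// subr_ge0.
rewrite Qt0 mulr0 leNgt; apply/negP => F0.
(* When [t] has norm 0 the quadratic in [l] degenerates to an affine function; this [l] gives it the
   value - [knorm2 b s] - 2 < 0. *)
have := main ((knorm2 b s + 1) / (cnorm F ^+ 2)); rewrite Qt0 mulr0 addr0.
rewrite -mulrA divfK ?gt_eqF//; lra.
Qed.

End positivity.

(** * Growth of functions with finite Dirichlet integral *)

Section measure.
Context {R : realType}.

(* No measurability is needed: the integral of a nonnegative function is a
   supremum over simple functions below it. *)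
Lemma ge0_le_integral_sub d (T : measurableType d) (m : {measure set T -> \bar R})
    (D E : set T) (f g : T -> \bar R) : D `<=` E ->
  (forall x, D x -> 0 <= f x)%E -> (forall x, E x -> 0 <= g x)%E ->
  (forall x, D x -> f x <= g x)%E ->
  (\int[m]_(x in D) f x <= \int[m]_(x in E) g x)%E.
Proof.
move=> DE f0 g0 fg; rewrite !ge0_integralE//; apply: le_ereal_sup => _ [h /= hf <-].
exists h => //= x; apply: le_trans (hf x) _; rewrite /patch.
case: ifPn => [|_]; first by rewrite inE => xD; rewrite mem_set; [exact: fg|exact: DE].
by case: ifPn => // /set_mem /g0.
Qed.

(** Measurability for the product sigma-algebra: rounding both coordinates down to a grid of mesh 1
    / (n + 1) gives step functions on countably many rectangles, which converge pointwise to [f] by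
    continuity. *)
Lemma measurable_fun_continuous2 (f : R * R -> R) :
  (forall p (e : R), 0 < e -> exists2 d : R, 0 < d &
    forall q, `|q.1 - p.1| < d -> `|q.2 - p.2| < d -> `|f q - f p| < e) ->
  measurable_fun setT f.
Proof.
move=> cf; pose h (n : nat) (x : R) : R := (Num.floor (x * n.+1%:R))%:~R / n.+1%:R.
have hn n x : `|h n x - x| <= n.+1%:R^-1.
  have n0 : 0 < n.+1%:R :> R by rewrite ltr0n.
  have /andP[f1 f2] := floor_itv (x * n.+1%:R).
  have -> : h n x - x = ((Num.floor (x * n.+1%:R))%:~R - x * n.+1%:R) / n.+1%:R.
    by rewrite /h mulrBl mulfK// gt_eqF.
  rewrite normrM [X in _ * X]gtr0_norm ?invr_gt0// -[leRHS]mul1r ler_pM2r ?invr_gt0//.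
  move: f2; rewrite intrD1 ler_norml => f2; apply/andP; split; lra.
apply: (@measurable_realfun.measurable_fun_cvg _ _ _ _ (fun n p => f (h n p.1, h n p.2))).
  move=> n _ Y mY; rewrite setTI.
  pose I (k : int) : set R := [set x | Num.floor (x * n.+1%:R) = k].
  have mI k : measurable (I k).
    have n0 : 0 < n.+1%:R :> R by rewrite ltr0n.
    rewrite (_ : I k = `[k%:~R / n.+1%:R, (k + 1)%:~R / n.+1%:R[%classic); first exact: measurable_itv.
    apply/seteqP; split=> x /=; rewrite in_itv/= ler_pdivrMr// ltr_pdivlMr//.
      by move=> <-; exact: floor_itv _.
    exact: floor_def.
  pose Fk (k : int * int) : set (R * R) :=
    [set p | Y (f (k.1%:~R / n.+1%:R, k.2%:~R / n.+1%:R)) /\ (I k.1 `*` I k.2) p].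
  rewrite [X in measurable X](_ : _ = \bigcup_k Fk k); last first.
    apply/seteqP; split=> [p /= Yp|p [k _ [Yp [/= p1 p2]]]].
      by exists (Num.floor (p.1 * n.+1%:R), Num.floor (p.2 * n.+1%:R)).
    by rewrite /h p1 p2.
  apply: countable_bigcupT_measurable => // k.
  have [Yk|Yk] := pselect (Y (f (k.1%:~R / n.+1%:R, k.2%:~R / n.+1%:R))).
    rewrite (_ : Fk k = I k.1 `*` I k.2); first exact: measurableX.
    by apply/seteqP; split=> p //= [].
  rewrite (_ : Fk k = set0)//; apply/seteqP; split=> p //= [].
  by move=> /Yk.
move=> p _; apply/cvgrPdist_lt => e e0; have [d d0 dE] := cf p e e0.
have [N _ hN] := near_infty_natSinv_lt (PosNum d0).
exists N => // n /= Nn; rewrite distrC.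
have := hN n Nn; rewrite /= => nd.
by apply: dE; apply: le_lt_trans nd => /=; exact: hn.
Qed.

End measure.

(** * Cauchy's formula on rectangles and the area mean value estimate *)

Section area.
Context {R : realType}.
Local Notation C := R[i].

(** Continuity at the exceptional point is enough: cutting away four rectangles leaves a small
    square around it, where [F] is bounded and the perimeter is arbitrarily short. *)
Lemma goursat_punctured (F : C -> C) (x1 x2 y1 y2 a b : R) :
  x1 < a < x2 -> y1 < b < y2 ->
  (forall x y, x1 <= x <= x2 -> y1 <= y <= y2 -> ccts F (Complex x y)) ->
  (forall x y, x1 <= x <= x2 -> y1 <= y <= y2 -> Complex x y != Complex a b ->
    exists l, is_cderiv F (Complex x y) l) ->
  rect_int F x1 x2 y1 y2 = 0.
Proof.
move=> /andP[xa ax] /andP[yb by_] cF dF.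
apply/eqP; rewrite -cnorm_eq0 eq_le cnorm_ge0 andbT; apply/ler_addgt0Pr => e e0; rewrite add0r.
have ca : ccts F (Complex a b) by apply: cF; lra.
have [d d0 dE] := ca 1 ltr01.
(* With remainder bound 1, [rect_int_affine_le] gives 4 (2 s + 2 s) = 16 s on the small square,
   whence [e / 16]; the bound [d / 4] keeps the square where [F] varies by less than 1. *)
pose s := Num.min (Num.min (a - x1) (x2 - a)) (Num.min (Num.min (b - y1) (y2 - b))
  (Num.min (e / 16) (d / 4))).
have s0 : 0 < s by rewrite !lt_min !subr_gt0 xa ax yb by_ !divr_gt0.
have [s1 [s2 [s3 [s4 [s5 s6]]]]] : s <= a - x1 /\ s <= x2 - a /\ s <= b - y1 /\ s <= y2 - b /\
   s <= e / 16 /\ s <= d / 4.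
  by rewrite /s; do !split; rewrite !ge_min lexx ?orbT.
have neqx x y : x < a \/ a < x -> Complex x y != Complex a b.
  by move=> h; apply/eqP => -[E _]; move: h; rewrite E ltxx => -[].
have neqy x y : y < b \/ b < y -> Complex x y != Complex a b.
  by move=> h; apply/eqP => -[_ E]; move: h; rewrite E ltxx => -[].
have cH y u v : y1 <= y <= y2 -> x1 <= u -> v <= x2 -> pcts_on u v (fun x => F (Complex x y)).
  by move=> hy hu hv; apply: pcts_hor => x hx; apply: cF => //; lra.
have cV x u v : x1 <= x <= x2 -> y1 <= u -> v <= y2 -> pcts_on u v (fun y => F (Complex x y)).
  by move=> hx hu hv; apply: pcts_ver => y hy; apply: cF => //; lra.
have -> : rect_int F x1 x2 y1 y2 = rect_int F (a - s) (a + s) (b - s) (b + s).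
  rewrite (@rect_int_splitx _ _ x1 (a - s) x2); [|lra|lra|apply: cH; lra|apply: cH; lra].
  rewrite (@rect_int_splitx _ _ (a - s) (a + s) x2); [|lra|lra|apply: cH; lra|apply: cH; lra].
  rewrite (@rect_int_splity _ _ (a - s) (a + s) y1 (b - s)); [|lra|lra|apply: cV; lra|apply: cV; lra].
  rewrite (@rect_int_splity _ _ (a - s) (a + s) (b - s) (b + s)); [|lra|lra|apply: cV; lra|apply: cV; lra].
  rewrite (@goursat _ _ x1 (a - s)); [|lra|lra|]; last first.
    by move=> x y hx hy; apply: dF; [lra|lra|apply: neqx; lra].
  rewrite (@goursat _ _ (a + s) x2); [|lra|lra|]; last first.
    by move=> x y hx hy; apply: dF; [lra|lra|apply: neqx; lra].
  rewrite (@goursat _ _ _ _ y1 (b - s)); [|lra|lra|]; last first.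
    by move=> x y hx hy; apply: dF; [lra|lra|apply: neqy; lra].
  rewrite (@goursat _ _ _ _ (b + s) y2); [|lra|lra|]; last first.
    by move=> x y hx hy; apply: dF; [lra|lra|apply: neqy; lra].
  by rewrite !add0r !addr0.
apply: le_trans (@rect_int_affine_le _ F _ _ _ _ 0 (F (Complex a b)) 0 1 _ _ _ _) _; [lra|lra| | |].
- by move=> x y hx hy; apply: cF; lra.
- move=> x y hx hy; rewrite mul0r subr0; apply/ltW/dE.
  rewrite (le_lt_trans (cnorm_le_ReIm _))// !ReD !ImD !ReN !ImN/=.
  have h1 : `|x - a| <= s by rewrite ler_norml; apply/andP; split; lra.
  have h2 : `|y - b| <= s by rewrite ler_norml; apply/andP; split; lra.
  lra.
- lra.
Qed.

Lemma cint_norm_le_Rintegral (a b : R) (f : R -> C) (phi : R -> R) :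
  pcts_on a b f -> rcts_on a b phi -> (forall t, a <= t <= b -> cnorm (f t) <= phi t) ->
  cnorm (cint a b f) <= 2 * \int[lebR]_(t in `[a, b]) phi t.
Proof.
move=> cf cphi fphi; apply: le_trans (cnorm_le_ReIm _) _.
have aux (g : R -> R) : rcts_on a b g -> (forall t, a <= t <= b -> `|g t| <= phi t) ->
    `|\int[lebR]_(t in `[a, b]) g t| <= \int[lebR]_(t in `[a, b]) phi t.
  move=> cg gphi; apply: le_trans (le_normr_Rintegral _ _) _ => //.
    exact: rcts_integrable.
  apply: Rintegral_segment_le => // t tab.
  by apply: cvg_norm; exact: cg.
rewrite mulr_natl mulr2n lerD// aux//.
- exact: pcts_on_Re.
- by move=> t tab; rewrite (le_trans (normr_Re_le _))// fphi.
- exact: pcts_on_Im.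
- by move=> t tab; rewrite (le_trans (normr_Im_le _))// fphi.
Qed.

(** A function cannot exceed its average everywhere; this selects the sides of the rectangle in
    [area_bound]. *)
Lemma exists_le_of_integral_le (phi : R -> \bar R) (al be M k : R) : al <= be ->
  (forall x, 0 <= phi x)%E -> (\int[lebR]_x phi x <= M%:E)%E -> 0 <= k -> M < k * (be - al) ->
  exists2 x, al <= x <= be & (phi x <= k%:E)%E.
Proof.
move=> ab phi0 phiM k0 Mk; apply: contrapT => H.
have Hk x : `[al, be]%classic x -> (k%:E <= phi x)%E.
  rewrite /= in_itv/= => xab; rewrite leNgt; apply/negP => h; apply: H.
  by exists x => //; exact: ltW.
have : (\int[lebR]_(x in `[al, be]) k%:E <= \int[lebR]_x phi x)%E.
  by apply: ge0_le_integral_sub => // x _; rewrite lee_fin.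
rewrite integral_cst//= lebesgue_measure_itv/= => h.
have := le_trans h phiM; rewrite leNgt => /negP; apply.
case: ifPn => [_|]; first by rewrite -EFinB -EFinM lte_fin.
rewrite lte_fin -leNgt => ba; rewrite mule0 lte_fin (lt_le_trans Mk)//.
by rewrite mulr_ge0_le0// subr_le0.
Qed.

End area.

Section area_bound.
Context {R : realType}.
Local Notation C := R[i].

(* The integral has modulus [2 pi]; the crude bound 1 comes from the imaginary
   part, each side contributing at least 1/4. *)
Lemma rect_int_winding (x1 x2 y1 y2 a b rho : R) : 0 < rho ->
  a - rho <= x1 <= a - rho / 2 -> a + rho / 2 <= x2 <= a + rho ->
  b - rho <= y1 <= b - rho / 2 -> b + rho / 2 <= y2 <= b + rho ->
  1 <= cnorm (rect_int (fun z => (z - Complex a b)^-1) x1 x2 y1 y2).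
Proof.
move=> rho0 /andP[x1l x1u] /andP[x2l x2u] /andP[y1l y1u] /andP[y2l y2u].
have cinv x y : Complex x y != Complex a b -> ccts (fun z : C => (z - Complex a b)^-1) (Complex x y).
  move=> h; apply: cctsV; first by rewrite subr_eq0.
  by apply: cctsB; [exact: ccts_id|exact: ccts_cst].
have neqx x y : x != a -> Complex x y != Complex a b :> C.
  by move=> h; apply/eqP => -[E _]; rewrite E eqxx in h.
have neqy x y : y != b -> Complex x y != Complex a b :> C.
  by move=> h; apply/eqP => -[_ E]; rewrite E eqxx in h.
have cH y : y != b -> pcts_on x1 x2 (fun x => (Complex x y - Complex a b)^-1).
  by move=> h; apply: (@pcts_hor _ (fun z => (z - Complex a b)^-1)) => x _; apply: cinv; exact: neqy.
have cV x : x != a -> pcts_on y1 y2 (fun y => (Complex x y - Complex a b)^-1).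
  by move=> h; apply: (@pcts_ver _ (fun z => (z - Complex a b)^-1)) => y _; apply: cinv; exact: neqx.
have invE x y : (Complex x y - Complex a b)^-1 =
    Complex ((x - a) / ((x - a) ^+ 2 + (y - b) ^+ 2)) (- ((y - b) / ((x - a) ^+ 2 + (y - b) ^+ 2))).
  by [].
have n2_le x y : a - rho <= x <= a + rho -> b - rho <= y <= b + rho ->
    (x - a) ^+ 2 + (y - b) ^+ 2 <= 2 * rho ^+ 2.
  move=> hx hy; have h1 : `|x - a| <= rho by rewrite ler_norml; apply/andP; split; lra.
  have h2 : `|y - b| <= rho by rewrite ler_norml; apply/andP; split; lra.
  rewrite mulr_natl mulr2n -(real_normK (num_real (x - a))) -(real_normK (num_real (y - b))).
  by rewrite lerD// lerXn2r ?nnegrE// ltW.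
(* Each side has length at least [rho], and the relevant part of the integrand is at least (rho / 2)
   / (2 rho^2) = 1 / (4 rho). *)
have quarter (al be : R) (g : R -> R) : rho <= be - al -> rcts_on al be g ->
    (forall t, al <= t <= be -> (4 * rho)^-1 <= g t) -> 4^-1 <= \int[lebR]_(t in `[al, be]) g t.
  move=> len cg gl; apply: le_trans (_ : (4 * rho)^-1 * (be - al) <= _).
    have -> : 4^-1 = (4 * rho)^-1 * rho by field; rewrite gt_eqF.
    by rewrite ler_wpM2l// invr_ge0 mulr_ge0// ltW.
  rewrite -Rintegral_segment_cst; last by lra.
  by apply: Rintegral_segment_le => // t _; exact: cvg_cst.
have frac (u n : R) : rho / 2 <= u -> 0 < n -> n <= 2 * rho ^+ 2 -> (4 * rho)^-1 <= u / n.
  move=> hu n0 hn; apply: le_trans (_ : (rho / 2) / (2 * rho ^+ 2) <= _).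
    have -> : (4 * rho)^-1 = rho / 2 / (2 * rho ^+ 2) by field; rewrite gt_eqF.
    exact: lexx.
  apply: ler_pM => //; first by rewrite divr_ge0// ltW.
    by rewrite invr_ge0 mulr_ge0// sqr_ge0.
  by rewrite lef_pV2 ?posrE// mulr_gt0// exprn_gt0.
have n2_gt x y : x != a \/ y != b -> 0 < (x - a) ^+ 2 + (y - b) ^+ 2.
  move=> [h|h]; [rewrite ltr_pwDl ?sqr_ge0//|rewrite ltr_wpDl ?sqr_ge0//];
    by rewrite lt_def sqr_ge0 sqrf_eq0 subr_eq0 h.
have [nx1 [nx2 [ny1 ny2]]] : x1 != a /\ x2 != a /\ y1 != b /\ y2 != b.
  by do !split; apply/eqP; lra.
apply: le_trans (_ : Im (rect_int (fun z => (z - Complex a b)^-1) x1 x2 y1 y2) <= _); last first.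
  exact: le_trans (ler_norm _) (normr_Im_le _).
rewrite /rect_int ImD ImD ImN [_ * (_ - _)]mulrC ImiRe ReD ReN !Re_cint !Im_cint.
have h1 : 4^-1 <= \int[lebR]_(x in `[x1, x2]) Im (Complex x y1 - Complex a b)^-1.
  apply: quarter; first by lra.
    exact: pcts_on_Im (cH _ ny1).
  move=> x hx; rewrite invE /= -mulNr; apply: frac; [lra|apply: n2_gt; right|apply: n2_le; lra] => //.
have h2 : 4^-1 <= - \int[lebR]_(x in `[x1, x2]) Im (Complex x y2 - Complex a b)^-1.
  rewrite -mulN1r -RintegralZl//; last exact/rcts_integrable/pcts_on_Im/cH.
  apply: quarter; first by lra.
    by move=> t ht; apply: cvgM; [exact: cvg_cst|apply: (pcts_on_Im (cH _ ny2))].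
  move=> x hx; rewrite invE /= mulN1r opprK; apply: frac; [lra|apply: n2_gt; right|apply: n2_le; lra] => //.
have h3 : 4^-1 <= \int[lebR]_(y in `[y1, y2]) Re (Complex x2 y - Complex a b)^-1.
  apply: quarter; first by lra.
    exact: pcts_on_Re (cV _ nx2).
  move=> y hy; rewrite invE /=; apply: frac; [lra|apply: n2_gt; left|apply: n2_le; lra] => //.
have h4 : 4^-1 <= - \int[lebR]_(y in `[y1, y2]) Re (Complex x1 y - Complex a b)^-1.
  rewrite -mulN1r -RintegralZl//; last exact/rcts_integrable/pcts_on_Re/cV.
  apply: quarter; first by lra.
    by move=> t ht; apply: cvgM; [exact: cvg_cst|apply: (pcts_on_Re (cV _ nx1))].
  move=> y hy; rewrite invE /= mulN1r -mulNr; apply: frac; [lra|apply: n2_gt; left|apply: n2_le; lra] => //.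
move: h1 h2 h3 h4; clear; lra.
Qed.

End area_bound.

Section area_bound.
Context {R : realType}.
Local Notation C := R[i].

Definition square (a b rho : R) : set (R * R) := `[a - rho, a + rho] `*` `[b - rho, b + rho].

Lemma measurable_square a b rho : measurable (square a b rho).
Proof. by apply: measurableX; exact: measurable_itv. Qed.

(* Cauchy's formula on a rectangle around [(a, b)] whose four sides, chosen by Fubini
   at distance between [rho / 2] and [rho] from the centre, each carry an integral
   of [|H|] at most [4 M / rho]. *)
Lemma area_bound (H : C -> C) (a b rho M : R) : 0 < rho -> 0 < M ->
  (forall x y, a - rho <= x <= a + rho -> b - rho <= y <= b + rho ->
    exists l, is_cderiv H (Complex x y) l) ->
  (\int[(@lebesgue_measure R \x @lebesgue_measure R)%E]_(p in square a b rho)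
     (cnorm (H (to_C p)))%:E <= M%:E)%E ->
  cnorm (H (Complex a b)) <= 64 * M / rho ^+ 2.
Proof.
move=> rho0 M0 dH HM.
have cH x y : a - rho <= x <= a + rho -> b - rho <= y <= b + rho -> ccts H (Complex x y).
  by move=> hx hy; have [l /is_cderiv_ccts] := dH x y hx hy.
(* [H] is controlled only on the square; composing with the 1-Lipschitz projection onto it gives a
   continuous, hence measurable, function on the plane, to which Tonelli's theorem applies after
   restriction. *)
pose clamp (c x : R) := Num.max (c - rho) (Num.min x (c + rho)).
have clampI c x : c - rho <= clamp c x <= c + rho.
  by rewrite /clamp le_max lexx/= ge_max ge_min lexx orbT andbT; lra.
have clampE c x : c - rho <= x <= c + rho -> clamp c x = x.
  by move=> /andP[h1 h2]; rewrite /clamp (min_idPl h2) (max_idPr h1).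
have clampL c x y : `|clamp c x - clamp c y| <= `|x - y|.
  have maxL (u v : R) : `|Num.max (c - rho) u - Num.max (c - rho) v| <= `|u - v|.
    have k1 := ler_norm (u - v); have k2 := ler_norm (v - u); rewrite (distrC v u) in k2.
    by rewrite ler_norml; have [h1|h1] := leP (c - rho) u; have [h2|h2] := leP (c - rho) v;
      apply/andP; split; lra.
  apply: le_trans (maxL _ _) _.
  have k1 := ler_norm (x - y); have k2 := ler_norm (y - x); rewrite (distrC y x) in k2.
  by rewrite ler_norml; have [h1|h1] := leP x (c + rho); have [h2|h2] := leP y (c + rho);
    apply/andP; split; lra.
pose g (p : R * R) := cnorm (H (Complex (clamp a p.1) (clamp b p.2))).
have mg : measurable_fun setT g.
  apply: measurable_fun_continuous2 => p e e0.
  have [d d0 dE] := cH _ _ (clampI a p.1) (clampI b p.2) e e0.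
  exists (d / 2); first by rewrite divr_gt0.
  move=> q q1 q2; apply: (@le_lt_trans _ _ (cnorm (H (Complex (clamp a q.1) (clamp b q.2)) -
      H (Complex (clamp a p.1) (clamp b p.2))))).
    rewrite ler_norml; apply/andP; split; last exact: cnorm_sub_ge.
    by rewrite lerNl opprB cdistC cnorm_sub_ge.
  apply: dE; rewrite (le_lt_trans (cnorm_le_ReIm _))// !ReD !ImD !ReN !ImN/=.
  have := le_lt_trans (clampL a q.1 p.1) q1; have := le_lt_trans (clampL b q.2 p.2) q2.
  lra.
pose f : R * R -> \bar R := (EFin \o g) \_ (square a b rho).
have f0 p : (0 <= f p)%E.
  by rewrite /f /patch; case: ifPn => // _; rewrite lee_fin cnorm_ge0.
have mf : measurable_fun setT f.
  apply/(measurable_restrictT _ _).1; first exact: measurable_square.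
  by apply: measurable_funTS; exact/measurable_EFinP.
have fM : (\int[(@lebesgue_measure R \x @lebesgue_measure R)%E]_p f p <= M%:E)%E.
  rewrite -integral_mkcond; apply: le_trans HM; rewrite le_eqVlt; apply/orP; left; apply/eqP.
  apply: eq_integral => -[x y]; rewrite inE /square/= !in_itv/= => -[hx hy].
  by rewrite /g/= !clampE.
have fE x y : a - rho <= x <= a + rho -> b - rho <= y <= b + rho -> f (x, y) = (cnorm (H (Complex x y)))%:E.
  move=> hx hy; rewrite /f /patch ifT; first by rewrite /g/= !clampE.
  by rewrite inE /square/= !in_itv.
(* Sides are sought in intervals of length [rho / 2], and k rho / 2 = 2 M exceeds the bound M on the
   double integral. *)
pose k := 4 * M / rho.
have k0 : 0 <= k by rewrite divr_ge0 ?mulr_ge0 ?(ltW M0) ?(ltW rho0).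
have kM : k * (rho / 2) = 2 * M by rewrite /k; field; rewrite gt_eqF.
have F1 : (\int[lebR]_x (\int[lebR]_y f (x, y)) <= M%:E)%E by rewrite -fubini_tonelli1.
have F2 : (\int[lebR]_y (\int[lebR]_x f (x, y)) <= M%:E)%E by rewrite -fubini_tonelli2.
have P1 x : (0 <= \int[lebR]_y f (x, y))%E by exact: integral_ge0.
have P2 y : (0 <= \int[lebR]_x f (x, y))%E by exact: integral_ge0.
have pickx := fun al be h => @exists_le_of_integral_le _ _ al be M k h P1 F1 k0.
have picky := fun al be h => @exists_le_of_integral_le _ _ al be M k h P2 F2 k0.
have [x1 hx1 kx1] : exists2 x, a - rho <= x <= a - rho / 2 & (\int[lebR]_y f (x, y) <= k%:E)%E.
  by apply: pickx; [lra|rewrite (_ : _ - _ = rho / 2) ?kM; [lra|field]].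
have [x2 hx2 kx2] : exists2 x, a + rho / 2 <= x <= a + rho & (\int[lebR]_y f (x, y) <= k%:E)%E.
  by apply: pickx; [lra|rewrite (_ : _ - _ = rho / 2) ?kM; [lra|field]].
have [y1 hy1 ky1] : exists2 y, b - rho <= y <= b - rho / 2 & (\int[lebR]_x f (x, y) <= k%:E)%E.
  by apply: picky; [lra|rewrite (_ : _ - _ = rho / 2) ?kM; [lra|field]].
have [y2 hy2 ky2] : exists2 y, b + rho / 2 <= y <= b + rho & (\int[lebR]_x f (x, y) <= k%:E)%E.
  by apply: picky; [lra|rewrite (_ : _ - _ = rho / 2) ?kM; [lra|field]].
have fineI (phi : R -> R) (psi : R -> \bar R) (al be c : R) : c - rho <= al -> be <= c + rho ->
    (forall t, 0 <= phi t) -> (forall t, 0 <= psi t)%E ->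
    (forall t, c - rho <= t <= c + rho -> psi t = (phi t)%:E) ->
    (\int[lebR]_t psi t <= k%:E)%E -> \int[lebR]_(t in `[al, be]) phi t <= k.
  move=> hal hbe phi0 psi0 psiE psik.
  have le : (\int[lebR]_(t in `[al, be]) (phi t)%:E <= k%:E)%E.
    apply: le_trans psik; apply: ge0_le_integral_sub => // t.
      by move=> _; rewrite lee_fin.
    rewrite /= in_itv/= => ht; rewrite psiE//; clear -ht hal hbe; lra.
  rewrite /Rintegral -lee_fin fineK// ge0_fin_numE.
    by apply: le_lt_trans le _; rewrite ltry.
  by apply: integral_ge0 => t _; rewrite lee_fin.
have rx1 : a - rho <= x1 <= a + rho by clear -hx1 rho0; lra.
have rx2 : a - rho <= x2 <= a + rho by clear -hx2 rho0; lra.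
have ry1 : b - rho <= y1 <= b + rho by clear -hy1 rho0; lra.
have ry2 : b - rho <= y2 <= b + rho by clear -hy2 rho0; lra.
have x12 : x1 <= x2 by clear -hx1 hx2 rho0; lra.
have y12 : y1 <= y2 by clear -hy1 hy2 rho0; lra.
have [ax1 ax2] : a - rho <= x1 /\ x2 <= a + rho by clear -rx1 rx2; lra.
have [by1 by2] : b - rho <= y1 /\ y2 <= b + rho by clear -ry1 ry2; lra.
have Iy x : a - rho <= x <= a + rho -> (\int[lebR]_y f (x, y) <= k%:E)%E ->
    \int[lebR]_(y in `[y1, y2]) cnorm (H (Complex x y)) <= k.
  move=> hx; exact: (fineI (fun y => cnorm (H (Complex x y))) (fun y => f (x, y)) y1 y2 b by1 by2
    (fun y => cnorm_ge0 _) (fun y => f0 _) (fun y => fE x y hx)).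
have Ix y : b - rho <= y <= b + rho -> (\int[lebR]_x f (x, y) <= k%:E)%E ->
    \int[lebR]_(x in `[x1, x2]) cnorm (H (Complex x y)) <= k.
  move=> hy; exact: (fineI (fun x => cnorm (H (Complex x y))) (fun x => f (x, y)) x1 x2 a ax1 ax2
    (fun x => cnorm_ge0 _) (fun x => f0 _) (fun x hx => fE x y hx hy)).
pose w : C := Complex a b.
have lew x y : rho / 2 <= `|x - a| \/ rho / 2 <= `|y - b| -> rho / 2 <= cnorm (Complex x y - w).
  move=> [h|h]; apply: le_trans h _.
    by have := normr_Re_le (Complex x y - w); rewrite ReD ReN.
  by have := normr_Im_le (Complex x y - w); rewrite ImD ImN.
have gew (al be c t : R) : al - rho <= c <= al - rho / 2 \/ al + rho / 2 <= c <= al + rho -> rho / 2 <= `|c - al|.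
  clear -rho0 => -[h|h]; [rewrite ler0_norm; lra|rewrite ger0_norm; lra].
have rho20 : 0 < rho / 2 by rewrite divr_gt0.
have nw x y : rho / 2 <= cnorm (Complex x y - w) -> Complex x y - w != 0.
  by move=> h; rewrite -cnorm_gt0; exact: lt_le_trans h.
have boundq x y : rho / 2 <= cnorm (Complex x y - w) ->
    cnorm (H (Complex x y) / (Complex x y - w)) <= 2 / rho * cnorm (H (Complex x y)).
  move=> h; rewrite cnorm_div mulrC ler_wpM2r ?cnorm_ge0//.
  have -> : 2 / rho = (rho / 2)^-1 by field; rewrite gt_eqF.
  by rewrite lef_pV2 ?posrE//; exact: lt_le_trans h.
have cq x y : a - rho <= x <= a + rho -> b - rho <= y <= b + rho -> rho / 2 <= cnorm (Complex x y - w) ->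
    ccts (fun z => H z / (z - w)) (Complex x y).
  move=> hx hy h; apply: cctsM; first exact: cH.
  apply: cctsV; first exact: nw.
  by apply: cctsB; [exact: ccts_id|exact: ccts_cst].
have rho2 : 0 <= 2 / rho by rewrite divr_ge0// ltW.
have side (al be : R) (path : R -> C) : pcts_on al be (fun t => H (path t) / (path t - w)) ->
    pcts_on al be (fun t => H (path t)) ->
    (forall t, al <= t <= be -> cnorm (H (path t) / (path t - w)) <= 2 / rho * cnorm (H (path t))) ->
    \int[lebR]_(t in `[al, be]) cnorm (H (path t)) <= k ->
    cnorm (cint al be (fun t => H (path t) / (path t - w))) <= 4 / rho * k.
  move=> c1 c2 le1 le2.
  have cn : rcts_on al be (fun t => cnorm (H (path t))).
    move=> t tab; apply/cvgrPdist_lt => e e0; apply: filterS (c2 t tab e e0) => s /=.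
    apply: le_lt_trans; rewrite distrC ler_norml; apply/andP; split; last exact: cnorm_sub_ge.
    by rewrite lerNl opprB cdistC cnorm_sub_ge.
  have cn2 : rcts_on al be (fun t => 2 / rho * cnorm (H (path t))).
    by move=> t tab; apply: cvgM; [exact: cvg_cst|exact: cn].
  apply: le_trans (cint_norm_le_Rintegral c1 cn2 le1) _.
  rewrite RintegralZl//; last exact: rcts_integrable.
  have -> : 4 / rho * k = 2 * (2 / rho * k) by ring.
  by rewrite ler_wpM2l// ler_wpM2l.
have sideH y : b - rho <= y <= b - rho / 2 \/ b + rho / 2 <= y <= b + rho ->
    b - rho <= y <= b + rho -> (\int[lebR]_x f (x, y) <= k%:E)%E ->
    pcts_on x1 x2 (fun x => H (Complex x y) / (Complex x y - w)) /\
    cnorm (cint x1 x2 (fun x => H (Complex x y) / (Complex x y - w))) <= 4 / rho * k.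
  move=> hy hy' hk.
  have hx x : x1 <= x <= x2 -> a - rho <= x <= a + rho by clear -ax1 ax2; lra.
  have far x : rho / 2 <= cnorm (Complex x y - w) by apply: lew; right; apply: gew.
  have cQ : pcts_on x1 x2 (fun x => H (Complex x y) / (Complex x y - w)).
    by apply: (@pcts_hor _ (fun z => H z / (z - w))) => x /hx ?; apply: cq.
  split=> //; apply: (side _ _ (fun x => Complex x y)) => //.
  - by apply: (@pcts_hor _ H) => x /hx ?; apply: cH.
  - by move=> x _; exact: boundq.
  - exact: Ix.
have sideV x : a - rho <= x <= a - rho / 2 \/ a + rho / 2 <= x <= a + rho ->
    a - rho <= x <= a + rho -> (\int[lebR]_y f (x, y) <= k%:E)%E ->
    pcts_on y1 y2 (fun y => H (Complex x y) / (Complex x y - w)) /\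
    cnorm (cint y1 y2 (fun y => H (Complex x y) / (Complex x y - w))) <= 4 / rho * k.
  move=> hx hx' hk.
  have hy y : y1 <= y <= y2 -> b - rho <= y <= b + rho by clear -by1 by2; lra.
  have far y : rho / 2 <= cnorm (Complex x y - w) by apply: lew; left; apply: gew.
  have cQ : pcts_on y1 y2 (fun y => H (Complex x y) / (Complex x y - w)).
    by apply: (@pcts_ver _ (fun z => H z / (z - w))) => y /hy ?; apply: cq.
  split=> //; apply: (side _ _ (fun y => Complex x y)) => //.
  - by apply: (@pcts_ver _ H) => y /hy ?; apply: cH.
  - by move=> y _; exact: boundq.
  - exact: Iy.
have [cy1 sy1] := sideH y1 (or_introl hy1) ry1 ky1.
have [cy2 sy2] := sideH y2 (or_intror hy2) ry2 ky2.
have [cx1 sx1] := sideV x1 (or_introl hx1) rx1 kx1.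
have [cx2 sx2] := sideV x2 (or_intror hx2) rx2 kx2.
have upper : cnorm (rect_int (fun z => H z / (z - w)) x1 x2 y1 y2) <= 64 * M / rho ^+ 2.
  (* One term per side: |z - w| >= rho / 2 gives a factor 2 / rho, and bounding real and imaginary
     parts separately doubles it. *)
  have -> : 64 * M / rho ^+ 2 = 4 / rho * k + 4 / rho * k + (4 / rho * k + 4 / rho * k).
    by rewrite /k; field; rewrite gt_eqF.
  rewrite /rect_int (le_trans (cnormD _ _))// cnormM cnorm_i mul1r.
  apply: lerD; apply: le_trans (cnormB _ _) _; apply: lerD; [exact: sy1|exact: sy2|exact: sx2|exact: sx1].
apply: le_trans upper.
have wr : a - rho <= a <= a + rho /\ b - rho <= b <= b + rho by clear -rho0; lra.
(* The difference quotient [Q] of [H] at [w] has zero contour integral, so that of H / (z - w) is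
   [H w] times the winding integral, whose modulus is at least 1. *)
have [l /is_cderiv_factor[Q Qc [Ql QE]]] := dH a b wr.1 wr.2.
have dQ x y : x1 <= x <= x2 -> y1 <= y <= y2 -> Complex x y != Complex a b ->
    exists l, is_cderiv Q (Complex x y) l.
  move=> hx hy neq; have [l' dl'] : exists l, is_cderiv H (Complex x y) l.
    by apply: dH; [clear -hx ax1 ax2; lra|clear -hy by1 by2; lra].
  eexists; apply: (@is_cderiv_near _ (fun z => (H z - H w) * (z - w)^-1)).
    exists (cnorm (Complex x y - w)); first by rewrite cnorm_gt0 subr_eq0.
    move=> u uz /=; have uw : u - w != 0.
      by rewrite subr_eq0; apply: contraTneq uz => ->; rewrite cdistC ltxx.
    by rewrite QE mulfK.
  apply: is_cderivM; first by apply: is_cderivB; [exact: dl'|exact: is_cderiv_cst].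
  apply: is_cderivV; first by rewrite subr_eq0.
  by apply: is_cderivB; [exact: is_cderiv_id|exact: is_cderiv_cst].
have cQ x y : x1 <= x <= x2 -> y1 <= y <= y2 -> ccts Q (Complex x y).
  move=> hx hy; have [->|neq] := eqVneq (Complex x y) (Complex a b).
    by rewrite /ccts Ql.
  by have [? /is_cderiv_ccts] := dQ x y hx hy neq.
have Q0 : rect_int Q x1 x2 y1 y2 = 0.
  apply: (@goursat_punctured _ Q _ _ _ _ a b) => //.
  - by clear -hx1 hx2 rho0; lra.
  - by clear -hy1 hy2 rho0; lra.
have lin (al be : R) (path : R -> C) : (forall t, al <= t <= be -> rho / 2 <= cnorm (path t - w)) ->
    pcts_on al be path -> pcts_on al be (fun t => Q (path t)) ->
    cint al be (fun t => H (path t) / (path t - w)) =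
    cint al be (fun t => Q (path t)) + H w * cint al be (fun t => (path t - w)^-1).
  move=> far cp cQp.
  have neq t : al <= t <= be -> path t - w != 0.
    by move=> /far h; rewrite -cnorm_gt0; exact: lt_le_trans h.
  have ci : pcts_on al be (fun t => (path t - w)^-1).
    move=> t ht; apply: climV; first exact: neq.
    by apply: climB; [exact: cp|exact: clim_cst].
  rewrite -cintZ// -cintD//; last by apply: pcts_onM => //; exact: pcts_on_cst.
  apply: eq_cint => t /neq h; rewrite (_ : Q _ = (H (path t) - H w) / (path t - w)).
    by field.
  by rewrite QE mulfK.
have key : rect_int (fun z => H z / (z - w)) x1 x2 y1 y2 =
    H w * rect_int (fun z => (z - w)^-1) x1 x2 y1 y2.
  have linH y : b - rho <= y <= b - rho / 2 \/ b + rho / 2 <= y <= b + rho -> y1 <= y <= y2 ->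
      cint x1 x2 (fun x => H (Complex x y) / (Complex x y - w)) =
      cint x1 x2 (fun x => Q (Complex x y)) + H w * cint x1 x2 (fun x => (Complex x y - w)^-1).
    move=> hy hy'; apply: (lin _ _ (fun x => Complex x y)).
    - by move=> t _; apply: lew; right; apply: gew.
    - by move=> t _; exact: clim_hor.
    - by apply: pcts_hor => x hx; exact: cQ.
  have linV x : a - rho <= x <= a - rho / 2 \/ a + rho / 2 <= x <= a + rho -> x1 <= x <= x2 ->
      cint y1 y2 (fun y => H (Complex x y) / (Complex x y - w)) =
      cint y1 y2 (fun y => Q (Complex x y)) + H w * cint y1 y2 (fun y => (Complex x y - w)^-1).
    move=> hx hx'; apply: (lin _ _ (fun y => Complex x y)).
    - by move=> t _; apply: lew; left; apply: gew.
    - by move=> t _; exact: clim_ver.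
    - by apply: pcts_ver => y hy; exact: cQ.
  transitivity (rect_int Q x1 x2 y1 y2 + H w * rect_int (fun z => (z - w)^-1) x1 x2 y1 y2).
    rewrite /rect_int (linH y1 (or_introl hy1)) ?lexx// (linH y2 (or_intror hy2)) ?lexx ?andbT//.
    by rewrite (linV x1 (or_introl hx1)) ?lexx// (linV x2 (or_intror hx2)) ?lexx ?andbT//; ring.
  by rewrite Q0 add0r.
rewrite key cnormM -[leLHS]mulr1 ler_wpM2l ?cnorm_ge0//.
exact: rect_int_winding rho0 hx1 hx2 hy1 hy2.
Qed.

End area_bound.

(** * Integrating derivative bounds along radii *)

Section growth.
Context {R : realType}.
Local Notation C := R[i].

Lemma is_derive_of_remainder (f : R -> R) (a l : R) :
  (forall e : R, 0 < e -> exists2 d : R, 0 < d &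
    forall h : R, `|h| < d -> `|f (a + h) - f a - l * h| <= e * `|h|) -> is_derive a 1 f l.
Proof.
move=> H; have cv : h^-1 *: ((f \o shift a) (h *: 1) - f a) @[h --> 0^'] --> l.
  apply/cvgrPdist_le => e e0; have [d d0 dE] := H e e0; exists d => // h /=.
  rewrite sub0r normrN => hd h0; rewrite /GRing.scale/= mulr1 (addrC h).
  have -> : l - h^-1 * (f (a + h) - f a) = - (f (a + h) - f a - l * h) / h by field.
  by rewrite normrM normrN normfV ler_pdivrMr ?normr_gt0// dE.
by apply: DeriveDef; [apply/cvg_ex; exists l|exact: cvg_lim cv].
Qed.

Lemma is_derive_Re_segment (g : C -> C) (c w l : C) (t : R) : is_cderiv g (t%:C%C * w) l ->
  is_derive t 1 (fun s => Re (c * g (s%:C%C * w))) (Re (c * (l * w))).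
Proof.
move=> dg; apply: is_derive_of_remainder => e e0.
have N1 : 0 < cnorm c * cnorm w + 1 by rewrite ltr_wpDl// mulr_ge0 ?cnorm_ge0.
have [d d0 dE] := dg _ (divr_gt0 e0 N1).
have W1 : 0 < cnorm w + 1 by rewrite ltr_wpDl// cnorm_ge0.
exists (d / (cnorm w + 1)); first by rewrite divr_gt0.
move=> h hd; set z := t%:C%C * w in dE *.
have -> : Re (c * g ((t + h)%:C%C * w)) - Re (c * g z) - Re (c * (l * w)) * h =
   Re (c * (g (z + h%:C%C * w) - g z - l * (h%:C%C * w))).
  rewrite [_ * h]mulrC -ReZ -ReN -ReD -ReN -ReD; congr Re.
  by rewrite /z -mulrDl -rmorphD/=; ring.
apply: le_trans (normr_Re_le _) _; rewrite cnormM.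
have [->|u0] := eqVneq (h%:C%C * w) 0.
  by rewrite addr0 mulr0 !subrr cnorm0 mulr0 mulr_ge0// ltW.
have un : cnorm (h%:C%C * w) = `|h| * cnorm w by rewrite cnormM cnorm_real.
have ud : cnorm (h%:C%C * w) < d.
  rewrite un; apply: le_lt_trans (_ : `|h| * (cnorm w + 1) < _).
    by rewrite ler_wpM2l// lerDl.
  by rewrite -ltr_pdivlMr.
have /ltW := dE _ u0 ud.
set u := h%:C%C * w in u0 un ud *.
move=> hle; have -> : g (z + u) - g z - l * u = ((g (z + u) - g z) / u - l) * u by field.
rewrite cnormM; apply: le_trans (ler_wpM2l (cnorm_ge0 c) (ler_wpM2r (cnorm_ge0 u) hle)) _.
rewrite un; have -> : cnorm c * (e / (cnorm c * cnorm w + 1) * (`|h| * cnorm w)) =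
   (e * `|h|) * (cnorm c * cnorm w / (cnorm c * cnorm w + 1)) by ring.
by rewrite ler_piMr ?mulr_ge0// ?(ltW e0)// ler_pdivrMr// mul1r lerDl.
Qed.

(** The constant [c] rotates [g w - g 0] onto its modulus, which reduces the claim to the real mean
    value theorem for [phi t - Re (c * g (t w))]. *)
Lemma segment_compare (g g1 : C -> C) (w : C) (phi dphi : R -> R) : disc w ->
  (forall z, disc z -> is_cderiv g z (g1 z)) ->
  (forall t : R, 0 <= t <= 1 -> is_derive t 1 phi (dphi t)) ->
  (forall t : R, 0 <= t <= 1 -> cnorm (g1 (t%:C%C * w)) * cnorm w <= dphi t) ->
  cnorm (g w - g 0) <= phi 1 - phi 0.
Proof.
rewrite /disc/= => wd dg dph hle; pose D := g w - g 0.
pose c := cconj D / (cnorm D)%:C%C.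
have cD : c * D = (cnorm D)%:C%C.
  rewrite /c mulrAC [cconj D * D]mulrC mulcconj -fmorphV -rmorphM/=; congr (_%:C%C).
  have [->|N0] := eqVneq (cnorm D) 0; first by rewrite expr0n mul0r.
  by rewrite expr2 mulfK.
have c1 : cnorm c <= 1.
  rewrite /c cnorm_div cnorm_conj cnorm_real ger0_norm ?cnorm_ge0//.
  have [->|N0] := eqVneq (cnorm D) 0; first by rewrite mul0r.
  by rewrite divff.
have tw (t : R) : 0 <= t <= 1 -> disc (t%:C%C * w).
  move=> /andP[t0 t1]; rewrite /disc/= cnormM cnorm_real ger0_norm//.
  by apply: le_lt_trans wd; rewrite ler_piMl// cnorm_ge0.
pose psi (t : R) := phi t - Re (c * g (t%:C%C * w)).
have dpsi (t : R) : 0 <= t <= 1 -> is_derive t 1 psi (dphi t - Re (c * (g1 (t%:C%C * w) * w))).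
  move=> ht; apply: is_deriveB; [exact: dph|].
  exact: is_derive_Re_segment (dg _ (tw t ht)).
have [||x x01 E] := @MVT _ psi (fun t => dphi t - Re (c * (g1 (t%:C%C * w) * w))) 0 1 ltr01.
- by move=> x; rewrite in_itv/= => /andP[x0 x1]; apply: dpsi; rewrite !ltW.
- apply: derivable_within_continuous => x; rewrite in_itv/= => hx.
  by have [] := dpsi x hx.
have {}x01 : 0 <= x <= 1 by move: x01; rewrite in_itv/= => /andP[? ?]; rewrite !ltW.
have : 0 <= psi 1 - psi 0.
  rewrite E subr0 mulr1 subr_ge0 (le_trans (Re_le_cnorm _))// cnormM cnormM.
  by apply: le_trans (hle x x01); rewrite ler_piMl// mulr_ge0 ?cnorm_ge0.
rewrite /psi mul1r mul0r.
have -> : phi 1 - Re (c * g w) - (phi 0 - Re (c * g 0)) =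
  phi 1 - phi 0 - (Re (c * g w) - Re (c * g 0)) by ring.
by rewrite -ReN -ReD -mulrBr -/D cD Re_real subr_ge0.
Qed.

(** The majorant is M (1 - t |w|)^-i / i, a primitive in [t] of M |w| (1 - t |w|)^-(i+1); the value
    [g 0] is absorbed because (1 - |w|)^-i >= 1. *)
Lemma growth_power (g g1 : C -> C) (M : R) (i : nat) : (0 < i)%N -> 0 <= M ->
  (forall z, disc z -> is_cderiv g z (g1 z)) ->
  (forall z, disc z -> cnorm (g1 z) <= M * (1 - cnorm z)^-1 ^+ i.+1) ->
  forall z, disc z -> cnorm (g z) <= (M + cnorm (g 0)) * (1 - cnorm z)^-1 ^+ i.
Proof.
move=> i0 M0 dg hg w wd; have w1 : cnorm w < 1 := wd.
pose v (t : R) := (1 - t * cnorm w)^-1.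
have vp (t : R) : 0 <= t <= 1 -> 0 < 1 - t * cnorm w.
  move=> /andP[t0 t1]; rewrite subr_gt0; apply: le_lt_trans w1.
  by rewrite ler_piMl// cnorm_ge0.
have dv (t : R) : 0 <= t <= 1 -> is_derive t 1 v (cnorm w * v t ^+ 2).
  move=> /vp ht; have d1 : is_derive t 1 (fun t : R => 1 - t * cnorm w) (- cnorm w).
    apply: is_derive_of_remainder => e e0; exists 1 => // h _.
    rewrite (_ : _ - _ = 0); last by ring.
    by rewrite normr0 mulr_ge0// ltW.
  have := @is_deriveV _ (fun t : R => 1 - t * cnorm w) _ _ _ (lt0r_neq0 ht) d1.
  by rewrite /GRing.scale/= mulrNN mulrC exprVn.
pose phi (t : R) := M / i%:R * v t ^+ i.
have dphi (t : R) : 0 <= t <= 1 -> is_derive t 1 phi (M * cnorm w * v t ^+ i.+1).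
  move=> /dv h; have := is_deriveZ (M / i%:R) (is_deriveX i h).
  rewrite /GRing.scale/= => H; move: H.
  have -> : M / i%:R * (i%:R * v t ^+ i.-1 * (cnorm w * v t ^+ 2)) = M * cnorm w * v t ^+ i.+1.
    have -> : v t ^+ i.+1 = v t ^+ i.-1 * v t ^+ 2 by rewrite -exprD addn2 prednK.
    by field; rewrite pnatr_eq0 -lt0n.
  by rewrite exprfctE.
have := @segment_compare g g1 w phi _ wd dg dphi.
have -> : (forall t : R, 0 <= t <= 1 -> cnorm (g1 (t%:C%C * w)) * cnorm w <= M * cnorm w * v t ^+ i.+1) = True.
  apply/propext; split=> // _ t ht; rewrite mulrAC ler_wpM2r ?cnorm_ge0//.
  have := hg (t%:C%C * w); rewrite /disc/= cnormM cnorm_real ger0_norm; last by case/andP: ht.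
  by apply; rewrite -subr_gt0 vp.
move=> /(_ I) h.
have i1 : 1 <= i%:R :> R by rewrite ler1n.
have vw : 1 <= v 1.
  by rewrite /v mul1r -[leLHS]invr1 lef_pV2 ?posrE// ?subr_gt0// gerBl cnorm_ge0.
have vi : 1 <= v 1 ^+ i by exact: exprn_ege1.
have ph0 : 0 <= phi 0.
  by rewrite /phi /v mul0r subr0 invr1 expr1n mulr1 divr_ge0.
have ph1 : phi 1 <= M * v 1 ^+ i.
  rewrite /phi ler_wpM2r ?(le_trans ler01 vi)//.
  by rewrite ler_pdivrMr ?(lt_le_trans ltr01 i1)// ler_peMr.
have : cnorm (g w) <= phi 1 - phi 0 + cnorm (g 0).
  by rewrite -lerBlDr; apply: le_trans (cnorm_sub_ge _ _) h.
have -> : (1 - cnorm w)^-1 = v 1 by rewrite /v mul1r.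
have : cnorm (g 0) <= cnorm (g 0) * v 1 ^+ i by rewrite ler_peMr ?cnorm_ge0.
rewrite mulrDl; lra.
Qed.

(** Here the primitive is a logarithm, weakened to a fourth root so that the result can be compared
    algebraically with kernel norms. *)
Lemma growth_log (g g1 : C -> C) (M : R) : 0 <= M ->
  (forall z, disc z -> is_cderiv g z (g1 z)) ->
  (forall z, disc z -> cnorm (g1 z) <= M * (1 - cnorm z)^-1) ->
  forall z, disc z ->
    cnorm (g z) <= (4 * M + cnorm (g 0)) * Num.sqrt (Num.sqrt (1 - cnorm z)^-1).
Proof.
move=> M0 dg hg w wd; have w1 : cnorm w < 1 := wd.
have vp (t : R) : 0 <= t <= 1 -> 0 < 1 - t * cnorm w.
  move=> /andP[t0 t1]; rewrite subr_gt0; apply: le_lt_trans w1.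
  by rewrite ler_piMl// cnorm_ge0.
pose phi (t : R) := - M * ln (1 - t * cnorm w).
have dphi (t : R) : 0 <= t <= 1 -> is_derive t 1 phi (M * cnorm w * (1 - t * cnorm w)^-1).
  move=> /vp ht; have d1 : is_derive t 1 (fun t : R => 1 - t * cnorm w) (- cnorm w).
    apply: is_derive_of_remainder => e e0; exists 1 => // h _.
    rewrite (_ : _ - _ = 0); last by ring.
    by rewrite normr0 mulr_ge0// ltW.
  have := is_deriveZ (- M) (@is_derive1_comp _ _ (fun t : R => 1 - t * cnorm w) _ _ _ (is_derive1_ln ht) d1).
  rewrite /GRing.scale/= => H; move: H.
  have -> : - M * ((1 - t * cnorm w)^-1 * - cnorm w) = M * cnorm w * (1 - t * cnorm w)^-1 by ring.
  by [].
have := @segment_compare g g1 w phi _ wd dg dphi.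
have -> : (forall t : R, 0 <= t <= 1 -> cnorm (g1 (t%:C%C * w)) * cnorm w <= M * cnorm w * (1 - t * cnorm w)^-1) = True.
  apply/propext; split=> // _ t ht; rewrite mulrAC ler_wpM2r ?cnorm_ge0//.
  have := hg (t%:C%C * w); rewrite /disc/= cnormM cnorm_real ger0_norm; last by case/andP: ht.
  by apply; rewrite -subr_gt0 vp.
move=> /(_ I) h.
pose d : R := 1 - cnorm w; have d0 : 0 < d by rewrite subr_gt0.
have d1 : d <= 1 by rewrite gerBl cnorm_ge0.
pose q : R := Num.sqrt (Num.sqrt d^-1).
have q0 : 0 < q by rewrite !sqrtr_gt0 invr_gt0.
have q4 : q ^+ 4 = d^-1.
  by rewrite -[4%N]/(2 * 2)%N exprM !sqr_sqrtr ?sqrtr_ge0// invr_ge0 ltW.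
have q1 : 1 <= q.
  rewrite leNgt; apply/negP => qlt; have : q ^+ 4 < 1 by rewrite exprn_ilt1// ltW.
  by rewrite q4 ltNge -[leLHS]invr1 lef_pV2 ?posrE// d1.
(* Since [q ^+ 4 = d^-1], this is ln (1 / d) = 4 ln q together with ln q <= q - 1. *)
have lnd : - ln d <= 4 * (q - 1).
  have -> : - ln d = 4 * ln q by rewrite -lnV ?posrE// -q4 lnXn// mulr_natl.
  rewrite ler_wpM2l//; have -> : ln q = ln (1 + (q - 1)) by congr ln; ring.
  by apply: le_ln1Dx; lra.
have ph : phi 1 - phi 0 <= 4 * M * (q - 1).
  rewrite /phi mul1r mul0r subr0 ln1 mulr0 subr0 -/d.
  have := ler_wpM2l M0 lnd; lra.
have : cnorm (g w) <= phi 1 - phi 0 + cnorm (g 0).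
  by rewrite -lerBlDr; apply: le_trans (cnorm_sub_ge _ _) h.
have : cnorm (g 0) <= cnorm (g 0) * q by rewrite ler_peMr ?cnorm_ge0.
rewrite -/d -/q mulrDl; lra.
Qed.

End growth.

(** * From a finite Dirichlet integral to pointwise growth *)

Section dirichlet_growth.
Context {R : realType}.
Local Notation C := R[i].
Implicit Types m : finite_measure_R2 R.

Lemma measurable_circle : measurable (@circle R).
Proof.
have mf : measurable_fun [set: R * R] (fun p : R * R => p.1 ^+ 2 + p.2 ^+ 2).
  by apply: measurable_funD; apply: measurable_funX; [exact: measurable_fst|exact: measurable_snd].
have := mf measurableT [set 1] (measurable_set1 1); rewrite setTI.
by congr measurable.
Qed.

Lemma circle_measure_gt0 m : on_circle m -> ~ zero_measure m -> (0 < m circle)%E.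
Proof.
move=> mc mn0; rewrite lt0e measure_ge0 andbT; apply/negP => /eqP m0; apply: mn0 => A mA.
apply/eqP; rewrite eq_le measure_ge0 andbT.
apply: le_trans (_ : m (circle `|` ~` circle) <= _)%E.
  apply: le_measure; rewrite ?inE//.
    by apply: measurableU; [exact: measurable_circle|apply: measurableC; exact: measurable_circle].
  by rewrite setUv.
apply: le_trans (measureU2 _ _ _) _; [exact: measurable_circle|apply: measurableC; exact: measurable_circle|].
have m0' : (m circle <= 0)%E by rewrite m0.
have mc' : (m (~` circle) <= 0)%E by rewrite mc.
by apply: le_trans (leeD m0' mc') _; rewrite adde0.
Qed.

Lemma cnorm_to_C_circle (p : R * R) : circle p -> cnorm (to_C p) = 1.
Proof. by rewrite /circle/= /cnorm/= => ->; rewrite sqrtr1. Qed.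

Lemma Poisson_ge0 m z : disc z -> (0 <= Poisson m z)%E.
Proof.
move=> zd; apply: integral_ge0 => p _; rewrite lee_fin divr_ge0 ?sqr_ge0// subr_ge0.
by rewrite exprn_ile1 ?cnorm_ge0// ltW.
Qed.

(** Two points of the closed disc are at distance at most 2, whence the constant [m circle / 4]. *)
Lemma Poisson_lower m : on_circle m -> ~ zero_measure m ->
  exists2 c : R, 0 < c & forall z, disc z -> (((1 - cnorm z ^+ 2) * c)%:E <= Poisson m z)%E.
Proof.
move=> mc mn0; have mp := circle_measure_gt0 mc mn0.
have mf : m circle \is a fin_num by apply: fin_num_measure; exact: measurable_circle.
exists (fine (m circle) / 4).
  by rewrite divr_gt0// fine_gt0// mp ltey_eq mf.
move=> z zd; have z1 : cnorm z < 1 := zd.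
have n0 : 0 <= 1 - cnorm z ^+ 2 by rewrite subr_ge0 exprn_ile1 ?cnorm_ge0// ltW.
have -> : ((1 - cnorm z ^+ 2) * (fine (m circle) / 4))%:E =
    (\int[m]_(p in circle) ((1 - cnorm z ^+ 2) / 4)%:E)%E.
  rewrite integral_cst; last exact: measurable_circle.
  transitivity (((1 - cnorm z ^+ 2) / 4)%:E * (fine (m circle))%:E)%E.
    by rewrite -EFinM; congr EFin; ring.
  by congr (_ * _)%E; exact: fineK.
apply: ge0_le_integral_sub => // p pc; rewrite lee_fin.
- by rewrite divr_ge0.
- by rewrite divr_ge0 ?sqr_ge0.
have p1 := cnorm_to_C_circle pc.
have d0 : 0 < cnorm (z - to_C p).
  by have := cnorm_sub_ge (to_C p) z; rewrite cdistC p1; apply: lt_le_trans; rewrite subr_gt0.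
rewrite ler_wpM2l// lef_pV2 ?posrE ?exprn_gt0//.
have -> : 4 = 2 ^+ 2 :> R by ring.
rewrite lerXn2r ?nnegrE ?cnorm_ge0// (le_trans (cnormB _ _))// p1.
by move: z1 => /ltW; lra.
Qed.

Lemma growth_top m j f : (2 <= j)%N -> on_circle m -> ~ zero_measure m ->
  holomorphic_on_disc f -> (Dmu m j f < +oo)%E ->
  exists2 K : R, 0 <= K & forall w, disc w -> cnorm (cderivn j f w) <= K * (1 - cnorm w)^-1 ^+ j.
Proof.
move=> j2 mc mn0 hf Df; have [c c0 cP] := Poisson_lower mc mn0.
set F := cderivn j f.
pose k0 : R := (j`!)%:R * ((j - 1)`!)%:R * pi.
have k00 : 0 < k0 by rewrite !mulr_gt0 ?pi_gt0// ltr0n fact_gt0.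
pose g (p : R * R) : \bar R := ((cnorm (F (to_C p)) ^+ 2
        * (1 - cnorm (to_C p) ^+ 2) ^+ (j - 1) / k0)%:E * Poisson m (to_C p))%E.
have discR_disc p : discR p -> disc (to_C p : C).
  by rewrite /discR /disc/= /cnorm/= => h; rewrite -sqrtr1 ltr_sqrt.
have disc_discR p : disc (to_C p : C) -> discR p.
  rewrite /discR /disc/= => h; rewrite -[X in X < _](cnorm_sqr (to_C p)).
  by rewrite exprn_ilt1// cnorm_ge0.
have n0 z : disc z -> 0 <= 1 - cnorm z ^+ 2.
  by move=> zd; rewrite subr_ge0 exprn_ile1 ?cnorm_ge0// ltW.
have g0 p : discR p -> (0 <= g p)%E.
  move=> /discR_disc pd; apply: mule_ge0; last exact: Poisson_ge0.
  by rewrite lee_fin divr_ge0 ?(ltW k00)// mulr_ge0 ?sqr_ge0// exprn_ge0// n0.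
have Dge0 : (0 <= Dmu m j f)%E by exact: integral_ge0.
have Dfin : Dmu m j f \is a fin_num by rewrite ge0_fin_numE.
pose D := fine (Dmu m j f); have DE : Dmu m j f = D%:E by rewrite fineK.
have D0 : 0 <= D by exact: fine_ge0.
pose K2 := 64 * (D + 1) * 16 * k0 * 2 ^+ j / c.
have K20 : 0 <= K2.
  rewrite /K2; apply: divr_ge0; last exact: ltW.
  apply: mulr_ge0; last exact: exprn_ge0.
  apply: mulr_ge0; last exact: ltW.
  apply: mulr_ge0 => //; apply: mulr_ge0 => //; exact: addr_ge0.
exists (Num.sqrt K2); first exact: sqrtr_ge0.
move=> w wd; have w1 : cnorm w < 1 := wd; have w0 := cnorm_ge0 w.
pose d : R := 1 - cnorm w; have d0 : 0 < d by rewrite subr_gt0.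
have d1 : d <= 1 by rewrite gerBl.
(* A point of the square is at distance at most 2 rho = d / 2 from [w], so the square stays in the
   disc of radius 1 - d / 2. *)
pose rho : R := d / 4; have rho0 : 0 < rho by rewrite divr_gt0.
(* A lower bound on the square for the whole weight of [Dmu]: its power [j - 1] of 1 - |z|^2 gains
   one more factor from [Poisson_lower]. *)
pose kap : R := (d / 2) ^+ j * c / k0.
have kap0 : 0 < kap by rewrite divr_gt0// mulr_gt0// exprn_gt0// divr_gt0.
case: w => a b in wd w1 w0 d d0 d1 rho rho0 kap kap0 *.
have inQ x y : a - rho <= x <= a + rho -> b - rho <= y <= b + rho -> cnorm (Complex x y) <= 1 - d / 2.
  move=> hx hy; have := cnorm_sub_ge (Complex x y) (Complex a b).
  have h1 : `|x - a| <= rho by rewrite ler_norml; apply/andP; split; lra.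
  have h2 : `|y - b| <= rho by rewrite ler_norml; apply/andP; split; lra.
  have := cnorm_le_ReIm (Complex x y - Complex a b); rewrite ReD ImD ReN ImN/=.
  by move: h1 h2; rewrite /rho /d; lra.
have inQd x y : a - rho <= x <= a + rho -> b - rho <= y <= b + rho -> disc (Complex x y : C).
  by move=> hx hy; rewrite /disc/= (le_lt_trans (inQ x y hx hy))//; clear -d0; lra.
have hF := holomorphic_cderivn j hf.
(* The square of [F] is holomorphic, so the area estimate for moduli of holomorphic functions bounds
   |F|^2 itself. *)
pose H (z : C) := kap%:C%C * (F z * F z).
have HN z : cnorm (H z) = kap * cnorm (F z) ^+ 2.
  by rewrite /H !cnormM cnorm_real gtr0_norm.
have dH x y : a - rho <= x <= a + rho -> b - rho <= y <= b + rho -> exists l, is_cderiv H (Complex x y) l.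
  move=> hx hy; have [l dl] := hF _ (inQd x y hx hy).
  by eexists; apply: is_cderivZ; exact: (is_cderivM dl dl).
have := @area_bound _ H a b rho (D + 1) rho0 _ dH; rewrite HN => h.
have {h} : kap * cnorm (F (Complex a b)) ^+ 2 <= 64 * (D + 1) / rho ^+ 2.
  apply: h; first by rewrite ltr_wpDl.
  apply: le_trans (_ : Dmu m j f <= _)%E; last by rewrite DE lee_fin lerDl.
  apply: ge0_le_integral_sub.
  - by move=> [x y] [/=]; rewrite !in_itv/= => hx hy; apply: disc_discR; exact: inQd.
  - by move=> p _; rewrite lee_fin cnorm_ge0.
  - exact: g0.
  - move=> [x y] [/=]; rewrite !in_itv/= => hx hy.
    have zd := inQd x y hx hy; have zn := inQ x y hx hy.
    apply: le_trans (_ : ((cnorm (F (Complex x y)) ^+ 2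
        * (1 - cnorm (Complex x y) ^+ 2) ^+ (j - 1) / k0)%:E *
        ((1 - cnorm (Complex x y) ^+ 2) * c)%:E) <= _)%E; last first.
      apply: lee_wpmul2l; last exact: cP.
      by rewrite lee_fin divr_ge0 ?(ltW k00)// mulr_ge0 ?sqr_ge0// exprn_ge0// n0.
    rewrite -EFinM lee_fin HN.
    set N := cnorm (F _) ^+ 2; set q := 1 - cnorm (Complex x y) ^+ 2.
    have -> : N * q ^+ (j - 1) / k0 * (q * c) = q ^+ j * c / k0 * N.
      have -> : q ^+ j = q ^+ (j - 1) * q by rewrite -exprSr subn1 prednK// ltnW.
      by ring.
    rewrite ler_wpM2r ?sqr_ge0// ler_wpM2r ?invr_ge0 ?(ltW k00)// ler_wpM2r ?(ltW c0)//.
    have dq : d / 2 <= q.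
      rewrite /q; have : cnorm (Complex x y) ^+ 2 <= cnorm (Complex x y).
        by rewrite expr2 ler_piMr ?cnorm_ge0// ltW.
      by clear -zn; lra.
    have d20 : 0 <= d / 2 by rewrite divr_ge0// ltW.
    by rewrite lerXn2r ?nnegrE// (le_trans d20).
move=> h; rewrite -/d -(@ler_pXn2r _ 2)// ?nnegrE ?cnorm_ge0//; last first.
  by rewrite mulr_ge0 ?sqrtr_ge0// exprn_ge0// invr_ge0 ltW.
rewrite exprMn (sqr_sqrtr K20).
have : cnorm (F (Complex a b)) ^+ 2 <= K2 * d^-1 ^+ (j + 2).
  move: h; rewrite mulrC -ler_pdivlMr// => h; apply: le_trans h _.
  rewrite le_eqVlt; apply/orP; left; apply/eqP.
  have dj0 : d ^+ j != 0 by rewrite expf_neq0// gt_eqF.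
  have tj0 : (2 : R) ^+ j != 0 by rewrite expf_neq0.
  rewrite /K2 /kap /rho exprD exprVn (expr_div_n d 2 j).
  move: (d ^+ j) (2 ^+ j) dj0 tj0 => u t u0 t0; field.
  by rewrite u0 t0 !gt_eqF.
move=> h2; apply: le_trans h2 _; rewrite ler_wpM2l// -exprM.
(* The estimate obtained is |F|^2 <= K2 d^-(j+2); the comparison with d^(-2j) is where [j >= 2] is
   needed. *)
have -> : (j * 2 = (j + 2) + (j - 2))%N by clear -j2; lia.
rewrite [leRHS]exprD ler_peMr ?exprn_ge0 ?invr_ge0 ?(ltW d0)// exprn_ege1//.
by rewrite -[leLHS]invr1 lef_pV2 ?posrE.
Qed.

(** Each integration lowers both the order of the derivative and the exponent by one; the last one,
    from exponent 1, produces the logarithm. *)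
Lemma dirichlet_growth m j f : (2 <= j)%N -> on_circle m -> ~ zero_measure m ->
  holomorphic_on_disc f -> (Dmu m j f < +oo)%E ->
  exists2 K : R, 0 <= K & forall w, disc w ->
    cnorm (f w) <= K * Num.sqrt (Num.sqrt (1 - cnorm w)^-1).
Proof.
move=> j2 mc mn0 hf Df; have [K K0 hK] := growth_top j2 mc mn0 hf Df.
have down i : (i < j)%N -> exists2 K' : R, 0 <= K' & forall w, disc w ->
    cnorm (cderivn (j - i) f w) <= K' * (1 - cnorm w)^-1 ^+ (j - i).
  elim: i => [|i ih] ij; first by exists K => //; rewrite subn0.
  have [K' K'0 h] := ih (ltnW ij).
  exists (K' + cnorm (cderivn (j - i.+1) f 0)); first by rewrite addr_ge0 ?cnorm_ge0.
  have ji : (j - i = (j - i.+1).+1)%N by rewrite subnS prednK// subn_gt0 ltnW.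
  apply: (@growth_power _ _ (cderivn (j - i) f)) => //.
  - by rewrite subn_gt0.
  - by move=> z zd; rewrite ji; exact: is_cderiv_cderivn.
  - by move=> z zd; rewrite -ji; exact: h.
have [|K1 K10 h1] := down j.-1; first by rewrite prednK// ltnW.
have j1 : (j - j.-1 = 1)%N by clear -j2; lia.
rewrite j1 in h1.
exists (4 * K1 + cnorm (f 0)); first by rewrite addr_ge0 ?mulr_ge0 ?cnorm_ge0.
apply: (@growth_log _ f (cderivn 1 f)) => //.
- by move=> z zd; exact: (@is_cderiv_cderivn _ 0).
Qed.

End dirichlet_growth.

(** * The boundary modulus of b *)

Section gliding_hump.
Context {R : realType}.
Local Notation C := R[i].
Implicit Types s t : seq (C * C).

(** Completeness with an explicit rate: the hump argument must know how far its limit function is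
    from a partial sum at a given point. *)
Lemma real_cauchy_limit (u eps : nat -> R) :
  (forall k m, `|u (k + m)%N - u k| <= eps k) -> exists l, forall k, `|u k - l| <= eps k.
Proof.
move=> H; have cross j k : u k - eps k <= u j + eps j.
  have [kj|/ltnW jk] := leqP k j.
    have := H k (j - k)%N; rewrite subnKC// ler_norml => /andP[h _].
    have := H j 0%N; rewrite addn0 subrr normr0; lra.
  have := H j (k - j)%N; rewrite subnKC// ler_norml => /andP[_ h].
  have := H k 0%N; rewrite addn0 subrr normr0; lra.
pose E := range (fun k => u k - eps k); exists (sup E) => k.
have lo : u k - eps k <= sup E.
  apply: sup_upper_bound; last by exists k.
  split; first by exists (u 0%N - eps 0%N), 0%N.
  by exists (u 0%N + eps 0%N) => _ [j _ <-]; exact: cross.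
have hi : sup E <= u k + eps k.
  apply: ge_sup; first by exists (u 0%N - eps 0%N), 0%N.
  by move=> _ [j _ <-]; exact: cross.
by rewrite ler_norml; apply/andP; split; lra.
Qed.

Lemma complex_cauchy_limit (u : nat -> C) (eps : nat -> R) :
  (forall k m, cnorm (u (k + m)%N - u k) <= eps k) ->
  exists l, forall k, cnorm (u k - l) <= 2 * eps k.
Proof.
move=> H.
have [|lr hr] := @real_cauchy_limit (fun k => Re (u k)) eps.
  by move=> k m; rewrite -ReN -ReD (le_trans (normr_Re_le _)).
have [|li hi] := @real_cauchy_limit (fun k => Im (u k)) eps.
  by move=> k m; rewrite -ImN -ImD (le_trans (normr_Im_le _)).
exists (Complex lr li) => k; rewrite (le_trans (cnorm_le_ReIm _))// ReD ImD ReN ImN/=.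
by rewrite mulr_natl mulr2n lerD.
Qed.

Lemma real_complex_div (x y : R) : (x / y)%:C%C = x%:C%C / y%:C%C :> C.
Proof. by rewrite rmorphM fmorphV. Qed.

Lemma real_complex_1sub (x : R) : (1 - x)%:C%C = 1 - x%:C%C :> C.
Proof. by rewrite rmorphB. Qed.

Context (b : C -> C) (hb : Hinf_ball b).

Definition knorm s : R := Num.sqrt (knorm2 b s).

Lemma knorm_sqr s : in_disc s -> knorm s ^+ 2 = knorm2 b s.
Proof. by move=> hs; rewrite sqr_sqrtr// knorm2_ge0. Qed.

Lemma cnorm_kform_le s t : in_disc s -> in_disc t -> cnorm (kform b s t) <= knorm s * knorm t.
Proof.
move=> hs ht; rewrite -(@ler_pXn2r _ 2)// ?nnegrE ?cnorm_ge0 ?mulr_ge0 ?sqrtr_ge0//.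
by rewrite exprMn !knorm_sqr// kform_cauchy_schwarz.
Qed.

Lemma knorm_cat s t : in_disc s -> in_disc t -> knorm (s ++ t) <= knorm s + knorm t.
Proof.
move=> hs ht; rewrite -(@ler_pXn2r _ 2)// ?nnegrE ?sqrtr_ge0 ?addr_ge0 ?sqrtr_ge0//.
rewrite knorm_sqr ?sqrrD ?knorm_sqr//; last exact: in_disc_cat.
rewrite knorm2E kform_catl !kform_catr -(kform_conj b s t) !ReD Re_conj -!knorm2E.
have := le_trans (Re_le_cnorm _) (cnorm_kform_le hs ht); lra.
Qed.

Lemma knorm1 (c z : C) : disc z -> knorm [:: (c, z)] = cnorm c * knorm [:: (1, z)].
Proof.
move=> zd; apply/eqP; rewrite -(@eqrXn2 _ 2)// ?mulr_ge0 ?sqrtr_ge0 ?cnorm_ge0//.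
rewrite exprMn !knorm_sqr; [|exact: in_disc1|exact: in_disc1].
have -> : [:: (c, z)] = kscale c [:: (1, z)] by rewrite /kscale/= mulr1.
by rewrite !knorm2E kform_scalel kform_scaler mulrA [cconj c * c]mulrC mulcconj ReZ.
Qed.

Lemma dBR_kernel_real z :
  dBR_kernel b z z = ((1 - cnorm (b z) ^+ 2) / (1 - cnorm z ^+ 2))%:C%C.
Proof. by rewrite real_complex_div !real_complex_1sub -!mulcconj. Qed.

Lemma knorm1_sqr z : disc z -> knorm [:: (1, z)] ^+ 2 = (1 - cnorm (b z) ^+ 2) / (1 - cnorm z ^+ 2).
Proof.
by move=> zd; rewrite knorm_sqr; [rewrite knorm2E kform1 dBR_kernel_real|exact: in_disc1].
Qed.

Lemma kcomb_le s z : in_disc s -> disc z -> cnorm (kcomb b s z) <= knorm [:: (1, z)] * knorm s.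
Proof. by move=> hs zd; rewrite -kform1l cnorm_kform_le//; exact: in_disc1. Qed.

Lemma kcomb_cat s t z : kcomb b (s ++ t) z = kcomb b s z + kcomb b t z.
Proof. by rewrite /kcomb big_cat. Qed.

Lemma kcomb1 c z w : kcomb b [:: (c, w)] z = c * dBR_kernel b z w.
Proof. by rewrite /kcomb big_seq1. Qed.

Lemma dBR_kernel_diag z : disc z -> dBR_kernel b z z = (knorm [:: (1, z)] ^+ 2)%:C%C.
Proof.
by move=> zd; rewrite knorm1_sqr// dBR_kernel_real.
Qed.

(* Gliding hump: [f = sum_n sg_n 5^-n K_(w_n) / |K_(w_n)|], where the sign [sg_n]
   makes the partial sums large at [w_n]. *)
Lemma boundary_modulus :
  (forall f, dBR_space b f -> exists2 K : R, 0 <= K & forall w, disc w ->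
    cnorm (f w) <= K * Num.sqrt (Num.sqrt (1 - cnorm w)^-1)) ->
  forall eps : R, 0 < eps -> exists2 d : R, 0 < d & forall w, disc w -> 1 - cnorm w < d ->
    1 - cnorm (b w) ^+ 2 < eps.
Proof.
move=> growth eps eps0; apply: contrapT => H.
have bad (d : R) : 0 < d -> exists w, [/\ disc w, 1 - cnorm w < d & eps <= 1 - cnorm (b w) ^+ 2].
  move=> d0; apply: contrapT => H'; apply: H; exists d => // w wd wlt.
  by rewrite ltNge; apply/negP => h; apply: H'; exists w.
(* The fourth power makes (1 - |w_n|)^(-1/4) at least 25^n, so that even after the weight 5^-n it is
   at least 5^n. *)
have pick (n : nat) : exists w, [/\ disc w, 1 - cnorm w < 25 ^- (4 * n) & eps <= 1 - cnorm (b w) ^+ 2].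
  by apply: bad; rewrite invr_gt0 exprn_gt0.
have [w wP] := choice pick.
have wd n : disc (w n) by have [] := wP n.
pose N n := knorm [:: (1, w n)].
pose q n := Num.sqrt (Num.sqrt (1 - cnorm (w n))^-1).
have d0 n : 0 < 1 - cnorm (w n) by rewrite subr_gt0; exact: wd.
have q4 n : q n ^+ 4 = (1 - cnorm (w n))^-1.
  by rewrite -[4%N]/(2 * 2)%N exprM !sqr_sqrtr ?sqrtr_ge0// invr_ge0 ltW.
have q0 n : 0 <= q n by exact: sqrtr_ge0.
have q25 n : 25 ^+ n <= q n.
  have [_ h _] := wP n; rewrite -(@ler_pXn2r _ 4)// ?nnegrE ?exprn_ge0// q4 -exprM mulnC.
  by rewrite -[leLHS]invrK lef_pV2 ?posrE ?invr_gt0 ?exprn_gt0// ltW.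
pose c := Num.sqrt (eps / 2); have c0 : 0 < c by rewrite sqrtr_gt0 divr_gt0.
(* The squared norm is (1 - |b|^2) / (1 - |w|^2) >= eps / (2 (1 - |w|)), using 1 - |w|^2 <= 2 (1 -
   |w|). *)
have Nq n : c * q n ^+ 2 <= N n.
  have [_ _ h] := wP n; have w0 := cnorm_ge0 (w n); have w1 := d0 n.
  rewrite -(@ler_pXn2r _ 2)// ?nnegrE ?sqrtr_ge0 ?mulr_ge0 ?exprn_ge0 ?sqrtr_ge0//.
  rewrite exprMn -exprM q4 knorm1_sqr// sqr_sqrtr ?divr_ge0 ?(ltW eps0)//.
  have w2 : 0 < 1 - cnorm (w n) ^+ 2 by rewrite subr_gt0 exprn_ilt1// -subr_gt0.
  rewrite ler_pdivlMr// mulrAC ler_pdivrMr//.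
  have -> : eps / 2 * (1 - cnorm (w n) ^+ 2) = eps * ((1 - cnorm (w n) ^+ 2) / 2) by ring.
  apply: ler_pM => //; first exact: ltW.
    by rewrite divr_ge0// ltW.
  have : 0 <= (1 - cnorm (w n)) ^+ 2 by exact: sqr_ge0.
  by rewrite ler_pdivrMr// sqrrB; lra.
have N0 n : 0 < N n.
  apply: lt_le_trans (Nq n); rewrite mulr_gt0// exprn_gt0//.
  by apply: lt_le_trans (q25 n); rewrite exprn_gt0.
pose a n : R := 5 ^- n.
have a0 n : 0 < a n by rewrite invr_gt0 exprn_gt0.
pose v n (sg : C) : C * C := (sg * (a n / N n)%:C%C, w n).
pose fix S n := if n is m.+1 then
   S m ++ [:: v m (if a m * N m <= cnorm (kcomb b (S m) (w m) + (a m * N m)%:C%C) then 1 else -1)]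
  else [::].
(* If |A + B| < |B| then |A - B| > |B|, because the two differ by 2 B: one of the signs keeps the
   new partial sum at [w n] at least as large as its new term. *)
have [sg sgP] : exists sg : nat -> C, forall n, [/\ S n.+1 = S n ++ [:: v n (sg n)], cnorm (sg n) = 1 &
    a n * N n <= cnorm (kcomb b (S n.+1) (w n))].
  exists (fun m => if a m * N m <= cnorm (kcomb b (S m) (w m) + (a m * N m)%:C%C) then 1 else -1).
  move=> n; split; [by []|by case: ifP; rewrite ?cnormN cnorm1|].
  rewrite [S n.+1]/= kcomb_cat kcomb1 dBR_kernel_diag// -/(N n).
  have E : (a n / N n)%:C%C * (N n ^+ 2)%:C%C = (a n * N n)%:C%C :> C.
    by rewrite -rmorphM/=; congr (_%:C%C); field; rewrite gt_eqF.
  case: ifPn => [h|]; first by rewrite mul1r E.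
  rewrite -ltNge => h; rewrite mulN1r mulNr E.
  set A := kcomb b (S n) (w n) in h *; set B : C := (a n * N n)%:C%C in h *.
  have BN : cnorm B = a n * N n by rewrite cnorm_real ger0_norm// mulr_ge0 ?(ltW (a0 n)) ?(ltW (N0 n)).
  have := cnorm_sub_ge (B + B) (A + B).
  have -> : B + B - (A + B) = - (A - B) by ring.
  have -> : cnorm (B + B) = 2 * (a n * N n) by rewrite (_ : B + B = 2%:R * B) ?cnormM ?cnorm_nat ?BN//; ring.
  by rewrite cnormN; move: h; clear; lra.
have vd n sg' : in_disc [:: v n sg'] by exact: in_disc1.
have vn n : knorm [:: v n (sg n)] = a n.
  rewrite knorm1// cnormM cnorm_real -/(N n); have [_ -> _] := sgP n.
  by rewrite mul1r ger0_norm ?divr_ge0 ?(ltW (a0 n)) ?(ltW (N0 n))// divfK ?gt_eqF.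
(* The subtracted term lets the induction telescope: 5/4 a_k is the full geometric tail from [k]
   on. *)
have tail k m : exists T, [/\ S (k + m)%N = S k ++ T, in_disc T & knorm T <= 5 / 4 * a k - 5 / 4 * a (k + m)%N].
  elim: m => [|m [T [TE Td Tn]]].
    by exists [::]; rewrite addn0 cats0 subrr /knorm knorm2E /kform big_nil sqrtr0.
  exists (T ++ [:: v (k + m)%N (sg (k + m)%N)]).
  have [SE _ _] := sgP (k + m)%N; split.
  - by rewrite addnS SE TE catA.
  - exact: in_disc_cat.
  - apply: le_trans (knorm_cat Td (vd _ _)) _; rewrite vn addnS.
    have : a (k + m)%N = 5 * a (k + m).+1 by rewrite /a exprS; field.
    by move: Tn; lra.
have Sd n : in_disc (S n).
  elim: n => [|n ih] //; have [-> _ _] := sgP n; exact: in_disc_cat.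
have tail' k m : exists T, [/\ S (k + m)%N = S k ++ T, in_disc T & knorm T <= 5 / 4 * a k].
  have [T [TE Td Tn]] := tail k m; exists T; split=> //; apply: le_trans Tn _.
  by have := a0 (k + m)%N; lra.
have lim z : exists l, disc z -> forall k, cnorm (kcomb b (S k) z - l) <= 2 * (knorm [:: (1, z)] * (5 / 4 * a k)).
  have [zd|nzd] := pselect (disc z); last by exists 0.
  have [|l hl] := @complex_cauchy_limit (fun k => kcomb b (S k) z) (fun k => knorm [:: (1, z)] * (5 / 4 * a k)).
    move=> k m; have [T [-> Td Tn]] := tail' k m.
    rewrite kcomb_cat addrC addKr (le_trans (kcomb_le Td zd))//.
    by rewrite ler_wpM2l// sqrtr_ge0.
  by exists l.
have [f fP] := choice lim.
have asmall (A e : R) : 0 < e -> exists n, forall k, (n <= k)%N -> `|A| * a k < e.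
  move=> e0; have [n nlt] := halving_lt `|A| e0; exists n => k nk.
  apply: le_lt_trans nlt; rewrite ler_wpM2l// /a -exprVn.
  apply: le_trans (_ : 2^-1 ^+ k <= _); last by rewrite ler_wiXn2l//; lra.
  by rewrite lerXn2r ?nnegrE//; lra.
have fH : dBR_space b f.
  exists S; split; [|split].
  - by move=> n x; exact: Sd.
  - have diff k m : knorm2 b (S (k + m)%N ++ kneg (S k)) <= (5 / 4 * a k) ^+ 2 /\
        knorm2 b (S k ++ kneg (S (k + m)%N)) <= (5 / 4 * a k) ^+ 2.
      have [T [-> Td Tn]] := tail' k m.
      have Tn2 : knorm2 b T <= (5 / 4 * a k) ^+ 2.
        by rewrite -knorm_sqr// lerXn2r ?nnegrE ?sqrtr_ge0// (le_trans _ Tn)// sqrtr_ge0.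
      have c1 : cconj (-1 : C) = -1 by rewrite cconjN cconj1.
      have E1 : kform b ((S k ++ T) ++ kneg (S k)) ((S k ++ T) ++ kneg (S k)) = kform b T T.
        by rewrite knegE !(kform_catl, kform_catr, kform_scalel, kform_scaler) c1; ring.
      have E2 : kform b (S k ++ kneg (S k ++ T)) (S k ++ kneg (S k ++ T)) = kform b T T.
        by rewrite knegE !(kform_catl, kform_catr, kform_scalel, kform_scaler) c1; ring.
      by rewrite !knorm2E E1 E2.
    move=> e e0; have [n hn] := asmall 2 _ e0.
    exists (maxn n 1) => i j; rewrite !geq_max => /andP[ni i1] /andP[nj j1].
    have sq k : (n <= k)%N -> (1 <= k)%N -> (5 / 4 * a k) ^+ 2 < e.
      move=> nk k1; apply: le_lt_trans (hn k nk).
      have ak : a k <= 5^-1.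
        by rewrite /a -exprVn -[leRHS]expr1 ler_wiXn2l//; lra.
      have := a0 k; rewrite ger0_norm// => h.
      have : a k * a k <= a k * 5^-1 by rewrite ler_wpM2l// ltW.
      rewrite exprMn; lra.
    have [ij|/ltnW ji] := leqP i j.
      rewrite -(subnKC ij); have [_ h] := diff i (j - i)%N.
      exact: le_lt_trans h (sq i ni i1).
    rewrite -(subnKC ji); have [h _] := diff j (i - j)%N.
    exact: le_lt_trans h (sq j nj j1).
  - move=> z zd e e0; have [n hn] := asmall (2 * (knorm [:: (1, z)] * (5 / 4))) _ e0.
    exists n => k nk; apply: le_lt_trans (fP z zd k) _.
    apply: le_lt_trans (hn k nk); rewrite !mulrA ler_wpM2r ?(ltW (a0 k))//.
    by rewrite -!mulrA ler_norm.
have [K K0 hK] := growth f fH.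
(* The tail after [n] changes the value at [w n] by at most 2 N_n (5/4) a_(n+1) = a_n N_n / 2, half
   of the hump. So |f(w_n)| >= a_n c q_n^2 / 2, while the growth bound allows only K q_n. *)
have low n : c / 2 * 5 ^+ n <= K.
  have [_ _ h] := sgP n; have := fP (w n) (wd n) n.+1; rewrite -/(N n) => h2.
  have aS : a n = 5 * a n.+1 by rewrite /a exprS; field.
  have h3 : a n * N n / 2 <= cnorm (f (w n)).
    have := cnorm_sub_ge (kcomb b (S n.+1) (w n)) (f (w n)).
    have -> : a n * N n / 2 = a n * N n - 2 * (N n * (5 / 4 * a n.+1)) by rewrite aS; field.
    by move: h h2; clear; lra.
  have h4 := le_trans h3 (hK _ (wd n)); rewrite -/(q n) in h4.
  have qp : 0 < q n by apply: lt_le_trans (q25 n); rewrite exprn_gt0.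
  rewrite -(ler_pM2r qp); apply: le_trans h4.
  have h5 : a n * (c * q n ^+ 2) / 2 <= a n * N n / 2.
    by rewrite ler_wpM2r// ler_wpM2l// ltW.
  apply: le_trans h5.
  have -> : a n * (c * q n ^+ 2) / 2 = c / 2 * (a n * q n) * q n by ring.
  rewrite ler_wpM2r// ler_wpM2l ?divr_ge0 ?(ltW c0)//.
  apply: le_trans (_ : a n * 25 ^+ n <= _); last by rewrite ler_wpM2l ?(ltW (a0 n)).
  have -> : (25 : R) = 5 * 5 by ring.
  by rewrite exprMn mulKf// expf_neq0.
have c20 : 0 < c / 2 by rewrite divr_gt0.
have [n hn] := halving_lt K c20.
have h1 : K < c / 2 * 2 ^+ n by rewrite -ltr_pdivrMr ?exprn_gt0// -exprVn.
have h2 : c / 2 * 2 ^+ n <= c / 2 * 5 ^+ n.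
  by rewrite ler_pM2l// lerXn2r ?nnegrE//; lra.
by have := le_trans h2 (low n); rewrite leNgt h1.
Qed.

End gliding_hump.

(** * Szego kernels in the Dirichlet-type spaces *)

(** Tonelli for an indicator on a product whose first factor is itself a product: products of
    exhausting sets show that [m1 \x m2] is sigma-finite, and it is then packed as such a
    measure. *)
Lemma product_section_integral {d1 d2 d3 : measure_display} {R : realType}
  (T1 : measurableType d1) (T2 : measurableType d2) (T3 : measurableType d3)
  (m1 : {sigma_finite_measure set T1 -> \bar R})
  (m2 : {sigma_finite_measure set T2 -> \bar R})
  (m3 : {sigma_finite_measure set T3 -> \bar R}) (A : set ((T1 * T2) * T3)) :
  measurable A ->
  (\int[(m1 \x m2)%E]_p fubini_F m3 (EFin \o \1_A) p =
   \int[m3]_z (m1 \x m2)%E (ysection A z))%E.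
Proof.
move=> mA; have sf : sigma_finite setT (m1 \x m2)%E.
  have /sigma_finiteP[F [TF ndF Foo]] := sigma_finiteT m1.
  have /sigma_finiteP[G [TG ndG Goo]] := sigma_finiteT m2.
  exists (fun n => F n `*` G n).
    apply/seteqP; split => [[x y] _|//].
    have : setT x by []; rewrite TF => -[n _ Fnx].
    have : setT y by []; rewrite TG => -[k _ Gky].
    exists (maxn n k) => //; split.
    - by move: x Fnx; exact/subsetPset/ndF/leq_maxl.
    - by move: y Gky; exact/subsetPset/ndG/leq_maxr.
  move=> k; have [mF Fk] := Foo k; have [mG Gk] := Goo k.
  split; first exact: measurableX.
  by rewrite product_measure1E// lte_mul_pinfty// ge0_fin_numE.
pose L : {sigma_finite_measure set (T1 * T2)%type -> \bar R} :=
  HB.pack (m1 \x m2)%E (Measure_isSigmaFinite.Build _ _ _ (m1 \x m2)%E sf).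
rewrite (@indic_fubini_tonelli _ _ _ _ R L m3 A mA).
by rewrite indic_fubini_tonelli_GE.
Qed.

(** * Integrability of the Poisson integral over the disc *)

Section poisson_integral.
Context {R : realType}.
Local Notation C := R[i].
Local Notation leb2 := (@lebesgue_measure R \x @lebesgue_measure R)%E.

(** Closeness is coordinatewise, so that the sections are squares, whose area is immediate. *)
Definition near_diag (h : R) : set ((R * R) * (R * R)) :=
  [set q | `|q.1.1 - q.2.1| <= h /\ `|q.1.2 - q.2.2| <= h].

Lemma measurable_near_diag h : measurable (near_diag h).
Proof.
have aux (pr : R * R -> R) : measurable_fun setT pr ->
    measurable [set q : (R * R) * (R * R) | `|pr q.1 - pr q.2| <= h].
  move=> mpr; have mf : measurable_fun setT (fun q : (R * R) * (R * R) => `|pr q.1 - pr q.2|).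
    apply: measurableT_comp => //; apply: measurable_funB.
      by apply: measurableT_comp => //; exact: measurable_fst.
    by apply: measurableT_comp => //; exact: measurable_snd.
  have := mf measurableT `]-oo, h]%classic (measurable_itv _); rewrite setTI.
  by congr measurable; apply/seteqP; split=> q /=; rewrite in_itv.
have -> : near_diag h = [set q : (R * R) * (R * R) | `|q.1.1 - q.2.1| <= h] `&`
    [set q : (R * R) * (R * R) | `|q.1.2 - q.2.2| <= h] by [].
by apply: measurableI; [exact: (aux fst)|exact: (aux snd)].
Qed.

Lemma near_diag_section h (zeta : R * R) : 0 <= h ->
  leb2 (ysection (near_diag h) zeta) = (4 * h ^+ 2)%:E.
Proof.
move=> h0; have -> : ysection (near_diag h) zeta =
    `[zeta.1 - h, zeta.1 + h]%classic `*` `[zeta.2 - h, zeta.2 + h]%classic.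
  apply/seteqP; split=> p; rewrite /ysection/= !in_itv/= inE /near_diag/= !ler_distl => -[].
    by move=> -> ->.
  by move=> -> ->.
have len (x : R) : lebesgue_measure (`[x - h, x + h]%classic : set R) = (2 * h)%:E.
  rewrite lebesgue_measure_itv/= lte_fin; case: ltP => hx.
    by rewrite -EFinB; congr EFin; ring.
  by congr EFin; lra.
rewrite product_measure1E; [|exact: measurable_itv|exact: measurable_itv].
by rewrite [X in (X * _)%E]len [X in (_ * X)%E]len -EFinM; congr EFin; ring.
Qed.

Definition annulus_radius (k : nat) : R := 2 / 2 ^+ k.

(* Dyadic decomposition of the Poisson kernel: with [d = |p - zeta|], it is at most
   [2 / d] because [1 - |p| <= d]. *)
Lemma poisson_kernel_le (p zeta : R * R) : discR p -> circle zeta ->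
  exists k : nat, near_diag (annulus_radius k) (p, zeta) /\
   (1 - cnorm (to_C p) ^+ 2) / cnorm (to_C p - to_C zeta) ^+ 2 <= 2 ^+ k.+1.
Proof.
move=> pd zc; have z1 : cnorm (to_C zeta) = 1 := cnorm_to_C_circle zc.
have p1 : cnorm (to_C p) < 1.
  by move: pd; rewrite /discR /cnorm/= => h; rewrite -sqrtr1 ltr_sqrt.
have p0 := cnorm_ge0 (to_C p).
pose M := Num.max `|p.1 - zeta.1| `|p.2 - zeta.2|.
pose d := cnorm (to_C p - to_C zeta).
have d0 : 1 - cnorm (to_C p) <= d.
  by have := cnorm_sub_ge (to_C zeta) (to_C p); rewrite cdistC z1.
have dp : 0 < d by apply: lt_le_trans d0; rewrite subr_gt0.
have Md : M <= d.
  rewrite ge_max; apply/andP; split.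
    by have := normr_Re_le (to_C p - to_C zeta); rewrite ReD ReN.
  by have := normr_Im_le (to_C p - to_C zeta); rewrite ImD ImN.
have d2 : d <= 2 by rewrite (le_trans (cnormB _ _))// z1; clear -p1; lra.
have Mp : 0 < M.
  rewrite lt_max !normr_gt0 !subr_eq0; apply/negPn/negP; rewrite negb_or !negbK => /andP[/eqP e1 /eqP e2].
  have E : p = zeta by move: e1 e2; clear; case: p zeta => [? ?] [? ?] /= -> ->.
  by move: p1; rewrite E z1 ltxx.
(* The least such [k] brackets [M]: it gives 2 / d <= 2 / M < 2^(k+1), and its minimality gives M <=
   2 / 2^k, where for k = 0 the bound d <= 2 takes over. *)
have exk : exists k : nat, 2^-1 ^+ k < M.
  by have [n] := halving_lt 1 Mp; rewrite mul1r => h; exists n.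
pose k := ex_minn exk; exists k; rewrite /k; case: ex_minnP => {}k hk kmin.
have Mk : M <= annulus_radius k.
  rewrite /annulus_radius; case: k hk kmin => [|k] hk kmin.
    by rewrite expr0 divr1 (le_trans Md).
  rewrite leNgt; apply/negP => h; have := kmin k; rewrite ltnn => /(_ _)H.
  apply: (@notF); apply: H; apply: le_lt_trans h; rewrite exprVn exprS le_eqVlt; apply/orP; left.
  by apply/eqP; field; rewrite expf_neq0.
split.
  by move: Mk; rewrite ge_max => /andP[].
apply: le_trans (_ : 2 / d <= _).
  rewrite expr2 invfM mulrA ler_wpM2r ?invr_ge0 ?(ltW dp)// ler_pdivrMr//.
  have : 0 <= (1 - cnorm (to_C p)) ^+ 2 by exact: sqr_ge0.
  by move: d0; rewrite -/d sqrrB; lra.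
rewrite exprS ler_wpM2l// -[leRHS]invrK lef_pV2 ?posrE ?invr_gt0 ?exprn_gt0//.
by rewrite -exprVn (le_trans (ltW hk)).
Qed.

(** The Poisson kernel is dominated by the series of 2^(k+1) times the indicator of [S k]. The
    sections of [S k] have area 16 / 4^k, so integrating first over the plane leaves a geometric
    series times the mass of [m]. *)
Lemma poisson_integral_lty (m : finite_measure_R2 R) (c : R * R -> R) (B : R) :
  0 <= B -> (forall p, discR p -> 0 <= c p <= B) ->
  (\int[leb2]_(p in discR) ((c p)%:E * Poisson m (to_C p)) < +oo)%E.
Proof.
move=> B0 cB; pose S k := near_diag (annulus_radius k).
have mS k : measurable (S k) by exact: measurable_near_diag.
pose I k : (R * R) * (R * R) -> R := \1_(S k).
pose phi k (p : R * R) : \bar R := fubini_F m (EFin \o I k) p.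
have phi0 k p : (0 <= phi k p)%E by exact: indic_fubini_tonelli_F_ge0.
have mphi k : measurable_fun setT (phi k).
  by apply: (@indic_measurable_fun_fubini_tonelli_F _ _ _ _ R m (S k)); exact: mS.
have I0 k q : 0 <= I k q by rewrite /I indicE.
have a0 k : 0 <= 2 ^+ k.+1 :> R by exact: exprn_ge0.
have step1 p : discR p -> (Poisson m (to_C p) <= \sum_(0 <= k <oo) (2 ^+ k.+1)%:E * phi k p)%E.
  move=> pd; apply: le_trans (_ : \int[m]_zeta
      (\sum_(0 <= k <oo) (2 ^+ k.+1)%:E * (I k (p, zeta))%:E) <= _)%E.
    apply: ge0_le_integral_sub => // zeta.
    - move=> zc; rewrite lee_fin divr_ge0 ?sqr_ge0// subr_ge0 exprn_ile1 ?cnorm_ge0//.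
      by move: pd; rewrite /discR /cnorm/= => h; rewrite -sqrtr1 ler_sqrt// ltW.
    - by move=> _; apply: nneseries_ge0 => k _ _; rewrite -EFinM lee_fin mulr_ge0.
    - move=> zc; have [k [kS kle]] := poisson_kernel_le pd zc.
      apply: le_trans (nneseries_lim_ge (m := 0) k.+1 _); last first.
        by move=> n _ _; rewrite -EFinM lee_fin mulr_ge0.
      rewrite big_nat_recr//=; apply: le_trans (_ : (2 ^+ k.+1)%:E * (I k (p, zeta))%:E <= _)%E.
        by rewrite /I indicE mem_set// -EFinM lee_fin mulr1.
      by rewrite leeDr// sume_ge0// => n _; rewrite -EFinM lee_fin mulr_ge0.
  rewrite integral_nneseries//; last 2 first.
  - move=> k; under eq_fun do rewrite -EFinM.
    apply/measurable_EFinP; apply: measurable_funM => //.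
    apply: (measurable_fun_pair2 (f := I k)); exact: measurable_indic.
  - by move=> k zeta _; rewrite -EFinM lee_fin mulr_ge0.
  apply: lee_nneseries => [k _ _|k _].
    by apply: integral_ge0 => zeta _; rewrite -EFinM lee_fin mulr_ge0.
  rewrite ge0_integralZl_EFin//.
  - by move=> zeta _; rewrite lee_fin.
  - by apply/measurable_EFinP; apply: (measurable_fun_pair2 (f := I k)); exact: measurable_indic.
have mT : m setT \is a fin_num by apply: fin_num_measure.
pose T := fine (m setT); have T0 : 0 <= T by exact: fine_ge0.
have intphi k : (\int[leb2]_p phi k p = (4 * annulus_radius k ^+ 2 * T)%:E)%E.
  transitivity (\int[m]_z leb2 (ysection (S k) z))%E.
    exact: (product_section_integral (@lebesgue_measure R) (@lebesgue_measure R) m (mS k)).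
  under eq_integral => zeta _.
    rewrite /= near_diag_section; last by rewrite /annulus_radius divr_ge0// exprn_ge0.
    over.
  rewrite integral_cst// [in RHS]EFinM; congr (_ * _)%E; exact/esym/fineK.
(* The k-th term is B 2^(k+1) (16 / 4^k) T = 64 B T / 2^(k+1). *)
apply: le_lt_trans (_ : \sum_(0 <= k <oo) (64 * B * T / (2 ^ k.+1)%:R)%:E < +oo)%E; last first.
  by apply: le_lt_trans (epsilon_trick0 _ _) (ltry _); rewrite !mulr_ge0.
apply: le_trans (_ : \int[leb2]_p (\sum_(0 <= k <oo) (B * 2 ^+ k.+1)%:E * phi k p) <= _)%E.
  apply: ge0_le_integral_sub => // p pd.
  - have /andP[c0 _] := cB p pd; apply: mule_ge0; first by rewrite lee_fin.
    apply: Poisson_ge0; move: pd; rewrite /discR /disc/= /cnorm/= => h.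
    by rewrite -sqrtr1 ltr_sqrt.
  - by apply: nneseries_ge0 => k _ _; rewrite mule_ge0// lee_fin mulr_ge0.
  - have /andP[c0 cle] := cB p pd.
    apply: le_trans (_ : B%:E * Poisson m (to_C p) <= _)%E.
      apply: lee_wpmul2r; last by rewrite lee_fin.
      apply: Poisson_ge0; move: pd; rewrite /discR /disc/= /cnorm/= => h.
      by rewrite -sqrtr1 ltr_sqrt.
    apply: le_trans (lee_wpmul2l _ (step1 p pd)) _; first by rewrite lee_fin.
    rewrite -nneseriesZl; last by move=> k _; rewrite mule_ge0// lee_fin.
    apply: lee_nneseries => [k _ _|k _]; last by rewrite muleA -EFinM.
    by rewrite !mule_ge0// lee_fin.
rewrite integral_nneseries//; last 2 first.
- by move=> k; apply: measurable_funeM; exact: mphi.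
- by move=> k p _; rewrite mule_ge0// lee_fin mulr_ge0.
apply: lee_nneseries => [k _ _|k _].
  by apply: integral_ge0 => p _; rewrite mule_ge0// lee_fin mulr_ge0.
rewrite ge0_integralZl_EFin//; [|exact: mphi|by rewrite mulr_ge0].
rewrite intphi -EFinM lee_fin le_eqVlt; apply/orP; left; apply/eqP.
rewrite /annulus_radius natrX exprS; field; by rewrite expf_neq0.
Qed.

End poisson_integral.

(** * Szego kernels, their derivatives and their Dirichlet integrals *)

Section szego.
Context {R : realType}.
Local Notation C := R[i].
Implicit Types (v z : C).

Lemma is_cderivX (f : C -> C) z a n : is_cderiv f z a ->
  is_cderiv (fun w => f w ^+ n.+1) z (n.+1%:R * f z ^+ n * a).
Proof.
move=> fa; elim: n => [|n ih].
  by under [X in is_cderiv X]funext do rewrite expr1; rewrite expr0 !mul1r.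
under [X in is_cderiv X]funext do rewrite exprS.
have := is_cderivM fa ih; congr is_cderiv.
by rewrite -[n.+2%:R]natr1 (exprS _ n); ring.
Qed.

Definition szego v z : C := (1 - cconj v * z)^-1.

Lemma szego_denom_ge v z : disc z -> 1 - cnorm v <= cnorm (1 - cconj v * z).
Proof.
move=> zd; have := cnorm_sub_ge 1 (cconj v * z); rewrite cnorm1 cnormM cnorm_conj => h.
have : cnorm v * cnorm z <= cnorm v by rewrite ler_piMr ?cnorm_ge0// ltW.
lra.
Qed.

Lemma szego_denom_neq0 v z : disc v -> disc z -> 1 - cconj v * z != 0.
Proof.
move=> vd zd; rewrite -cnorm_gt0; have := szego_denom_ge v zd.
by move: vd; rewrite /disc/=; lra.
Qed.

Lemma is_cderiv_szego v z : disc v -> disc z ->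
  is_cderiv (szego v) z (cconj v * szego v z ^+ 2).
Proof.
move=> vd zd.
have d1 : is_cderiv (fun w => 1 - cconj v * w) z (0 - cconj v * 1).
  exact: (is_cderivB (is_cderiv_cst 1 z) (is_cderivZ (cconj v) (is_cderiv_id z))).
have := @is_cderivV _ (fun w => 1 - cconj v * w) z _ (szego_denom_neq0 vd zd) d1; congr is_cderiv.
by rewrite sub0r mulr1 opprK /szego exprVn.
Qed.

Lemma holomorphic_szego v : disc v -> holomorphic_on_disc (szego v).
Proof. by move=> vd z zd; exists (cconj v * szego v z ^+ 2); exact: is_cderiv_szego. Qed.

Lemma cderivn_szego v n z : disc v -> disc z ->
  cderivn n (szego v) z = n`!%:R * cconj v ^+ n * szego v z ^+ n.+1.
Proof.
move=> vd; elim: n z => [|n ih] z zd; first by rewrite /= !mul1r expr1.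
apply: is_cderivE.
have := is_cderivZ (n`!%:R * cconj v ^+ n) (is_cderivX n (is_cderiv_szego vd zd)).
have -> : n`!%:R * cconj v ^+ n * (n.+1%:R * szego v z ^+ n * (cconj v * szego v z ^+ 2)) =
    (n.+1)`!%:R * cconj v ^+ n.+1 * szego v z ^+ n.+2.
  rewrite factS natrM !exprS; ring.
apply: is_cderiv_near; exists (1 - cnorm z); first by rewrite subr_gt0.
move=> w wz; apply/esym/ih; rewrite /disc/=; have := cnorm_sub_ge w z; lra.
Qed.

Lemma H2_szego v : disc v -> H2 (szego v).
Proof.
move=> vd; split; first exact: holomorphic_szego.
have v1 : cnorm v ^+ 2 < 1 by rewrite exprn_ilt1 ?cnorm_ge0.
exists (1 - cnorm v ^+ 2)^-1 => N.
rewrite (eq_bigr (fun n : 'I_N => (cnorm v ^+ 2) ^+ n)) => [|n _].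
  rewrite -[leRHS]mul1r ler_pdivlMr ?subr_gt0// mulrC -[X in X <= _]opprK -mulNr opprB.
  by rewrite -subrX1 opprB gerBl exprn_ge0// sqr_ge0.
rewrite cderivn_szego//; last by rewrite /disc/= cnorm0.
rewrite /szego mulr0 subr0 invr1 expr1n mulr1 mulrC mulrA mulVf ?pnatr_eq0 -?lt0n ?fact_gt0//.
by rewrite mul1r cnormX cnorm_conj -!exprM mulnC.
Qed.

Lemma Dmu_szego_lty (m : finite_measure_R2 R) j v : disc v -> (Dmu m j (szego v) < +oo)%E.
Proof.
move=> vd; pose K : R := (j`!%:R / (1 - cnorm v) ^+ j.+1) ^+ 2 / (j`!%:R * (j - 1)`!%:R * pi).
have v1 : 0 < 1 - cnorm v by rewrite subr_gt0.
have D0 : 0 <= (j`!%:R * (j - 1)`!%:R * pi : R) by rewrite !mulr_ge0// pi_ge0.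
apply: (@poisson_integral_lty _ _ _ K); first by rewrite divr_ge0// sqr_ge0.
move=> p pd; have cd : disc (to_C p).
  by move: pd; rewrite /discR /disc/= /cnorm/= => h; rewrite -sqrtr1 ltr_sqrt.
have q0 : 0 <= 1 - cnorm (to_C p) ^+ 2 <= 1.
  by rewrite subr_ge0 gerBl sqr_ge0 andbT exprn_ile1 ?cnorm_ge0// ltW.
have /andP[q1 q2] := q0.
rewrite divr_ge0 ?mulr_ge0 ?exprn_ge0 ?cnorm_ge0 ?pi_ge0//=.
rewrite ler_wpM2r ?invr_ge0//; apply: le_trans (_ : cnorm (cderivn j (szego v) (to_C p)) ^+ 2 <= _).
  by rewrite ler_piMr ?sqr_ge0// exprn_ile1.
have b0 : 0 <= (j`!%:R / (1 - cnorm v) ^+ j.+1 : R) by rewrite divr_ge0// exprn_ge0// ltW.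
rewrite ler_sqr ?nnegrE ?cnorm_ge0// cderivn_szego// !cnormM cnorm_nat !cnormX cnorm_conj -mulrA.
rewrite ler_wpM2l//; apply: le_trans (_ : cnorm (szego v (to_C p)) ^+ j.+1 <= _).
  by rewrite ler_piMl ?exprn_ge0 ?cnorm_ge0// exprn_ile1 ?cnorm_ge0// ltW.
rewrite -exprVn lerXn2r ?nnegrE ?cnorm_ge0 ?invr_ge0 ?(ltW v1)//.
have h := szego_denom_ge v cd; rewrite /szego cnormV lef_pV2 ?posrE//.
exact: lt_le_trans h.
Qed.

Lemma Hvec_szego m (mu : nat -> finite_measure_R2 R) v : disc v -> Hvec m mu (szego v).
Proof.
move=> vd j _; split=> _; first exact: H2_szego.
by split; [exact: holomorphic_szego|exact: Dmu_szego_lty].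
Qed.

End szego.

(** * Vanishing of b *)

Section duality.
Context {R : realType}.
Local Notation C := R[i].
Context (b : C -> C) (hb : Hinf_ball b).

Lemma kform_kcomb s t : kform b t s = \sum_(x <- t) cconj x.1 * kcomb b s x.2.
Proof.
apply: eq_bigr => x _; rewrite /kcomb mulr_sumr; apply: eq_bigr => y _; ring.
Qed.

Lemma sum_conj_approx (f : C -> C) (g : nat -> C -> C) (t : seq (C * C)) :
  in_disc t ->
  (forall z, disc z -> forall e : R, 0 < e -> exists N : nat, forall n, (N <= n)%N ->
     cnorm (g n z - f z) < e) ->
  forall e : R, 0 < e -> exists N : nat, forall n, (N <= n)%N ->
    cnorm (\sum_(x <- t) cconj x.1 * g n x.2 - \sum_(x <- t) cconj x.1 * f x.2) <= e.
Proof.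
move=> + gf; elim: t => [|y t ih] td e e0.
  by exists 0%N => n _; rewrite !big_nil subrr cnorm0 ltW.
have [|N1 h1] := ih _ (e / 2) (divr_gt0 e0 (ltr0Sn _ _)).
  by move=> x xt; apply: td; rewrite inE xt orbT.
have c0 : 0 < cnorm y.1 + 1 by rewrite ltr_wpDl// cnorm_ge0.
have [||N2 h2] := gf y.2 _ (e / 2 / (cnorm y.1 + 1)).
- by apply: td; rewrite inE eqxx.
- by rewrite !divr_gt0.
exists (maxn N1 N2) => n; rewrite geq_max => /andP[n1 n2].
rewrite !big_cons.
have -> (a c d k l : C) : a * c + d - (a * k + l) = a * (c - k) + (d - l) by ring.
apply: le_trans (cnormD _ _) _; rewrite cnormM cnorm_conj.
have k1 := h1 n n1; have k2 := ltW (h2 n n2).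
have : cnorm y.1 * cnorm (g n y.2 - f y.2) <= e / 2.
  apply: le_trans (_ : (cnorm y.1 + 1) * (e / 2 / (cnorm y.1 + 1)) <= _).
    by apply: ler_pM; rewrite ?cnorm_ge0// lerDl.
  by rewrite mulrC divfK// gt_eqF.
move: k1; lra.
Qed.

(** The sum is the limit of the pairings of [S n] with [t], to which Cauchy-Schwarz applies; once
    the sequence stays within distance 1 of [S N], its norms are at most [knorm b (S N) + 1]. *)
Lemma dBR_duality f : dBR_space b f -> exists2 K : R, 0 <= K &
  forall t, in_disc t -> cnorm (\sum_(x <- t) cconj x.1 * f x.2) <= K * knorm b t.
Proof.
move=> [S [Sd [Sc Sl]]].
have [N hN] := Sc 1 ltr01.
exists (knorm b (S N) + 1); first by rewrite addr_ge0// sqrtr_ge0.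
move=> t td; apply/ler_addgt0Pr => e e0.
have [M hM] := sum_conj_approx td Sl e0.
pose n := maxn N M; have nN : (N <= n)%N by exact: leq_maxl.
have h := hM n (leq_maxr _ _).
have sd k : in_disc (S k) by move=> x; exact: Sd.
have nd k : in_disc (kneg (S k)) by rewrite knegE; exact: in_disc_scale.
have h1 : knorm b (S n ++ kneg (S N)) <= 1.
  by rewrite /knorm -[leRHS]sqrtr1 ler_wsqrtr// ltW// hN.
have c1 : cconj (-1 : C) = -1 by rewrite cconjN cconj1.
have E : kform b t (S n) = kform b t (S n ++ kneg (S N)) + kform b t (S N).
  by rewrite knegE kform_catr kform_scaler; ring.
have h2 : cnorm (kform b t (S n)) <= knorm b t * 1 + knorm b t * knorm b (S N).
  rewrite E; apply: le_trans (cnormD _ _) _; apply: lerD.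
    apply: le_trans (cnorm_kform_le hb td _) _; first exact: in_disc_cat.
    by rewrite ler_wpM2l// sqrtr_ge0.
  exact: cnorm_kform_le.
rewrite kform_kcomb in h2.
have := cnorm_sub_ge (\sum_(x <- t) cconj x.1 * f x.2) (\sum_(x <- t) cconj x.1 * kcomb b (S n) x.2).
rewrite cdistC; move: h h2; rewrite mulrDl mul1r mulr1 (mulrC (knorm b (S N))).
lra.
Qed.

End duality.

(** * Discrete Fourier analysis on roots of unity *)

Section fourier.
Context {R : realType}.
Local Notation C := R[i].

Lemma real_complex_sum (I : Type) (r : seq I) (P : pred I) (F : I -> R) :
  (\sum_(i <- r | P i) F i)%:C%C = \sum_(i <- r | P i) (F i)%:C%C :> C.
Proof. exact: rmorph_sum. Qed.

Lemma real_complexM (x y : R) : (x * y)%:C%C = x%:C%C * y%:C%C :> C.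
Proof. exact: rmorphM. Qed.

Lemma real_complex_nat n : n%:R%:C%C = n%:R :> C.
Proof. exact: rmorph_nat. Qed.

Lemma cconjX (z : C) n : cconj (z ^+ n) = cconj z ^+ n.
Proof. by elim: n => [|n ih]; rewrite ?expr0 ?cconj1// !exprS cconjM ih. Qed.

Lemma sum_conj_square (I : finType) (a : I -> C) :
  \sum_i \sum_j a i * cconj (a j) = (cnorm (\sum_i a i) ^+ 2)%:C%C.
Proof.
rewrite -mulcconj cconj_sum mulr_suml; apply: eq_bigr => i _; by rewrite mulr_sumr.
Qed.

(** Off the diagonal, [u = w i * cconj (w j)] differs from 1 and satisfies [u ^+ N = 1], so its
    geometric sum vanishes. *)
Lemma discrete_parseval N (w a : 'I_N -> C) :
  (forall i, cnorm (w i) = 1) -> (forall i, w i ^+ N = 1) -> injective w ->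
  \sum_(n < N) cnorm (\sum_i a i * w i ^+ n) ^+ 2 = N%:R * \sum_i cnorm (a i) ^+ 2.
Proof.
move=> w1 wN winj.
suff : (\sum_(n < N) cnorm (\sum_i a i * w i ^+ n) ^+ 2)%:C%C =
   (N%:R * \sum_i cnorm (a i) ^+ 2)%:C%C :> C by move=> /(congr1 (@complex.Re R)).
have ww i : w i * cconj (w i) = 1 by rewrite mulcconj w1 expr1n.
rewrite real_complexM !real_complex_sum real_complex_nat.
under eq_bigr do rewrite -sum_conj_square.
rewrite exchange_big mulr_sumr; apply: eq_bigr => i _.
rewrite exchange_big (bigD1 i)//= [X in _ + X]big1 ?addr0.
  rewrite -mulcconj (eq_bigr (fun=> a i * cconj (a i))) => [|n _].
    by rewrite sumr_const card_ord mulr_natl.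
  by rewrite cconjM cconjX mulrACA -exprMn ww expr1n mulr1.
move=> j ji; pose u := w i * cconj (w j).
have u1 : u != 1.
  apply: contra ji => /eqP h; apply/eqP/winj.
  by rewrite -[LHS]mul1r -h -mulrA (mulrC (cconj _)) ww mulr1.
rewrite (eq_bigr (fun n : 'I_N => (a i * cconj (a j)) * u ^+ n)) => [|n _].
  rewrite -mulr_sumr; have /eqP : (u - 1) * (\sum_(n < N) u ^+ n) = 0.
    by rewrite -subrX1 exprMn wN mul1r -cconjX wN cconj1 subrr.
  by rewrite mulf_eq0 subr_eq0 (negPf u1) => /eqP ->; rewrite mulr0.
by rewrite cconjM cconjX mulrACA -exprMn.
Qed.

Definition root_unity N (i : nat) : C := circ 1 (tpi * i%:R / N%:R).

Lemma circ1X t n : (circ 1 t : C) ^+ n = circ 1 (t * n%:R).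
Proof.
elim: n => [|n ih]; first by rewrite expr0 mulr0 /circ cos0 sin0 mulr1 mulr0.
rewrite exprS ih -natr1 mulrDr mulr1 addrC /circ !mul1r cosD sinD.
by apply/complexP; rewrite !(ReM, ImM)/= addrC.
Qed.

Lemma circ1_tpi : circ 1 (tpi : R) = 1 :> C.
Proof. by rewrite /circ /tpi cos2pi sin2pi mulr1 mulr0. Qed.

Lemma root_unityX N i : (0 < N)%N -> root_unity N i ^+ N = 1.
Proof.
by move=> N0; rewrite circ1X divfK ?pnatr_eq0 -?lt0n// -circ1X circ1_tpi expr1n.
Qed.

Lemma cnorm_root_unity N i : cnorm (root_unity N i) = 1.
Proof. by rewrite cnorm_circ normr1. Qed.

Lemma root_unity_inj N : injective (fun i : 'I_N => root_unity N i).
Proof.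
move=> i j; wlog ij : i j / (i <= j)%N => [H|].
  by have [ij|/ltnW ji] := leqP i j; [exact: H|move=> /esym/(H _ _ ji)].
move=> E; apply/val_inj/eqP; rewrite eqn_leq ij/= leqNgt; apply/negP => lt.
have N0 : 0 < N%:R :> R by rewrite ltr0n (leq_ltn_trans _ (ltn_ord i)).
(* Half the difference of the angles: it lies strictly between 0 and pi, so sin x > 0, whereas equal
   roots force cos (2 x) = 1. *)
pose x : R := pi * (j - i)%:R / N%:R.
have xpi : 0 < x < pi.
  apply/andP; split; first by rewrite divr_gt0// mulr_gt0 ?pi_gt0// ltr0n subn_gt0.
  rewrite ltr_pdivrMr// ltr_pM2l ?pi_gt0// ltr_nat.
  exact: leq_ltn_trans (leq_subr _ _) (ltn_ord j).
have s0 := sin_gt0_pi xpi.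
have : cos (x *+ 2) = 1.
  have -> : x *+ 2 = (tpi : R) * j%:R / N%:R - tpi * i%:R / N%:R.
    rewrite /x natrB// /tpi; ring.
  rewrite cosB; move: E; rewrite /root_unity /circ !mul1r => -[-> ->].
  by rewrite -!expr2 cos2Dsin2.
rewrite cos_mulr2n cos2sin2; have := exprn_gt0 2 s0.
lra.
Qed.

End fourier.

Section roots_estimate.
Context {R : realType}.
Local Notation C := R[i].
Context (b : C -> C).

Definition root_points (c : C) N (i : nat) : C := c * root_unity N i.

(** Pairing a function with this combination averages it against conj b over the [N] rotates of
    [c]. *)
Definition root_comb (c : C) N : seq (C * C) :=
  [seq (b (root_points c N i) / N%:R, root_points c N i) | i : 'I_N].

Lemma cnorm_root_points c N i : cnorm (root_points c N i) = cnorm c.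
Proof. by rewrite cnormM cnorm_root_unity mulr1. Qed.

Lemma in_disc_root_comb c N : disc c -> in_disc (root_comb c N).
Proof.
by move=> cd x /mapP[i _ ->] /=; rewrite /disc/= cnorm_root_points.
Qed.

(** Because [u ^+ N = 1], the geometric series folds modulo [N] into finitely many frequencies; the
    folding costs the factor 1 / (1 - q^N). *)
Lemma kernel_geometric (q : R) (u : C) N : 0 <= q -> q < 1 -> (0 < N)%N -> u ^+ N = 1 ->
  q%:C%C * u != 1 ->
  (1 - q%:C%C * u)^-1 = ((1 - q ^+ N)^-1)%:C%C * \sum_(n < N) (q ^+ n)%:C%C * u ^+ n.
Proof.
move=> q0 q1 N0 uN qu1.
have qN : 1 - (q ^+ N)%:C%C != 0 :> C.
  by rewrite -real_complex_1sub -cnorm_eq0 cnorm_real normr_eq0 subr_eq0 gt_eqF// exprn_ilt1 ?gtn_eqF.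
have qX n : (q ^+ n)%:C%C = q%:C%C ^+ n :> C by exact: rmorphXn.
have S : (1 - q%:C%C * u) * \sum_(n < N) (q ^+ n)%:C%C * u ^+ n = 1 - (q ^+ N)%:C%C.
  under eq_bigr do rewrite qX -exprMn.
  by rewrite -opprB mulNr -subrX1 opprB exprMn uN mulr1 qX.
have -> : ((1 - q ^+ N)^-1)%:C%C = (1 - (q ^+ N)%:C%C)^-1 :> C.
  by rewrite -real_complex_1sub; exact: fmorphV.
apply: (mulfI (_ : 1 - q%:C%C * u != 0)); first by rewrite subr_eq0 eq_sym.
by rewrite mulfV ?subr_eq0 1?eq_sym// mulrCA S mulVf.
Qed.

(** With these coefficients c_j conj c_i (1 - b_i conj b_j) equals (conj b_i b_j - |b_i|^2 |b_j|^2)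
    / N^2, a difference of two products of separate factors, so each frequency contributes a
    difference of two squares. *)
Lemma kform_root_comb c N : disc c -> (0 < N)%N ->
  kform b (root_comb c N) (root_comb c N) =
  ((1 - (cnorm c ^+ 2) ^+ N)^-1 * \sum_(n < N) (cnorm c ^+ 2) ^+ n *
    (cnorm (\sum_(i < N) cconj (b (root_points c N i)) / N%:R * root_unity N i ^+ n) ^+ 2 -
     cnorm (\sum_(i < N) (cnorm (b (root_points c N i)) ^+ 2)%:C%C / N%:R * root_unity N i ^+ n) ^+ 2))%:C%C.
Proof.
move=> cd N0; pose q := cnorm c ^+ 2; have q0 : 0 <= q := sqr_ge0 _.
have q1 : q < 1 by rewrite exprn_ilt1 ?cnorm_ge0.
pose z i := root_points c N i; pose w i := root_unity N i : C.
pose al (i : 'I_N) n : C := cconj (b (z i)) / N%:R * w i ^+ n.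
pose be (i : 'I_N) n : C := (cnorm (b (z i)) ^+ 2)%:C%C / N%:R * w i ^+ n.
pose D : C := ((1 - q ^+ N)^-1)%:C%C.
have zz i j : z i * cconj (z j) = q%:C%C * (w i * cconj (w j)).
  by rewrite /z /root_points cconjM mulrACA mulcconj.
have wwN i j : (w i * cconj (w j)) ^+ N = 1.
  by rewrite exprMn -cconjX !root_unityX// cconj1 mulr1.
have zd i : disc (z i) by rewrite /disc/= cnorm_root_points.
have term (i j : 'I_N) : b (z j) / N%:R * cconj (b (z i) / N%:R) * dBR_kernel b (z i) (z j) =
   D * \sum_(n < N) (q ^+ n)%:C%C * (al i n * cconj (al j n) - be i n * cconj (be j n)).
  rewrite /dBR_kernel zz (kernel_geometric (N := N))//; last first.
    by have := one_sub_mulconj_neq0 (zd i) (zd j); rewrite zz subr_eq0 eq_sym.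
  rewrite !mulrA -(mulrC D) -/D -!mulrA; congr (_ * _); rewrite !mulr_sumr; apply: eq_bigr => n _.
  rewrite /al /be !cconjM !cconjX !cconjV cconj_nat cconj_real cconjK -!mulcconj [(w i * _) ^+ n]exprMn.
  move: (b (z i)) (b (z j)) (w i) (w j) (_^-1) => bi bj wi wj m; ring.
rewrite /kform big_map big_enum.
under eq_bigr do rewrite big_map big_enum.
under eq_bigr do under eq_bigr do rewrite term.
under eq_bigr do rewrite -mulr_sumr.
rewrite -mulr_sumr real_complexM real_complex_sum; congr (_ * _).
under eq_bigr do rewrite exchange_big.
rewrite exchange_big; apply: eq_bigr => n _.
under eq_bigr do rewrite -mulr_sumr.
rewrite -mulr_sumr real_complexM; congr (_ * _).
under eq_bigr do rewrite sumrB.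
by rewrite sumrB !sum_conj_square; apply/esym; exact: rmorphB.
Qed.

(** The weights of the positive squares are raised to 1, and Parseval bounds their sum by 1. Of the
    negative squares only frequency 0 is kept, the squared mean of |b|^2, at least (1 - eta)^2; and
    1 - (1 - eta)^2 <= 2 eta. *)
Lemma knorm2_root_comb c N eta : disc c -> (0 < N)%N -> 0 <= eta <= 1 ->
  (forall z, cnorm z = cnorm c -> cnorm (b z) <= 1 /\ 1 - cnorm (b z) ^+ 2 <= eta) ->
  knorm2 b (root_comb c N) <= 2 * eta / (1 - (cnorm c ^+ 2) ^+ N).
Proof.
move=> cd N0 /andP[eta0 eta1] hb; rewrite knorm2E kform_root_comb// Re_real mulrC.
have q0 : 0 <= cnorm c ^+ 2 := sqr_ge0 _.
have q1 : cnorm c ^+ 2 < 1 by rewrite exprn_ilt1 ?cnorm_ge0.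
have N0' : 0 < N%:R :> R by rewrite ltr0n.
rewrite ler_wpM2r//; first by rewrite invr_ge0 subr_ge0 exprn_ile1// ltW.
set A := fun n : nat => cnorm (\sum_(i < N) cconj (b (root_points c N i)) / N%:R * root_unity N i ^+ n) ^+ 2.
set B := fun n : nat => cnorm (\sum_(i < N) (cnorm (b (root_points c N i)) ^+ 2)%:C%C / N%:R * root_unity N i ^+ n) ^+ 2.
have A0 n : 0 <= A n by exact: sqr_ge0.
have B0 n : 0 <= B n by exact: sqr_ge0.
have hz i := hb _ (cnorm_root_points c N i).
apply: le_trans (_ : \sum_(n < N) A n - B 0%N <= _).
  have -> : \sum_(n < N) (cnorm c ^+ 2) ^+ n * (A n - B n) =
     \sum_(n < N) (cnorm c ^+ 2) ^+ n * A n - \sum_(n < N) (cnorm c ^+ 2) ^+ n * B n.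
    by rewrite -sumrB; apply: eq_bigr => n _; rewrite mulrBr.
  apply: lerB.
    by apply: ler_sum => n _; rewrite ler_piMl// exprn_ile1// ltW.
  rewrite (bigD1 (Ordinal N0))//= expr0 mul1r lerDl sumr_ge0// => n _.
  by rewrite mulr_ge0// exprn_ge0.
have SA : \sum_(n < N) A n <= 1.
  rewrite (@discrete_parseval _ N (fun i : 'I_N => root_unity N i) (fun i : 'I_N => cconj (b (root_points c N i)) / N%:R)).
  - rewrite mulr_sumr; apply: le_trans (_ : \sum_(i < N) (N%:R^-1 : R) <= _).
      apply: ler_sum => i _; have [b1 _] := hz i.
      rewrite cnormM cnorm_conj cnormV cnorm_nat exprMn.
      apply: le_trans (_ : N%:R * (1 * N%:R^-1 ^+ 2) <= _).
        rewrite ler_pM2l// ler_wpM2r ?sqr_ge0//.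
        by rewrite exprn_ile1 ?cnorm_ge0.
      by rewrite mul1r expr2 mulrA mulfV ?gt_eqF// mul1r.
    by rewrite sumr_const card_ord -[leLHS]mulr_natl mulfV// gt_eqF.
  - by move=> i; exact: cnorm_root_unity.
  - by move=> i; exact: root_unityX.
  - exact: root_unity_inj.
have BE : B 0%N = (\sum_(i < N) cnorm (b (root_points c N i)) ^+ 2 / N%:R) ^+ 2.
  rewrite /B; under eq_bigr do rewrite expr0 mulr1 -real_complex_nat -real_complex_div.
  rewrite -real_complex_sum cnorm_real real_normK ?num_real//.
have SB : 1 - eta <= \sum_(i < N) cnorm (b (root_points c N i)) ^+ 2 / N%:R.
  apply: le_trans (_ : \sum_(i < N) (1 - eta) / N%:R <= _).
    by rewrite sumr_const card_ord -[leRHS]mulr_natl mulrCA mulfV ?gt_eqF// mulr1.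
  apply: ler_sum => i _; rewrite ler_wpM2r ?invr_ge0// ?(ltW N0')//.
  by have [_] := hz i; lra.
have : (1 - eta) ^+ 2 <= B 0%N.
  by rewrite BE lerXn2r ?nnegrE// ?subr_ge0// (le_trans _ SB)// subr_ge0.
have : 0 <= eta ^+ 2 by exact: sqr_ge0.
move: SA; rewrite sqrrB expr1n mul1r; lra.
Qed.

End roots_estimate.

(** * Averaging over rotates, and the contradiction *)

Section vanishing.
Context {R : realType}.
Local Notation C := R[i].
Context (b : C -> C) (hb : Hinf_ball b).

(* On [|c| = r], [conj (k_v (c w)) = c / (c - r^2 v conj w)]. *)
Lemma rotated_cauchy (r : R) (v w : C) : 0 < r -> r < 1 -> disc v -> cnorm w = 1 ->
  ccirc r (fun c => cconj (b (c * w)) * szego v (c * w)) /\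
  cmean r (fun c => cconj (b (c * w)) * szego v (c * w)) = cconj (b ((r ^+ 2)%:C%C * v)).
Proof.
move=> r0 r1 vd w1; have [hol _] := hb.
have ww : w * cconj w = 1 by rewrite mulcconj w1 expr1n.
have rot c : cnorm c <= r -> disc (c * w).
  by move=> cr; rewrite /disc/= cnormM w1 mulr1 (le_lt_trans cr).
have dmul c : is_cderiv (fun z => z * w) c w.
  by have := is_cderivM (is_cderiv_id c) (is_cderiv_cst w c); rewrite mul1r mulr0 addr0.
have db c : cnorm c <= r -> exists l, is_cderiv (fun z => b (z * w)) c l.
  move=> /rot cd; have [l dl] := hol _ cd.
  by exists (l * w); exact: (is_cderiv_comp (dmul c) dl).
have rr : `|r| = r by rewrite gtr0_norm.
have cb : ccirc r (fun c => b (c * w)).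
  by apply: ccirc_ccts => c; rewrite rr => cr; have [|l /is_cderiv_ccts] := db c; rewrite ?cr.
have ck : ccirc r (fun c => szego v (c * w)).
  apply: ccirc_ccts => c; rewrite rr => cr; have cd : disc (c * w) by apply: rot; rewrite cr.
  exact: is_cderiv_ccts (is_cderiv_comp (dmul c) (is_cderiv_szego vd cd)).
split; first by apply: ccircM => //; exact: ccirc_conj.
pose p : C := (r ^+ 2)%:C%C * v * cconj w.
have pr : cnorm p < r.
  rewrite !cnormM cnorm_conj w1 mulr1 cnorm_real ger0_norm ?sqr_ge0// expr2 -mulrA.
  rewrite gtr_pMr//; apply: mulr_ilt1 => //; [exact: ltW|exact: cnorm_ge0].
have pw : (r ^+ 2)%:C%C * v = p * w by rewrite /p -mulrA (mulrC (cconj w)) ww mulr1.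
have cE : ccirc r (fun c => b (c * w) * cconj (szego v (c * w))).
  by apply: ccircM => //; exact: ccirc_conj.
rewrite pw -(cauchy r0 pr db).
transitivity (cmean r (fun c => cconj (b (c * w) * cconj (szego v (c * w))))).
  by apply: eq_cmean => c _; rewrite cconjM cconjK.
rewrite cmean_conj//; congr cconj; apply: eq_cmean => c; rewrite rr => cr; congr (_ * _).
have c0 : c != 0 by rewrite -cnorm_gt0 cr.
have -> : c - p = c * (1 - v * cconj (c * w)).
  by rewrite /p -cr -mulcconj cconjM; ring.
by rewrite invfM mulrA mulfV// mul1r /szego cconjV cconjD cconj1 cconjN cconjM cconjK.
Qed.

Lemma root_mean_bound (r eta K : R) (v : C) : 0 < r -> r < 1 -> disc v -> 0 <= eta <= 1 -> 0 <= K ->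
  (forall t, in_disc t -> cnorm (\sum_(x <- t) cconj x.1 * szego v x.2) <= K * knorm b t) ->
  (forall z, cnorm z = r -> 1 - cnorm (b z) ^+ 2 <= eta) ->
  cnorm (b ((r ^+ 2)%:C%C * v)) <= 4 * K * Num.sqrt eta.
Proof.
move=> r0 r1 vd /andP[eta0 eta1] K0 hK heta; have [_ b1] := hb.
have r20 : 0 <= r ^+ 2 := sqr_ge0 r.
have r21 : r ^+ 2 < 1 by rewrite exprn_ilt1// ltW.
(* The denominator 1 - r^(2N) is then at least 1/2, so each combination has norm at most 2 sqrt eta;
   [cmean_norm_le] contributes the other factor 2 of the constant 4. *)
have [N N0 hN] : exists2 N, (0 < N)%N & (r ^+ 2) ^+ N <= 2^-1.
  have : (r ^+ 2) ^+ n @[n --> \oo] --> (0 : R) by apply: cvg_expr; rewrite ger0_norm.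
  move=> /cvgrPdist_le/(_ 2^-1 ltac:(by rewrite invr_gt0))[M _ hM].
  exists M.+1 => //; have := hM M.+1 (leqnSn M).
  by rewrite sub0r normrN ger0_norm// exprn_ge0.
pose F c := \sum_(i < N) N%:R^-1 * (cconj (b (c * root_unity N i)) * szego v (c * root_unity N i)).
have cF i : ccirc r (fun c => N%:R^-1 * (cconj (b (c * root_unity N i)) * szego v (c * root_unity N i))).
  have [h _] := rotated_cauchy r0 r1 vd (cnorm_root_unity N i).
  by apply: ccircM => //; exact: ccirc_cst.
(* Every rotate has the same mean, so the average over the [N] rotates keeps it. *)
have FE : cmean r F = cconj (b ((r ^+ 2)%:C%C * v)).
  rewrite /F cmean_sum => [|i]; last exact: cF.
  rewrite (eq_bigr (fun=> N%:R^-1 * cconj (b ((r ^+ 2)%:C%C * v)))) => [|i _].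
    by rewrite sumr_const card_ord -[LHS]mulr_natl mulrA mulfV ?mul1r// pnatr_eq0 -lt0n.
  by have [h <-] := rotated_cauchy r0 r1 vd (cnorm_root_unity N i); rewrite cmeanZ.
rewrite -cnorm_conj -FE.
have -> : 4 * K * Num.sqrt eta = 2 * (K * (2 * Num.sqrt eta)) by ring.
apply: cmean_norm_le; first exact: ccirc_sum.
move=> t _; set c := circ r t.
have cr : cnorm c = r by rewrite cnorm_circ gtr0_norm.
have cd : disc c by rewrite /disc/= cr.
have -> : F c = \sum_(x <- root_comb b c N) cconj x.1 * szego v x.2.
  rewrite /root_comb big_map big_enum; apply: eq_bigr => i _ /=.
  by rewrite cconjM cconjV cconj_nat mulrA (mulrC _^-1).
apply: le_trans (hK _ (@in_disc_root_comb _ b c N cd)) _; rewrite ler_wpM2l//.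
have k2 : knorm2 b (root_comb b c N) <= 2 * eta / (1 - (cnorm c ^+ 2) ^+ N).
  apply: knorm2_root_comb => //; first by rewrite eta0.
  by move=> z zc; split; [apply: b1; rewrite /disc/= zc|apply: heta; rewrite zc].
rewrite -(@ler_pXn2r _ 2)// ?nnegrE ?sqrtr_ge0 ?mulr_ge0 ?sqrtr_ge0//.
rewrite knorm_sqr//; last exact: in_disc_root_comb.
rewrite exprMn sqr_sqrtr//; apply: le_trans k2 _.
rewrite cr ler_pdivrMr; last by move: hN; lra.
have : eta * (r ^+ 2) ^+ N <= eta * 2^-1 by rewrite ler_wpM2l.
lra.
Qed.

(** A single [v] suffices, chosen so near the circle that |b v|^2 > 1/2. The constant [K] depends on
    [v] but not on the radius, so [r] may be taken close to 1 afterwards. *)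
Lemma szego_notin_dBR :
  (forall eps : R, 0 < eps -> exists2 d : R, 0 < d &
     forall w, disc w -> 1 - cnorm w < d -> 1 - cnorm (b w) ^+ 2 < eps) ->
  ~ (forall v, disc v -> dBR_space b (szego v)).
Proof.
move=> bd inH.
have [d d0 hd] := bd 2^-1 ltac:(by rewrite invr_gt0).
pose s : R := 1 - Num.min d 1 / 2.
have m0 : 0 < Num.min d 1 by rewrite lt_min d0 ltr01.
have md : Num.min d 1 <= d by rewrite ge_min lexx.
have m1 : Num.min d 1 <= 1 by rewrite ge_min lexx orbT.
have sN : cnorm (s%:C%C : C) = s by rewrite cnorm_real ger0_norm// /s; lra.
pose v : C := s%:C%C.
have vd : disc v by rewrite /disc/= sN /s; lra.
have bv : 1 - cnorm (b v) ^+ 2 < 2^-1 by apply: hd => //; rewrite sN /s; lra.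
have [K K0 hK] := dBR_duality hb (inH v vd).
(* With 1 - |b|^2 below [q ^+ 2] on the circle of radius [r], the bound 4 K q on |b (r^2 v)| is at
   most 1/4. *)
pose q : R := 1 / (16 * (K + 1)).
have q0 : 0 < q by rewrite divr_gt0// mulr_gt0// ltr_wpDl.
have q1 : q <= 1 by rewrite ler_pdivrMr ?mulr_gt0// ?ltr_wpDl//; lra.
have [d1 d10 hd1] := bd (q ^+ 2) (exprn_gt0 2 q0).
have [hol _] := hb; have [l /is_cderiv_ccts cb] := hol v vd.
have [d2 d20 hd2] := cb 4^-1 ltac:(by rewrite invr_gt0).
(* The point r^2 v is within 1 - r^2 < 2 h <= d2 of [v], so [b] differs there from [b v] by less
   than 1/4; then |b v| <= 1/2, against |b v|^2 > 1/2. *)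
pose h : R := Num.min (Num.min d1 d2) 1 / 2.
have hh : [/\ 0 < h, h < d1, 2 * h <= d2 & h < 1].
  pose k : R := Num.min (Num.min d1 d2) 1; rewrite /h -/k.
  have k0 : 0 < k by rewrite !lt_min d10 d20 ltr01.
  have k1 : k <= d1 by rewrite !ge_min lexx.
  have k2 : k <= d2 by rewrite !ge_min lexx orbT.
  have k3 : k <= 1 by rewrite ge_min lexx orbT.
  by clear -k0 k1 k2 k3; split; lra.
have [h0 h1 h2 hlt1] := hh.
pose r := 1 - h; have r0 : 0 < r by rewrite /r; lra.
have r1 : r < 1 by rewrite /r; lra.
have hq : 0 <= q ^+ 2 <= 1 by rewrite sqr_ge0 exprn_ile1// ltW.
have := @root_mean_bound r (q ^+ 2) K v r0 r1 vd hq K0 hK.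
have -> : Num.sqrt (q ^+ 2) = q by rewrite sqrtr_sqr gtr0_norm.
move=> /(_ _)H.
have {}H : cnorm (b ((r ^+ 2)%:C%C * v)) <= 4 * K * q.
  apply: H => z zr; apply/ltW/hd1; first by rewrite /disc/= zr.
  by rewrite zr /r; lra.
have Kq : 4 * K * q <= 4^-1.
  rewrite /q mulrA ler_pdivrMr ?mulr_gt0// ?ltr_wpDl//; lra.
have /hd2 : cnorm ((r ^+ 2)%:C%C * v - v) < d2.
  have -> : (r ^+ 2)%:C%C * v - v = (r ^+ 2 - 1)%:C%C * v.
    by rewrite [X in _ = X * _](rmorphB (real_complex R)) mulrBl mul1r.
  have r2 : 0 <= r ^+ 2 <= 1 by rewrite sqr_ge0 exprn_ile1// ltW.
  rewrite cnormM cnorm_real ler0_norm ?subr_le0; last by case/andP: r2.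
  apply: le_lt_trans (_ : - (r ^+ 2 - 1) < _).
    by rewrite ler_piMr ?(ltW vd)// oppr_ge0 subr_le0; case/andP: r2.
  have : 0 < h ^+ 2 by exact: exprn_gt0.
  by rewrite /r sqrrB; move: h2; clear; lra.
rewrite /= => H2.
have H3 := cnorm_sub_ge (b v) (b ((r ^+ 2)%:C%C * v)).
rewrite cdistC in H3.
have H4 : cnorm (b v) <= 2^-1 by move: H H2 H3 Kq; clear; lra.
have : cnorm (b v) ^+ 2 <= 2^-1 ^+ 2 by rewrite lerXn2r ?nnegrE ?cnorm_ge0// invr_ge0.
move: bv; rewrite exprVn; clear; lra.
Qed.

End vanishing.

Theorem theorem5p2 (R : realType) (m : nat) (mu : nat -> finite_measure_R2 R)
    (b : R[i] -> R[i]) :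
  (2 <= m)%N ->
  (forall j : nat, (1 <= j <= m)%N -> on_circle (mu j)) ->
  Hinf_ball b ->
  (forall f : R[i] -> R[i], Hvec m mu f <-> dBR_space b f) ->
  forall j : nat, (2 <= j <= m)%N -> zero_measure (mu j).
Proof.
move=> _ hcirc hb hH j /andP[j2 jm]; apply: contrapT => nz.
have j1m : (1 <= j <= m)%N by rewrite jm andbT ltnW.
apply: (szego_notin_dBR hb) => [|v vd]; last by apply/hH; exact: Hvec_szego.
apply: boundary_modulus => // f /hH/(_ j j1m)[_ /(_ nz)[hol fin]].
exact: dirichlet_growth j2 (hcirc j j1m) nz hol fin.
Qed.
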